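(* Let $n\ge 3$. There exist exactly $n-1$ families of simplices in $\mathbb{E}^n$ generating the group $\widetilde B_n$ (families being counted up to similarity). They are parametrized by the integers $N$ with $2\le N\le n$, and the simplices of the family with parameter $N$ are described as follows. Let $\Gamma_N$ be the connected graph with $n$ nodes and $n$ edges consisting of a cycle with $N$ nodes (a pair of nodes joined by two edges if $N=2$) together with a simple path with $n-N$ edges having one end at a node $c$ of the cycle and otherwise disjoint from the cycle; the other end $u$ of the path is marked (if $N=n$ the path is trivial and $u=c$ is a node of the cycle). The $n+1$ facets of the simplex are in bijection with the $n$ edges of $\Gamma_N$ together with one further element $*$ corresponding to the marked node $u$, and the dihedral angles are: (i) between the facet $*$ and the facet of an edge $e$: $\pi/4$ if $e$ is incident to $u$, and $\pi/2$ otherwise; (ii) between the facets of two distinct edges $e,e'$: $\pi/2$ if $e,e'$ have no common node or have two common nodes; if they have exactly one common node, the angle is $2\pi/3$ when $e$ and $e'$ are both edges of the cycle and their common node is $c$, and $\pi/3$ in all other cases. Accordingly, the family diagram has as nodes the edges of $\Gamma_N$ and $*$; two edges are joined by a simple edge iff they have exactly one common node, and $*$ is joined by a $2$-fold edge with exactly the edges of $\Gamma_N$ incident to $u$.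
   Context: For a (compact, non-degenerate) simplex $P$ in Euclidean space $\mathbb{E}^n$, $G_P$ denotes the group generated by the reflections in the facets of $P$. A simplex is a Coxeter simplex if all its dihedral angles are of the form $\pi/k$, $k\ge2$ an integer; its Coxeter diagram has one node per facet, two nodes being joined by a $(k-2)$-fold edge if the facets form the angle $\pi/k$ (no edge if orthogonal). For $n\ge 3$, $\widetilde B_n$ is the Euclidean Coxeter simplex whose Coxeter diagram is the usual affine diagram with $n+1$ nodes: a chain with a $2$-fold edge at one end and a fork of two simple edges at the other end. $P$ is said to generate $\widetilde B_n$ if $G_P$ is discrete and a fundamental chamber of $G_P$ is a Coxeter simplex $\widetilde B_n$ (of any size). $P$ itself is not assumed to be a Coxeter simplex. If $f_0,\dots,f_n$ are the outward unit normals to the facets of $P$, the family of $P$ is the set of all simplices in $\mathbb{E}^n$ having the same set of vectors $\{\pm f_0,\dots,\pm f_n\}$ as facet normals; any two simplices of one family are similar. Families are classified up to similarity, so counting families means counting similarity classes of simplices. The family diagram of a simplex whose dihedral angles all have the form $\pi/k$ or $\pi(k-1)/k$ has one node per facet, two nodes being joined by a $(k-2)$-fold edge if the corresponding facets form an angle $\pi/k$ or $\pi(k-1)/k$ (no edge if orthogonal). *)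

(* Defs.v *)
From HB Require Import structures.
From mathcomp Require Export all_boot all_order all_algebra all_fingroup.
From mathcomp Require Export all_classical all_reals all_analysis.

Set Implicit Arguments.
Unset Strict Implicit.
Unset Printing Implicit Defensive.

Import Order.TTheory GRing.Theory Num.Theory.
Export numFieldNormedType.Exports.

#[global] Open Scope classical_set_scope.
#[global] Open Scope ring_scope.

Section Euclidean.
Variables (R : realType) (n : nat).
Implicit Types x y f : 'rV[R]_n.

Definition dot x y : R := (x *m y^T) 0 0.

(* The norm that the library puts on row vectors is the sup norm. *)
Definition enorm x : R := Num.sqrt (dot x x).

Definition is_similarity (phi : 'rV[R]_n -> 'rV[R]_n) : Prop :=
  exists2 r : R, 0 < r &
    forall x y, enorm (phi x - phi y) = r * enorm (x - y).

(* Reflection in the hyperplane [dot f x = c], for a unit vector f. *)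
Definition hyp_refl f (c : R) : 'rV[R]_n -> 'rV[R]_n :=
  fun x => x - (2 * (dot f x - c)) *: f.

End Euclidean.

Inductive generated_group (T : Type) (S : set (T -> T)) : (T -> T) -> Prop :=
| gen_mem s : S s -> generated_group S s
| gen_id : generated_group S idfun
| gen_comp g h :
    generated_group S g -> generated_group S h -> generated_group S (g \o h)
| gen_inv g h :
    generated_group S g -> cancel g h -> cancel h g -> generated_group S h.

Section ReflectionGroups.
Variables (R : realType) (n : nat).
Implicit Type G : set ('rV[R]_n -> 'rV[R]_n).

(* On isometries of Euclidean space, pointwise convergence induces the usual
   topology of the isometry group. *)
Definition discrete_group G : Prop :=
  let G' : set {ptws 'rV[R]_n -> 'rV[R]_n} := G in isolated G' = G'.

Definition mirrors G : set 'rV[R]_n :=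
  [set x | exists f c, [/\ dot f f = 1, G (hyp_refl f c) & dot f x = c]].

(* Chambers are closed. *)
Definition is_chamber G (C : set 'rV[R]_n) : Prop :=
  exists2 x, ~ mirrors G x &
    C = closure (connected_component (~` mirrors G) x).

End ReflectionGroups.

(* Facets are indexed by the opposite vertices. *)
Record simplex (R : realType) (n : nat) := Simplex {
  vertex : 'I_n.+1 -> 'rV[R]_n;
  vertex_affine_independent : forall t : 'I_n.+1 -> R,
    \sum_i t i = 0 -> \sum_i t i *: vertex i = 0 -> forall i, t i = 0
}.

Section Simplices.
Variables (R : realType) (n : nat).
Implicit Types P Q D : simplex R n.

Definition simplex_set P : set 'rV[R]_n :=
  [set x | exists t : 'I_n.+1 -> R,
     [/\ forall i, 0 <= t i, \sum_i t i = 1 & x = \sum_i t i *: vertex P i]].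

Definition is_outward_unit_normal P (i : 'I_n.+1) (f : 'rV[R]_n) : Prop :=
  [/\ dot f f = 1,
      forall j k, j != i -> k != i -> dot f (vertex P j - vertex P k) = 0
    & forall j, j != i -> dot f (vertex P i - vertex P j) < 0].

(* For n > 0 exactly one vector satisfies the predicate. *)
Definition outward_normal P (i : 'I_n.+1) : 'rV[R]_n :=
  xget 0 [set f | is_outward_unit_normal P i f].

Definition dihedral_angle P (i j : 'I_n.+1) : R :=
  pi - acos (dot (outward_normal P i) (outward_normal P j)).

Definition facet_reflections P : set ('rV[R]_n -> 'rV[R]_n) :=
  [set s | exists i j, j != i /\
     s = hyp_refl (outward_normal P i) (dot (outward_normal P i) (vertex P j))].

(* The group G_P. *)
Definition reflection_group P : set ('rV[R]_n -> 'rV[R]_n) :=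
  generated_group (facet_reflections P).

Definition is_coxeter_simplex P : Prop :=
  forall i j, i != j ->
    exists2 k : nat, (2 <= k)%N & dihedral_angle P i j = pi / k%:R.

(* The nodes i and j of the Coxeter diagram are joined by an m-fold edge
   (by no edge if m = 0). *)
Definition coxeter_diagram P (i j : 'I_n.+1) (m : nat) : Prop :=
  exists k : nat,
    [/\ (2 <= k)%N, dihedral_angle P i j = pi / k%:R & m = (k - 2)%N].

Definition family_diagram P (i j : 'I_n.+1) (m : nat) : Prop :=
  exists k : nat,
    [/\ (2 <= k)%N,
        dihedral_angle P i j = pi / k%:R
          \/ dihedral_angle P i j = pi * (k - 1)%:R / k%:R
      & m = (k - 2)%N].

Definition facet_normals_pm P : set 'rV[R]_n :=
  [set f | exists i, f = outward_normal P i \/ f = - outward_normal P i].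

Definition family P : set (simplex R n) :=
  [set Q | facet_normals_pm Q = facet_normals_pm P].

Definition is_family (F : set (simplex R n)) : Prop := exists P, F = family P.

Definition similar P Q : Prop :=
  exists2 phi, is_similarity phi & phi @` simplex_set P = simplex_set Q.

Definition similarity_class P : set (simplex R n) := [set Q | similar P Q].

(* Edge multiplicities of the affine diagram B~_n (n >= 3) with nodes 0..n:
   the chain 1 - 2 - ... - (n-1) = n, whose last edge is 2-fold, and the node 0
   joined to the node 2. *)
Definition Btilde_mult (i j : nat) : nat :=
  let: (a, b) := (minn i j, maxn i j) in
  if (a == n.-1) && (b == n) then 2%N
  else if ((0 < a)%N && (b == a.+1)) || ((a == 0%N) && (b == 2%N)) then 1%N
  else 0%N.

Definition is_Btilde_simplex D : Prop :=
  is_coxeter_simplex D /\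
  exists s : 'S_n.+1, forall i j : 'I_n.+1, i != j ->
    coxeter_diagram D (s i) (s j) (Btilde_mult i j).

Definition generates_Btilde P : Prop :=
  discrete_group (reflection_group P) /\
  exists2 D, is_Btilde_simplex D &
    is_chamber (reflection_group P) (simplex_set D).

End Simplices.

(* The multigraph Gamma_N (2 <= N <= n), with nodes and edges both indexed by
   'I_n: the edge e < n-1 joins the nodes e and e+1, and the edge n-1 joins the
   nodes 0 and N-1.  The cycle passes through the nodes 0..N-1, and the path
   runs from c = N-1 to u = n-1. *)
Section Gamma.
Variables (n N : nat).
Implicit Types (e v : 'I_n) (x y : option 'I_n).

Definition gamma_incident e v : bool :=
  if val e == n.-1 then (val v == 0%N) || (val v == N.-1)
  else (val v == val e) || (val v == (val e).+1).

Definition gamma_is_c v : bool := val v == N.-1.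
Definition gamma_is_u v : bool := val v == n.-1.

Definition gamma_cycle_edge e : bool := (val e == n.-1) || (val e < N.-1)%N.

Definition gamma_common e e' : {set 'I_n} :=
  [set v | gamma_incident e v && gamma_incident e' v].

Definition gamma_at_u e : bool :=
  [exists v, gamma_is_u v && gamma_incident e v].

(* The facets are indexed by [option 'I_n]: [Some e] is the facet of the edge e
   and [None] is the facet *.  The diagonal value is irrelevant. *)
Definition gamma_angle (R : realType) x y : R :=
  match x, y with
  | None, None => 0
  | None, Some e | Some e, None => if gamma_at_u e then pi / 4 else pi / 2
  | Some e, Some e' =>
      if #|gamma_common e e'| != 1%N then pi / 2
      else if [&& gamma_cycle_edge e, gamma_cycle_edge e'
                & [forall v in gamma_common e e', gamma_is_c v]]
           then 2 * pi / 3 else pi / 3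
  end.

Definition gamma_mult x y : nat :=
  match x, y with
  | None, None => 0%N
  | None, Some e | Some e, None => if gamma_at_u e then 2%N else 0%N
  | Some e, Some e' => if #|gamma_common e e'| == 1%N then 1%N else 0%N
  end.

Definition gamma_facets (R : realType) (P : simplex R n)
    (lab : option 'I_n -> 'I_n.+1) : Prop :=
  bijective lab /\
  forall x y, x != y -> dihedral_angle P (lab x) (lab y) = gamma_angle R x y.

End Gamma.

(* Main.v *)
(** Let [G] be the group of a simplex [P] generating B~_n, with chamber [D].
    Mirrors of [G] close to the centre of a facet of [D] have [D] on one side,
    so by discreteness the facet reflections of [D] lie in [G]; no mirror meets
    the interior of [D].  In coordinates where [D] is the standard alcove, a
    mirror that is not of the form [a.x = m] with [a] a root of B_n and [m] an
    integer would contain a point off all these hyperplanes, and the facet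
    reflections would move it into the interior of [D].  Hence the facets of
    [P] are orthogonal to roots.

    View a root [+-e_i +- e_j] as an edge and [+-e_i] as a half-edge of a signed
    graph.  The n + 1 normals span the space and have a single linear relation,
    whose coefficients are all nonzero, so the graph is a handcuff.  There is a
    half-edge, since otherwise linear parts would preserve the product of the
    coordinates.  Following positive coefficients from it one reads a path that
    ends in an unbalanced cycle; ending in a second half-edge is excluded,
    because [G] would preserve [p + 2 Z^n] for a vertex [p] of [P].  This
    determines the Gram matrix of the normals, that is the similarity class,
    up to the length N of the cycle.

    Conversely the simplex [x_0 >= ... >= x_(n-1) >= 0, x_0 + x_(N-1) <= 1] has
    the required angles and its group is that of the alcove N = 2.  Finally N is
    recovered from the relation between the unit normals: it is the number of
    minimal coefficients. *)

Require Import Defs.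
From mathcomp Require Import ring lra zify.

Set Implicit Arguments.
Unset Strict Implicit.
Unset Printing Implicit Defensive.
Import Order.TTheory GRing.Theory Num.Theory.

(** * Inner product and reflections *)

(** The Gram matrix of the outward normals carries the whole argument. The normals satisfy a single
    relation up to scale, with the inverse altitudes as coefficients, so equal Gram matrices mean
    similar simplices; this serves both to move the chamber onto the standard alcove and to count
    the families.

    The tessellation by chambers is never built. To see that a facet mirror of P is a root
    hyperplane, a generic point of it is reflected towards the alcove; a positive distance to all
    integer root hyperplanes at once makes this stop after finitely many steps.

    Directions of normals alone cannot single out the B~ shapes: the alcoves of types C~ and D~ are
    handcuffs as well, with half-edges at both ends and with two unbalanced cycles respectively.
    Hence the two invariants, the product of coordinates against D~ and the coset of 2 Z^n against
    C~; both contradict the fact that the group contains every reflection of the B~ alcove, and the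
    second one depends on the levels of the facets. *)

Section Dot.
Variables (R : realType) (n : nat).
Implicit Types x y z : 'rV[R]_n.

Lemma dotE x y : dot x y = \sum_i x 0 i * y 0 i.
Proof. by rewrite /dot mxE; apply: eq_bigr => i _; rewrite mxE. Qed.

Lemma dotC x y : dot x y = dot y x.
Proof. by rewrite !dotE; apply: eq_bigr => i _; rewrite mulrC. Qed.

Lemma dotDl x y z : dot (x + y) z = dot x z + dot y z.
Proof. by rewrite /dot mulmxDl mxE. Qed.

Lemma dotZl a x y : dot (a *: x) y = a * dot x y.
Proof. by rewrite /dot -scalemxAl mxE. Qed.

Lemma dotNl x y : dot (- x) y = - dot x y.
Proof. by rewrite -scaleN1r dotZl mulN1r. Qed.

Lemma dotBl x y z : dot (x - y) z = dot x z - dot y z.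
Proof. by rewrite dotDl dotNl. Qed.

Lemma dotDr x y z : dot x (y + z) = dot x y + dot x z.
Proof. by rewrite dotC dotDl !(dotC x). Qed.

Lemma dotZr a x y : dot x (a *: y) = a * dot x y.
Proof. by rewrite dotC dotZl dotC. Qed.

Lemma dotNr x y : dot x (- y) = - dot x y.
Proof. by rewrite dotC dotNl dotC. Qed.

Lemma dotBr x y z : dot x (y - z) = dot x y - dot x z.
Proof. by rewrite dotDr dotNr. Qed.

Lemma dot0l x : dot 0 x = 0.
Proof. by rewrite /dot mul0mx mxE. Qed.

Lemma dot0r x : dot x 0 = 0.
Proof. by rewrite dotC dot0l. Qed.

Lemma dot_suml (I : Type) (s : seq I) (P : pred I) (F : I -> 'rV[R]_n) x :
  dot (\sum_(i <- s | P i) F i) x = \sum_(i <- s | P i) dot (F i) x.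
Proof. by rewrite /dot mulmx_suml summxE. Qed.

Lemma dot_sumr (I : Type) (s : seq I) (P : pred I) (F : I -> 'rV[R]_n) x :
  dot x (\sum_(i <- s | P i) F i) = \sum_(i <- s | P i) dot x (F i).
Proof. by rewrite dotC dot_suml; apply: eq_bigr => i _; rewrite dotC. Qed.

Definition dotrE := (dotDl, dotDr, dotBl, dotBr, dotZl, dotZr, dotNl, dotNr).

Lemma dot_ge0 x : 0 <= dot x x.
Proof. by rewrite dotE sumr_ge0 // => i _; rewrite -expr2 sqr_ge0. Qed.

Lemma dot_eq0 x : (dot x x == 0) = (x == 0).
Proof.
apply/eqP/eqP => [|->]; last by rewrite dot0l.
rewrite dotE => /eqP; rewrite psumr_eq0 => [/allP h|i _]; last first.
  by rewrite -expr2 sqr_ge0.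
apply/rowP => i; rewrite mxE; apply/eqP.
by have := h i (mem_index_enum _); rewrite /= mulf_eq0 orbb.
Qed.

Lemma dot_gt0 x : x != 0 -> 0 < dot x x.
Proof. by rewrite lt_def dot_eq0 dot_ge0 andbT. Qed.

Lemma dot_inj x y : (forall z, dot x z = dot y z) -> x = y.
Proof.
move=> h; apply/eqP; rewrite -subr_eq0 -dot_eq0 dotBl h subrr //.
Qed.

Lemma dot_delta x i : dot x (delta_mx 0 i) = x 0 i.
Proof.
rewrite dotE (bigD1 i) //= mxE !eqxx mulr1 big1 ?addr0 // => j ji.
by rewrite mxE eqxx /= (negbTE ji) mulr0.
Qed.

Lemma enorm_ge0 x : 0 <= enorm x.
Proof. exact: sqrtr_ge0. Qed.

Lemma sqr_enorm x : enorm x ^+ 2 = dot x x.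
Proof. by rewrite sqr_sqrtr // dot_ge0. Qed.

Lemma enorm_eq0 x : (enorm x == 0) = (x == 0).
Proof. by rewrite -(sqrf_eq0 (enorm x)) sqr_enorm dot_eq0. Qed.

Lemma enorm_gt0 x : x != 0 -> 0 < enorm x.
Proof. by rewrite lt_def enorm_eq0 enorm_ge0 andbT. Qed.

Lemma enormZ a x : enorm (a *: x) = `|a| * enorm x.
Proof. by rewrite /enorm dotZl dotZr mulrA -expr2 sqrtrM ?sqr_ge0 // sqrtr_sqr. Qed.

Lemma enormN x : enorm (- x) = enorm x.
Proof. by rewrite -scaleN1r enormZ normrN1 mul1r. Qed.

Lemma cauchy_schwarz x y : `|dot x y| <= enorm x * enorm y.
Proof.
have [->|x0] := eqVneq x 0; first by rewrite dot0l normr0 mulr_ge0 // enorm_ge0.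
rewrite -(@ler_pXn2r _ 2) ?nnegrE ?mulr_ge0 ?enorm_ge0 //.
rewrite exprMn !sqr_enorm real_normK ?num_real //.
have := dot_ge0 (dot x x *: y - dot x y *: x).
have -> : dot (dot x x *: y - dot x y *: x) (dot x x *: y - dot x y *: x) =
  dot x x * (dot x x * dot y y - dot x y ^+ 2).
  by rewrite !dotrE (dotC y x); ring.
by rewrite pmulr_rge0 ?dot_gt0 // subr_ge0.
Qed.

Lemma enormD x y : enorm (x + y) <= enorm x + enorm y.
Proof.
rewrite -(@ler_pXn2r _ 2) ?nnegrE ?addr_ge0 ?enorm_ge0 //.
rewrite sqr_enorm sqrrD !sqr_enorm !dotrE (dotC y x).
have := le_trans (ler_norm _) (cauchy_schwarz x y); lra.
Qed.

Lemma enorm_sum (I : Type) (s : seq I) (P : pred I) (F : I -> 'rV[R]_n) :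
  enorm (\sum_(i <- s | P i) F i) <= \sum_(i <- s | P i) enorm (F i).
Proof.
elim/big_rec2: _ => [|i a b _ h]; first by rewrite /enorm dot0l sqrtr0.
by apply: le_trans (enormD _ _) _; rewrite lerD2l.
Qed.

Lemma coord_le_enorm x i : `|x 0 i| <= enorm x.
Proof.
rewrite -(@ler_pXn2r _ 2) ?nnegrE ?enorm_ge0 // sqr_enorm real_normK ?num_real //.
rewrite dotE (bigD1 i) //= expr2 lerDl sumr_ge0 // => j _.
by rewrite -expr2 sqr_ge0.
Qed.

Lemma enorm_le_sum x : enorm x <= \sum_i `|x 0 i|.
Proof.
have -> : enorm x = enorm (\sum_i x 0 i *: (delta_mx 0 i : 'rV[R]_n)).
  by rewrite -row_sum_delta.
apply: le_trans (enorm_sum _ _ _) _; apply: ler_sum => i _.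
rewrite enormZ /enorm dot_delta mxE !eqxx sqrtr1 mulr1 //.
Qed.

Lemma dot_le1 x y : dot x x = 1 -> dot y y = 1 -> -1 <= dot x y <= 1.
Proof.
move=> hx hy; rewrite -ler_norml; have := cauchy_schwarz x y.
by rewrite /enorm hx hy sqrtr1 mulr1.
Qed.

Lemma dot_mulmx (A : 'M[R]_n) r x y : A *m A^T = r%:M ->
  dot (x *m A) (y *m A) = r * dot x y.
Proof.
move=> hA; rewrite /dot trmx_mul mulmxA -(mulmxA x) hA mul_mx_scalar.
by rewrite -scalemxAl mxE.
Qed.

Lemma dot_mulmxl (A : 'M[R]_n) x y : dot (x *m A) y = dot x (y *m A^T).
Proof. by rewrite /dot trmx_mul trmxK mulmxA. Qed.

(** Normals may have any length, so that gradients of barycentric coordinates and roots of square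
    length 1 or 2 serve directly; by [rflZ] only the hyperplane matters. *)
Definition rfl (a : 'rV[R]_n) (k : R) x := x - (2 * (dot a x - k) / dot a a) *: a.

Lemma hyp_reflE f c : dot f f = 1 -> hyp_refl f c = rfl f c.
Proof. by move=> hf; apply/funext => x; rewrite /hyp_refl /rfl hf divr1. Qed.

Lemma rflZ t a k : t != 0 -> rfl (t *: a) (t * k) = rfl a k.
Proof.
move=> t0; have [->|a0] := eqVneq a 0.
  by rewrite scaler0; apply/funext => x; rewrite /rfl !scaler0.
apply/funext => x; rewrite /rfl !dotrE scalerA; congr (_ - _ *: _).
have d0 : dot a a != 0 by rewrite dot_eq0.
by field; apply/andP.
Qed.

Lemma rfl_sub a k x y : rfl a k x - rfl a k y =
  (x - y) - (2 * dot a (x - y) / dot a a) *: a.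
Proof.
by rewrite /rfl dotBr; apply/rowP => i; rewrite !mxE; ring.
Qed.

Lemma rflK a k : a != 0 -> involutive (rfl a k).
Proof.
move=> a0 x; rewrite /rfl !dotrE -addrA -opprD -scalerDl.
have d0 : dot a a != 0 by rewrite dot_eq0.
by rewrite [X in X *: _](_ : _ = 0) ?scale0r ?subr0 //; field.
Qed.

Lemma dot_rfl a k x y : a != 0 ->
  dot (rfl a k x - rfl a k y) (rfl a k x - rfl a k y) = dot (x - y) (x - y).
Proof.
move=> a0; rewrite rfl_sub; move: (x - y) => z.
have d0 : dot a a != 0 by rewrite dot_eq0.
by rewrite !(dotBl, dotBr) !dotrE (dotC z a); field.
Qed.

Lemma enorm_rfl a k x y : a != 0 ->
  enorm (rfl a k x - rfl a k y) = enorm (x - y).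
Proof. by move=> a0; rewrite /enorm dot_rfl. Qed.

Lemma rfl_conj (A : 'M[R]_n) (s : R) (b : 'rV[R]_n) a k x : s != 0 ->
  A *m A^T = s%:M ->
  rfl (a *m A) (s * k + dot (a *m A) b) (x *m A + b) = rfl a k x *m A + b.
Proof.
move=> s0 hA; rewrite /rfl dotDr !(dot_mulmx _ _ hA) mulmxBl addrAC -scalemxAl.
congr (_ - _ *: _ + _).
rewrite opprD addrACA subrr addr0 -mulrBr.
have [->|a0] := eqVneq a 0; first by rewrite !dot0l !mulr0 invr0 !mulr0.
have d0 : dot a a != 0 by rewrite dot_eq0.
by field; apply/andP.
Qed.

End Dot.

(** * Barycentric coordinates and normals *)

Section Barycentric.
Variables (R : realType) (n : nat).
Implicit Types (P : simplex R n) (x y z : 'rV[R]_n).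

(** Homogeneous coordinates: the leading ones turn affine independence into invertibility, and
    barycentric coordinates into a product with the inverse matrix. *)
Definition vertex_mx P : 'M[R]_(n.+1) :=
  \matrix_i row_mx (1 : 'rV[R]_1) (vertex P i).

Lemma vertex_mx_unit P : vertex_mx P \in unitmx.
Proof.
rewrite -row_free_unit; apply/inj_row_free => t ht.
have h : \sum_i t 0 i *: row_mx (1 : 'rV[R]_1) (vertex P i) = 0.
  rewrite -[RHS]ht; apply/rowP => j; rewrite mxE summxE.
  by apply: eq_bigr => i _; rewrite !mxE.
apply/rowP => i; rewrite mxE; apply: (@vertex_affine_independent _ _ P (fun i => t 0 i)).
  have := congr1 (fun v : 'rV[R]_(1 + n) => v 0 (lshift n 0)) h.
  rewrite [RHS]mxE summxE => e; rewrite -[RHS]e; apply: eq_bigr => k _.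
  by rewrite mxE row_mxEl mxE eqxx mulr1.
apply/rowP => j; have := congr1 (fun v : 'rV[R]_(1 + n) => v 0 (rshift 1 j)) h.
rewrite [RHS]mxE summxE => e; rewrite [RHS]mxE -[RHS]e summxE; apply: eq_bigr => k _.
by rewrite !mxE (unsplitK (inr j)).
Qed.

Definition bary P i x : R := (row_mx (1 : 'rV[R]_1) x *m invmx (vertex_mx P)) 0 i.

(* The gradient of [bary P i]. *)
Definition bdir P i : 'rV[R]_n := \row_j (invmx (vertex_mx P)) (rshift 1 j) i.

Lemma bary_vertex P i j : bary P i (vertex P j) = (i == j)%:R.
Proof.
rewrite /bary; have -> : row_mx 1 (vertex P j) = row j (vertex_mx P).
  by rewrite rowK.
by rewrite -row_mul mulmxV ?vertex_mx_unit // !mxE eq_sym.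
Qed.

Lemma bary_row P x : (\row_i bary P i x) *m vertex_mx P = row_mx (1 : 'rV[R]_1) x.
Proof.
have -> : \row_i bary P i x = row_mx (1 : 'rV[R]_1) x *m invmx (vertex_mx P).
  by apply/rowP => i; rewrite mxE.
by rewrite mulmxKV // vertex_mx_unit.
Qed.

Lemma sum_bary P x : \sum_i bary P i x = 1.
Proof.
have := congr1 (fun v : 'rV[R]_(1 + n) => v 0 (lshift n 0)) (bary_row P x).
rewrite row_mxEl mxE [RHS]mxE eqxx => e; rewrite -[RHS]e; apply: eq_bigr => i _.
by rewrite !mxE (unsplitK (inl _)) mxE eqxx mulr1.
Qed.

Lemma bary_comb P x : \sum_i bary P i x *: vertex P i = x.
Proof.
apply/rowP => j.
have := congr1 (fun v : 'rV[R]_(1 + n) => v 0 (rshift 1 j)) (bary_row P x).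
rewrite row_mxEr mxE => <-; rewrite summxE; apply: eq_bigr => i _.
by rewrite !mxE (unsplitK (inr _)).
Qed.

Lemma baryD P i x z : bary P i (x + z) = bary P i x + dot (bdir P i) z.
Proof.
rewrite /bary !mxE !big_split_ord /= -addrA; congr (_ + _).
  by apply: eq_bigr => j _; rewrite !row_mxEl.
rewrite dotE -big_split; apply: eq_bigr => j _ /=.
by rewrite !row_mxEr !mxE mulrDl; congr (_ + _); rewrite mulrC.
Qed.

Lemma baryE P i x : bary P i x = bary P i 0 + dot (bdir P i) x.
Proof. by rewrite -baryD add0r. Qed.

Lemma baryB P i x y : bary P i x - bary P i y = dot (bdir P i) (x - y).
Proof. by rewrite (baryE P i x) (baryE P i y) dotBr; lra. Qed.

Lemma bary_unique P (t : 'I_n.+1 -> R) x : \sum_i t i = 1 ->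
  x = \sum_i t i *: vertex P i -> forall i, bary P i x = t i.
Proof.
move=> ht hx i; apply/esym/eqP; rewrite -subr_eq0; apply/eqP.
apply: (@vertex_affine_independent _ _ P (fun i => t i - bary P i x)).
  by rewrite sumrB ht sum_bary subrr.
transitivity (\sum_i (t i *: vertex P i - bary P i x *: vertex P i)).
  by apply: eq_bigr => k _; rewrite scalerBl.
by rewrite sumrB -hx bary_comb subrr.
Qed.

Lemma bary_sum P i (I : finType) (t : I -> R) (y : I -> 'rV[R]_n) :
  \sum_k t k = 1 -> bary P i (\sum_k t k *: y k) = \sum_k t k * bary P i (y k).
Proof.
move=> ht; rewrite baryE dot_sumr -[bary P i 0]mul1r -ht mulr_suml -big_split /=.
by apply: eq_bigr => k _; rewrite dotZr -mulrDr -baryE.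
Qed.

Lemma affine_bary P a k x :
  dot a x - k = \sum_j bary P j x * (dot a (vertex P j) - k).
Proof.
rewrite -{1}(bary_comb P x) dot_sumr -[k in LHS]mul1r -(sum_bary P x) mulr_suml -sumrB.
by apply: eq_bigr => j _; rewrite dotZr mulrBr.
Qed.

Lemma simplex_setE P x : simplex_set P x <-> forall i, 0 <= bary P i x.
Proof.
split=> [[t [t0 t1 tx]] i|h]; first by rewrite (bary_unique t1 tx).
by exists (fun i => bary P i x); split => //; rewrite ?sum_bary ?bary_comb.
Qed.

Lemma sum_bdir P : \sum_i bdir P i = 0.
Proof.
apply: dot_inj => z; rewrite dot0l dot_suml.
have := sum_bary P (0 + z); under eq_bigr do rewrite baryD.
by rewrite big_split /= sum_bary -[RHS]addr0 => /addrI.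
Qed.

(** Pairing with [vertex P j - vertex P k] isolates [c j - c k]. Up to scale the gradients thus have
    [sum_bdir] as their only relation. *)
Lemma bdir_circuit P (c : 'I_n.+1 -> R) : \sum_i c i *: bdir P i = 0 ->
  forall j k, c j = c k.
Proof.
move=> h j k; have := congr1 (fun v => dot v (vertex P j - vertex P k)) h.
rewrite dot0l dot_suml; under eq_bigr do rewrite dotZl -baryB !bary_vertex mulrBr.
rewrite sumrB (bigD1 j) //= (bigD1 k (F := fun i => _ * (i == k)%:R)) //= !eqxx.
by rewrite !big1 ?addr0 ?mulr1 => [/subr0_eq//|i /negbTE->|i /negbTE->]; rewrite mulr0.
Qed.

Lemma bdir_sep P i z : (forall j, j != i -> dot (bdir P j) z = 0) -> z = 0.
Proof.
move=> h; have hi : dot (bdir P i) z = 0.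
  have := congr1 (fun v => dot v z) (sum_bdir P).
  by rewrite dot0l dot_suml (bigD1 i) //= big1 ?addr0.
have hz k : bary P k z = bary P k 0.
  by rewrite baryE; have [->|/h->] := eqVneq k i; rewrite ?hi addr0.
rewrite -(bary_comb P z) -[RHS](bary_comb P 0).
by apply: eq_bigr => k _; rewrite hz.
Qed.

Hypothesis n0 : (0 < n)%N.

Lemma other_index (i : 'I_n.+1) : exists j, j != i.
Proof. by exists (lift i (Ordinal n0)); rewrite eq_sym neq_lift. Qed.

Lemma bdir_neq0 P i : bdir P i != 0.
Proof.
have [j ji] := other_index i; apply/eqP => h.
have := baryB P i (vertex P i) (vertex P j).
rewrite !bary_vertex eqxx eq_sym (negbTE ji) h dot0l => /eqP.
by rewrite subr0 oner_eq0.
Qed.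

Lemma enorm_bdir_gt0 P i : 0 < enorm (bdir P i).
Proof. exact/enorm_gt0/bdir_neq0. Qed.

Lemma is_outward_normalP P i f : is_outward_unit_normal P i f <->
  f = - (enorm (bdir P i))^-1 *: bdir P i.
Proof.
have bp := enorm_bdir_gt0 P i.
split=> [[f1 f2 f3]|->].
  have [j ji] := other_index i.
  (* Both [f] and [bdir P i] vanish on differences of vertices of the facet, so they are
     proportional; the factor is then fixed by its negative sign and the unit length. *)
  have hf z : dot f z = dot f (vertex P i - vertex P j) * dot (bdir P i) z.
    have [x ->] : exists x, z = x - vertex P j by exists (z + vertex P j); rewrite addrK.
    rewrite -baryB bary_vertex eq_sym (negbTE ji) subr0.
    have -> : x - vertex P j = \sum_k bary P k x *: (vertex P k - vertex P j).
      under eq_bigr do rewrite scalerBr.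
      by rewrite sumrB bary_comb -scaler_suml sum_bary scale1r.
    rewrite dot_sumr (bigD1 i) //= big1; first by rewrite addr0 dotZr mulrC.
    by move=> k ki; rewrite dotZr f2 ?mulr0.
  have := f3 j ji; set h := dot f _ in hf *; move=> h0.
  have fE : f = h *: bdir P i by apply: dot_inj => z; rewrite dotZl hf.
  rewrite fE; congr (_ *: _).
  have : (h * enorm (bdir P i)) ^+ 2 = 1.
    by rewrite exprMn sqr_enorm -f1 fE !dotrE; ring.
  move/eqP; rewrite sqrf_eq1 => /orP[/eqP e|/eqP e].
    by have := pmulr_llt0 h bp; rewrite e h0 ltr10.
  by rewrite -mulN1r -e mulfK // gt_eqF.
split.
- rewrite !dotrE -sqr_enorm; field; exact: lt0r_neq0.
- move=> j k ji ki; rewrite dotZl -baryB !bary_vertex.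
  by rewrite !(eq_sym i) (negbTE ji) (negbTE ki) subrr mulr0.
- move=> j ji; rewrite dotZl -baryB !bary_vertex eqxx eq_sym (negbTE ji) subr0.
  by rewrite mulr1 oppr_lt0 invr_gt0.
Qed.

Lemma outward_normalE P i :
  outward_normal P i = - (enorm (bdir P i))^-1 *: bdir P i.
Proof.
apply/is_outward_normalP; rewrite /outward_normal.
by apply: xgetPex; eexists; apply/is_outward_normalP.
Qed.

Lemma outward_normalP P i f :
  is_outward_unit_normal P i f -> outward_normal P i = f.
Proof. by move/is_outward_normalP->; exact: outward_normalE. Qed.

Lemma bdirE P i : bdir P i = - enorm (bdir P i) *: outward_normal P i.
Proof.
by rewrite outward_normalE scalerA mulrNN divff ?scale1r // gt_eqF // enorm_bdir_gt0.
Qed.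

Lemma outward_normal_unit P i : dot (outward_normal P i) (outward_normal P i) = 1.
Proof. by case: (iffRL (is_outward_normalP P i _) (outward_normalE P i)). Qed.

(** Minkowski's relation: [enorm (bdir P i)] is the inverse of the altitude over facet [i], hence
    proportional to the volume of that facet. *)
Lemma normal_relation P :
  \sum_i enorm (bdir P i) *: outward_normal P i = 0.
Proof.
apply: oppr_inj; rewrite oppr0 -sumrN -[RHS](sum_bdir P); apply: eq_bigr => i _.
by rewrite [RHS]bdirE scaleNr.
Qed.

Lemma normal_circuit P (c : 'I_n.+1 -> R) :
  \sum_i c i *: outward_normal P i = 0 ->
  exists a, forall i, c i = a * enorm (bdir P i).
Proof.
move=> h; pose d i := - (c i / enorm (bdir P i)).
have dP : \sum_i d i *: bdir P i = 0.
  rewrite -[RHS]h; apply: eq_bigr => i _; rewrite bdirE scalerA /d mulrNN divfK //.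
  by rewrite gt_eqF // enorm_bdir_gt0.
exists (- d ord0) => i; rewrite -(bdir_circuit dP i ord0) opprK divfK //.
by rewrite gt_eqF // enorm_bdir_gt0.
Qed.

Lemma normal_sep P i z :
  (forall j, j != i -> dot (outward_normal P j) z = 0) -> z = 0.
Proof.
move=> h; apply: (@bdir_sep P i) => j /h hj.
by rewrite bdirE dotZl hj mulr0.
Qed.

Definition frefl P i := rfl (bdir P i) (- bary P i 0).

Lemma freflE P i x :
  frefl P i x = x - (2 * bary P i x / dot (bdir P i) (bdir P i)) *: bdir P i.
Proof. by rewrite /frefl /rfl opprK (baryE P i x) addrC [in LHS](addrC _ x) (addrC (dot _ _)). Qed.

Lemma frefl_hyp P i j : j != i -> hyp_refl (outward_normal P i)
  (dot (outward_normal P i) (vertex P j)) = frefl P i.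
Proof.
move=> ji; rewrite hyp_reflE ?outward_normal_unit // /frefl.
have e0 : - (enorm (bdir P i))^-1 != 0.
  by rewrite oppr_eq0 invr_eq0 gt_eqF // enorm_bdir_gt0.
rewrite -[RHS](rflZ _ _ e0) -outward_normalE; congr rfl.
rewrite outward_normalE dotZl; congr (_ * _).
have := bary_vertex P i j; rewrite baryE eq_sym (negbTE ji) /=; lra.
Qed.

Lemma facet_reflectionsE P : facet_reflections P = range (frefl P).
Proof.
apply/seteqP; split=> [s [i [j [ji ->]]]|s [i _ <-]].
  by exists i => //; rewrite (frefl_hyp P ji).
have [j ji] := other_index i; exists i, j; split => //.
by rewrite (frefl_hyp P ji).
Qed.

Lemma freflK P i : involutive (frefl P i).
Proof. exact/rflK/bdir_neq0. Qed.

Lemma reflection_group_frefl P i : reflection_group P (frefl P i).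
Proof. by apply: gen_mem; rewrite facet_reflectionsE; exists i. Qed.

Lemma reflection_group_ind P (Q : ('rV[R]_n -> 'rV[R]_n) -> Prop) :
  Q idfun -> (forall i, Q (frefl P i)) ->
  (forall g h, Q g -> Q h -> Q (g \o h)) ->
  (forall g h, Q g -> cancel g h -> cancel h g -> Q h) ->
  forall g, reflection_group P g -> Q g.
Proof.
move=> q1 qs qm qv g; elim => //.
- by move=> s; rewrite facet_reflectionsE => -[i _ <-].
- by move=> {}g h _ qg _ qh; apply: qm.
- by move=> {}g h _ qg; apply: qv.
Qed.

End Barycentric.

(** * Similarity and Gram matrices *)

Section Similarity.
Variables (R : realType) (n : nat).
Hypothesis n0 : (0 < n)%N.
Implicit Types (P Q : simplex R n) (x y z : 'rV[R]_n).

Definition gram P i j := dot (outward_normal P i) (outward_normal P j).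

Lemma gram_itv P i j : -1 <= gram P i j <= 1.
Proof. by apply: dot_le1; apply: outward_normal_unit. Qed.

Lemma cos_dihedral P i j : cos (dihedral_angle P i j) = - gram P i j.
Proof.
rewrite /dihedral_angle -/(gram P i j) addrC cosDpi cosN acosK //.
by rewrite in_itv /= gram_itv.
Qed.

Lemma dihedralE P i j t : 0 <= t <= pi -> gram P i j = - cos t ->
  dihedral_angle P i j = t.
Proof.
move=> ht h; rewrite /dihedral_angle -/(gram P i j) h.
rewrite acosN; last by rewrite cos_geN1 cos_le1.
by rewrite cosK ?in_itv // opprB addrC subrK.
Qed.

(** Only off-diagonal entries are compared, since these are what dihedral angles determine; the
    diagonal entries are always 1. *)
Definition gram_equiv P Q := exists2 s : 'I_n.+1 -> 'I_n.+1, injective s &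
  forall i j, i != j -> gram P (s i) (s j) = gram Q i j.

Lemma gram_equivT P Q s : (forall i j, i != j -> gram P (s i) (s j) = gram Q i j) ->
  forall i j, gram P (s i) (s j) = gram Q i j.
Proof.
move=> h i j; have [->|/h//] := eqVneq i j.
by rewrite /gram !outward_normal_unit.
Qed.

Lemma gram_equiv_refl P : gram_equiv P P.
Proof. by exists id. Qed.

Lemma gram_equiv_trans P Q T : gram_equiv P Q -> gram_equiv Q T -> gram_equiv P T.
Proof.
move=> [s si hs] [t ti ht]; exists (s \o t); first exact: inj_comp.
by move=> i j ij; rewrite -ht //= hs // (inj_eq ti).
Qed.

Lemma gram_equiv_sym P Q : gram_equiv P Q -> gram_equiv Q P.
Proof.
move=> [s si hs]; have [t st ts] := injF_bij si.
exists t; first exact: can_inj ts.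
by move=> i j ij; rewrite -hs ?ts // (can_eq ts).
Qed.

Definition affine_image (A : 'M[R]_n) (b : 'rV[R]_n) (r : R) s P Q :=
  [/\ 0 < r, A *m A^T = (r ^+ 2)%:M, injective s
    & forall i, vertex Q i = vertex P (s i) *m A + b].

Lemma bary_affine A b r s P Q : affine_image A b r s P Q ->
  forall i x, bary Q i (x *m A + b) = bary P (s i) x.
Proof.
move=> [r0 hA si hv] i x; apply: bary_unique (fun i => bary P (s i) x) _ _ _ i.
  by rewrite -(sum_bary P x) [RHS](reindex_inj si).
rewrite -{1}(bary_comb P x) mulmx_suml.
under [RHS]eq_bigr do rewrite hv scalerDr.
rewrite big_split /= -scaler_suml; congr (_ + _); last first.
  by rewrite -[b in LHS]scale1r -(sum_bary P x) [in LHS](reindex_inj si).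
by rewrite (reindex_inj si); apply: eq_bigr => k _; rewrite -scalemxAl.
Qed.

Lemma sim_mulmxV (A : 'M[R]_n) r : 0 < r -> A *m A^T = (r ^+ 2)%:M ->
  A *m (r ^- 2 *: A^T) = 1%:M /\ (r ^- 2 *: A^T) *m A = 1%:M.
Proof.
move=> r0 hA; have h : A *m (r ^- 2 *: A^T) = 1%:M.
  by rewrite -scalemxAr hA scale_scalar_mx mulVf // expf_neq0 // gt_eqF.
by split => //; apply: mulmx1C.
Qed.

Lemma sim_conjK (A : 'M[R]_n) b r : 0 < r -> A *m A^T = (r ^+ 2)%:M ->
  let phi x := x *m A + b in let psi y := (y - b) *m (r ^- 2 *: A^T) in
  cancel phi psi /\ cancel psi phi.
Proof.
move=> r0 hA phi psi; have [h1 h2] := sim_mulmxV r0 hA.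
split=> x; rewrite /phi /psi; first by rewrite addrK -mulmxA h1 mulmx1.
by rewrite -mulmxA h2 mulmx1 subrK.
Qed.

(** Gradients transform by the inverse transpose of [A], which for a multiple of an orthogonal
    matrix is [r ^- 2 *: A]. *)
Lemma bdir_affine A b r s P Q : affine_image A b r s P Q ->
  forall i, bdir Q i = r ^- 2 *: (bdir P (s i) *m A).
Proof.
move=> h i; have [r0 hA si hv] := h; have [A1 A2] := sim_mulmxV r0 hA.
apply: dot_inj => z.
have := baryB Q i (z + b) b; rewrite addrK => <-.
have -> : z + b = (z *m (r ^- 2 *: A^T)) *m A + b.
  by rewrite -mulmxA A2 mulmx1.
have -> : bary Q i b = bary Q i (0 *m A + b) by rewrite mul0mx add0r.
rewrite !(bary_affine h) baryB subr0 -scalemxAr dotZr dotZl.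
by congr (_ * _); rewrite dot_mulmxl.
Qed.

Lemma frefl_affine A b r s P Q : affine_image A b r s P Q ->
  forall i x, frefl Q i (x *m A + b) = frefl P (s i) x *m A + b.
Proof.
move=> h i x; have [r0 hA si hv] := h.
rewrite !freflE (bary_affine h) (bdir_affine h) !dotrE (dot_mulmx _ _ hA).
rewrite mulmxBl -scalemxAl scalerA [LHS]addrAC; congr (_ - _ *: _ + _).
have d0 : dot (bdir P (s i)) (bdir P (s i)) != 0 by rewrite dot_eq0 bdir_neq0.
by field; rewrite d0 gt_eqF.
Qed.

Lemma normal_affine A b r s P Q : affine_image A b r s P Q ->
  forall i, outward_normal Q i = r^-1 *: (outward_normal P (s i) *m A).
Proof.
move=> h i; have [r0 hA si hv] := h.
rewrite !outward_normalE // (bdir_affine h) enormZ -scalemxAl !scalerA.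
rewrite /enorm (dot_mulmx _ _ hA) sqrtrM ?sqr_ge0 // sqrtr_sqr.
rewrite (gtr0_norm r0) ger0_norm; last by rewrite invr_ge0 sqr_ge0.
congr (_ *: _); rewrite -/(enorm _).
have := enorm_bdir_gt0 n0 P (s i); move: (enorm _) => e e0.
by field; rewrite !gt_eqF.
Qed.

Lemma gram_affine A b r s P Q : affine_image A b r s P Q -> forall i j,
  gram Q i j = gram P (s i) (s j).
Proof.
move=> h i j; have [r0 hA si hv] := h.
rewrite /gram !(normal_affine h) !dotrE (dot_mulmx _ _ hA).
by field; rewrite gt_eqF.
Qed.

Lemma affine_image_sym A b r s P Q : affine_image A b r s P Q ->
  exists t, [/\ cancel s t, cancel t s &
    affine_image (r ^- 2 *: A^T) (- (b *m (r ^- 2 *: A^T))) r^-1 t Q P].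
Proof.
move=> [r0 hA si hv]; have [t st ts] := injF_bij si.
exists t; split => //; split.
- by rewrite invr_gt0.
- rewrite linearZ /= trmxK -scalemxAl -scalemxAr.
  have [_ ] := sim_mulmxV r0 hA; rewrite -scalemxAl => ->.
  by rewrite scale_scalar_mx mulr1 exprVn.
- exact: can_inj ts.
- move=> i; rewrite hv ts mulmxDl -mulmxA (sim_mulmxV r0 hA).1 mulmx1.
  by rewrite addrK.
Qed.

(** Equal Gram matrices of [n] normals give an orthogonal [U] matching these; the remaining normal
    follows because its inner products with the others, which span, agree. By uniqueness of the
    relation, [U] also matches the gradients up to one factor [a], so scaling by [a^-1] carries one
    simplex to a translate of the other. *)
Lemma gram_equiv_affine P Q : gram_equiv P Q ->
  exists A b r s, affine_image A b r s P Q.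
Proof.
move=> [s si /gram_equivT hs].
pose f i := outward_normal P (s i); pose g i := outward_normal Q i.
pose F : 'M[R]_n := \matrix_i f (lift ord0 i).
pose G : 'M[R]_n := \matrix_i g (lift ord0 i).
have FG : F *m F^T = G *m G^T.
  apply/matrixP => i j.
  have e (H : 'M[R]_n) : (H *m H^T) i j = dot (row i H) (row j H).
    by rewrite dotE mxE; apply: eq_bigr => k _; rewrite !mxE.
  by rewrite !e !rowK; exact: hs.
have Fu : F \in unitmx.
  rewrite -unitmx_tr -row_free_unit; apply/inj_row_free => z hz.
  apply: (normal_sep n0 (P := P) (i := s ord0)) => j js.
  have [t st ts] := injF_bij si.
  have j0 : ord0 != t j by apply: contraNneq js => ->; rewrite ts.
  have [k kE _] := unlift_some j0.
  have := congr1 (fun v : 'rV_n => v 0 k) hz; rewrite mxE [RHS]mxE => e.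
  rewrite -[RHS]e dotC dotE; apply: eq_bigr => l _; rewrite !mxE.
  by rewrite -kE /f ts.
pose U := invmx F *m G.
have FU : F *m U = G by rewrite mulmxA mulmxV // mul1mx.
have UU : U *m U^T = 1%:M.
  rewrite /U trmx_mul mulmxA -(mulmxA _ G) -FG mulmxA mulVmx // mul1mx.
  by rewrite -trmx_mul mulVmx // trmx1.
have dU x y : dot (x *m U) (y *m U) = dot x y by rewrite (dot_mulmx _ _ UU) mul1r.
have fUS i : f (lift ord0 i) *m U = g (lift ord0 i).
  have -> : f (lift ord0 i) = row i F by rewrite rowK.
  by rewrite -row_mul FU rowK.
have fU i : f i *m U = g i.
  case: (unliftP ord0 i) => [k ->|-> {i}]; first exact: fUS.
  apply/eqP; rewrite -subr_eq0; apply/eqP.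
  apply: (normal_sep n0 (P := Q) (i := ord0)) => j j0.
  have [k -> _] : {k | j = lift ord0 k & unlift ord0 j = Some k}.
    by apply: unlift_some; rewrite eq_sym.
  rewrite dotBr -/(g _) -{1}fUS dU; apply/eqP; rewrite subr_eq0; apply/eqP.
  exact: hs.
have [t st ts] := injF_bij si.
have [a ha] : exists a, forall i, enorm (bdir Q i) = a * enorm (bdir P (s i)).
  have := normal_relation n0 Q.
  under eq_bigr do rewrite -/(g _) -fU scalemxAl.
  rewrite -mulmx_suml => h.
  have : \sum_i enorm (bdir Q i) *: f i = 0.
    by rewrite -[LHS]mulmx1 -UU mulmxA h mul0mx.
  rewrite (reindex_inj (can_inj ts)) /=; under eq_bigr do rewrite /f ts.
  move=> /(normal_circuit n0)[a ha]; exists a => i; rewrite -ha st //.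
have a0 : 0 < a.
  by rewrite -(pmulr_lgt0 _ (enorm_bdir_gt0 n0 P (s ord0))) -ha enorm_bdir_gt0.
have bU i : bdir Q i = a *: (bdir P (s i) *m U).
  rewrite [LHS]bdirE // [in RHS](bdirE n0 P) -scalemxAl fU scalerA ha mulrN //.
pose A := a^-1 *: U.
exists A, (vertex Q ord0 - vertex P (s ord0) *m A), a^-1, s; split => //.
- by rewrite invr_gt0.
- rewrite /A linearZ /= -scalemxAl -scalemxAr UU scalerA scale_scalar_mx mulr1.
  by rewrite expr2.
- move=> i; apply/eqP; rewrite -subr_eq0; apply/eqP; apply: (bdir_sep (P := Q) (i := ord0)) => j _.
  have -> : vertex Q i - (vertex P (s i) *m A + (vertex Q ord0 - vertex P (s ord0) *m A))
     = (vertex Q i - vertex Q ord0) - (vertex P (s i) - vertex P (s ord0)) *m A.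
    by rewrite mulmxBl; apply/rowP => k; rewrite !mxE; ring.
  rewrite dotBr -baryB !bary_vertex bU /A -scalemxAr !dotrE dU -baryB !bary_vertex.
  by rewrite !(inj_eq si) mulrA divff ?mul1r ?subrr // gt_eqF.
Qed.

Lemma polarize x y : dot x y = (dot x x + dot y y - dot (x - y) (x - y)) / 2.
Proof. by rewrite !dotrE (dotC y x); field. Qed.

(** By polarization [phi - phi 0] multiplies inner products by [r ^+ 2]; then the squared distance
    between [phi x - phi 0] and [x *m A], where the rows of [A] are the images of the basis, expands
    to 0. *)
Lemma similarity_affine (phi : 'rV[R]_n -> 'rV[R]_n) r :
  (forall x y, enorm (phi x - phi y) = r * enorm (x - y)) ->
  exists2 A : 'M[R]_n, A *m A^T = (r ^+ 2)%:M & forall x, phi x = x *m A + phi 0.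
Proof.
move=> h; pose psi x := phi x - phi 0.
have hd x y : dot (phi x - phi y) (phi x - phi y) = r ^+ 2 * dot (x - y) (x - y).
  by rewrite -!sqr_enorm h exprMn.
have hp x y : dot (psi x) (psi y) = r ^+ 2 * dot x y.
  rewrite polarize /psi opprB addrA subrK !hd !subr0 [in RHS]polarize.
  by field.
pose A : 'M[R]_n := \matrix_i psi (delta_mx 0 i).
exists A.
  apply/matrixP => i j; rewrite !mxE.
  transitivity (dot (psi (delta_mx 0 i)) (psi (delta_mx 0 j))).
    by rewrite dotE; apply: eq_bigr => k _; rewrite !mxE.
  by rewrite hp dot_delta mxE eqxx /= mulr_natr eq_sym.
have xA x : x *m A = \sum_i x 0 i *: psi (delta_mx 0 i).
  by rewrite mulmx_sum_row; apply: eq_bigr => i _; rewrite rowK.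
move=> x; apply/eqP; rewrite -subr_eq -/(psi x) -subr_eq0.
rewrite -dot_eq0 (dotBl (psi x)) !(dotBr _ (psi x) (x *m A)) hp xA dot_sumr.
rewrite (dot_suml _ _ _ (psi x)).
have -> : \sum_i dot (psi x) (x 0 i *: psi (delta_mx 0 i)) = r ^+ 2 * dot x x.
  rewrite [in RHS]dotE mulr_sumr; apply: eq_bigr => i _; rewrite dotZr hp dot_delta.
  by ring.
have -> : \sum_i dot (x 0 i *: psi (delta_mx 0 i)) (psi x) = r ^+ 2 * dot x x.
  rewrite [in RHS]dotE mulr_sumr; apply: eq_bigr => i _; rewrite dotZl dotC hp dot_delta.
  by ring.
have -> : dot (\sum_i x 0 i *: psi (delta_mx 0 i)) (\sum_i x 0 i *: psi (delta_mx 0 i))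
   = r ^+ 2 * dot x x.
  rewrite dot_suml [in RHS]dotE mulr_sumr; apply: eq_bigr => i _.
  rewrite dotZl dot_sumr (bigD1 i) //= big1 ?addr0 => [|j ji].
    by rewrite dotZr hp dot_delta mxE !eqxx /=; ring.
  by rewrite dotZr hp dot_delta mxE eqxx /= (negbTE ji) !mulr0.
by rewrite subrr.
Qed.

Lemma affine_image_set A b r s P Q : affine_image A b r s P Q ->
  (fun x => x *m A + b) @` simplex_set P = simplex_set Q.
Proof.
move=> h; have [r0 hA si hv] := h; have [psi1 psi2] := sim_conjK b r0 hA.
have [t st ts] := injF_bij si.
apply/seteqP; split=> [_ [x /simplex_setE hx <-]|y /simplex_setE hy].
  by apply/simplex_setE => i; rewrite (bary_affine h).
exists ((y - b) *m (r ^- 2 *: A^T)); last exact: psi2.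
apply/simplex_setE => i; rewrite -(ts i) -(bary_affine h).
by have -> := psi2 y.
Qed.

Lemma affine_image_similar A b r s P Q : affine_image A b r s P Q -> similar P Q.
Proof.
move=> h; have [r0 hA si hv] := h; exists (fun x => x *m A + b).
  exists r => // x y; rewrite opprD addrACA subrr addr0 -mulmxBl.
  by rewrite /enorm (dot_mulmx _ _ hA) sqrtrM ?sqr_ge0 // sqrtr_sqr gtr0_norm.
exact: affine_image_set h.
Qed.

Lemma bary_le1 P i x : simplex_set P x -> bary P i x <= 1.
Proof.
move=> /simplex_setE h; rewrite -(sum_bary P x) (bigD1 i) //= lerDl.
by rewrite sumr_ge0.
Qed.

Lemma bary_eq1 P i x : simplex_set P x -> bary P i x = 1 -> x = vertex P i.
Proof.
move=> /simplex_setE h h1; rewrite -(bary_comb P x) (bigD1 i) //= h1 scale1r.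
rewrite big1 ?addr0 // => j ji.
have := sum_bary P x; rewrite (bigD1 i) //= h1 -[RHS]addr0 => /addrI /eqP.
rewrite psumr_eq0 // => /allP /(_ j (mem_index_enum _)).
by rewrite ji => /eqP ->; rewrite scale0r.
Qed.

Lemma vertex_in P i : simplex_set P (vertex P i).
Proof. by apply/simplex_setE => j; rewrite bary_vertex ler0n. Qed.

Lemma similar_affine_image P Q : similar P Q -> exists A b r s, affine_image A b r s Q P.
Proof.
move=> [phi [r r0 hphi] PQ].
have [A hA phiE] := similarity_affine hphi.
have [psi1 psi2] := sim_conjK (phi 0) r0 hA.
have phi_inj : injective phi.
  by move=> x y; rewrite (phiE x) (phiE y) => /(can_inj psi1).
(* Vertices are extreme points: pulled back to [P], the image of a vertex is a convex combination of
   points [y k] of [P], and any [y k] of nonzero weight must have its barycentric coordinate [i]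
   equal to 1. *)
have key i : exists k, phi (vertex P i) = vertex Q k.
  have : simplex_set Q (phi (vertex P i)) by rewrite -PQ; exists (vertex P i) => //; exact: vertex_in.
  move=> [t [t0 t1 tE]].
  have /choice[y hy] : forall k, exists y, simplex_set P y /\ phi y = vertex Q k.
    move=> k; have := vertex_in Q k; rewrite -PQ => -[y Py yE]; by exists y.
  have yE : vertex P i = \sum_k t k *: y k.
    apply: phi_inj; rewrite tE phiE mulmx_suml -[phi 0]scale1r -t1 scaler_suml.
    rewrite -big_split; apply: eq_bigr => k _ /=.
    by rewrite -scalemxAl -scalerDr -phiE (hy k).2.
  have e : bary P i (\sum_k t k *: y k) = 1 by rewrite -yE bary_vertex eqxx.
  rewrite bary_sum // in e.
  have : \sum_k t k * (1 - bary P i (y k)) = 0.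
    by under eq_bigr do rewrite mulrBr mulr1; rewrite sumrB e t1 subrr.
  move/eqP; rewrite psumr_eq0 => [/allP h|k _]; last first.
    by rewrite mulr_ge0 // subr_ge0; apply: bary_le1 (hy k).1.
  have [k tk] : exists k, t k != 0.
    apply/existsP; apply: contraT; rewrite negb_exists => /forallP h0.
    move: t1; rewrite big1 => [/eqP|k _]; first by rewrite eq_sym oner_eq0.
    by apply/eqP; rewrite -[_ == _]negbK h0.
  have := h k (mem_index_enum _); rewrite mulf_eq0 (negbTE tk) subr_eq0 /= => /eqP e1.
  exists k; rewrite -(hy k).2; congr phi; apply/esym/bary_eq1 => //.
  exact: (hy k).1.
have /choice[s sE] := key.
have si : injective s.
  move=> i j ij; have := sE i; rewrite ij -sE => /phi_inj e.
  have := bary_vertex P i j; rewrite -e bary_vertex eqxx.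
  by case: eqP => // _ /eqP; rewrite oner_eq0.
have [t st ts] := injF_bij si.
have h : affine_image A (phi 0) r t P Q.
  by split => //; [exact: can_inj ts | move=> i; rewrite -phiE sE ts].
by have [u [_ _ hu]] := affine_image_sym h; do 4!eexists; exact: hu.
Qed.

Lemma similarP P Q : similar P Q <-> gram_equiv P Q.
Proof.
split=> [/similar_affine_image[A [b [r [s h]]]]|h].
  apply: gram_equiv_sym; have [_ _ si _] := h.
  by exists s => // i j _; rewrite -(gram_affine h).
by have [A [b [r [s /affine_image_similar]]]] := gram_equiv_affine h.
Qed.

End Similarity.

(** * Discrete groups and chambers *)

Lemma finite_pos_lb (R : realType) (I : finType) (F : I -> R) :
  (forall i, 0 < F i) -> exists2 e, 0 < e & forall i, e <= F i.
Proof.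
move=> h; exists (\big[Order.min/1]_i F i).
  by elim/big_ind: _ => // x y hx hy; rewrite lt_min hx.
by move=> i; apply: bigmin_le_cond.
Qed.

Lemma convex_comb_lt (R : realType) (p q d s : R) :
  p < d -> q < d -> 0 <= s -> s <= 1 -> (1 - s) * p + s * q < d.
Proof.
move=> pd qd s0 s1; apply: (@le_lt_trans _ _ (Order.max p q)); last by rewrite gt_max pd.
have pm : p <= Order.max p q by rewrite le_max lexx.
have qm : q <= Order.max p q by rewrite le_max lexx orbT.
move: (Order.max p q) pm qm => m pm qm; nra.
Qed.

Section Topology.
Variables (R : realType) (n : nat).
Implicit Types (x y z a b : 'rV[R]_n) (G : set ('rV[R]_n -> 'rV[R]_n)).

Lemma nbhs_enorm a (B : set 'rV[R]_n) :
  nbhs a B <-> exists2 e, 0 < e & forall y, enorm (y - a) < e -> B y.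
Proof.
split=> [/nbhs_ballP[e e0 h]|[e e0 h]].
  exists e => // y hy; apply: h; split => // i j; rewrite (ord1 i) /ball /=.
  apply: le_lt_trans hy; rewrite distrC; have := coord_le_enorm (y - a) j.
  by rewrite !mxE.
(* The balls are those of the sup norm. Dividing by [n.+1] instead of [n] makes the final inequality
   strict and covers [n = 0]. *)
apply/nbhs_ballP; exists (e / n.+1%:R); first by rewrite /= divr_gt0.
move=> y hy; apply: h; apply: le_lt_trans (enorm_le_sum _) _.
apply: (@le_lt_trans _ _ (\sum_(i < n) (e / n.+1%:R))).
  apply: ler_sum => i _; rewrite !mxE distrC; apply/ltW; exact: hy.2.
rewrite sumr_const card_ord -[X in X < _]mulr_natr -mulrA gtr_pMr // mulrC ltr_pdivrMr //.
by rewrite mul1r ltr_nat.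
Qed.

Lemma dot_continuous a : continuous (dot a).
Proof.
move=> x B /nbhs_ballP[e e0 h]; apply/nbhs_enorm.
exists (e / (enorm a + 1)); first by rewrite divr_gt0 // ltr_pwDr // enorm_ge0.
move=> y; rewrite ltr_pdivlMr ?ltr_pwDr ?enorm_ge0 // => hy; apply: h.
rewrite /ball /= distrC -dotBr; apply: le_lt_trans (cauchy_schwarz _ _) _.
apply: le_lt_trans hy; rewrite mulrC ler_wpM2l ?enorm_ge0 //.
by rewrite lerDl.
Qed.

Lemma bary_continuous (D : simplex R n) i : continuous (bary D i).
Proof.
move=> x B /nbhs_ballP[e e0 h].
have /nbhs_enorm[d d0 hd] := @dot_continuous (bdir D i) x _ (nbhsx_ballx _ _ e0).
apply/nbhs_enorm; exists d => // y /hd; rewrite /ball /= -dotBr -baryB => hy.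
by apply: h; rewrite /ball /= .
Qed.

Lemma segment_component (A : set 'rV[R]_n) x y :
  (forall t, 0 <= t <= 1 -> A (x + t *: (y - x))) -> connected_component A x y.
Proof.
move=> h; pose p (t : R) := x + t *: (y - x).
exists (p @` `[0, 1]); last first.
  by exists 1; rewrite /= ?in_itv /= ?lexx ?ler01 // /p scale1r addrC subrK.
split.
- by exists 0; rewrite /= ?in_itv /= ?lexx ?ler01 // /p scale0r addr0.
- by move=> _ [t /= t01 <-]; apply: h; rewrite in_itv /= in t01.
apply: connected_continuous_connected; first exact: segment_connected.
apply: continuous_subspaceT => t.
by apply: cvgD; [exact: cvg_cst | apply: cvgZr_tmp; exact: cvg_id].
Qed.

Lemma connected_ivt (C : set 'rV[R]_n) (f : 'rV[R]_n -> R) x y k :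
  connected C -> continuous f -> C x -> C y -> f x <= k <= f y ->
  exists2 z, C z & f z = k.
Proof.
move=> cC cf Cx Cy hk.
have /connected_intervalP hI : connected (f @` C).
  by apply: connected_continuous_connected => //; apply: continuous_subspaceT.
have [z Cz zk] : (f @` C) k by apply: (hI (f x) (f y)) => //.
by exists z.
Qed.

(** Isolation of each element in terms of the basic neighbourhoods of pointwise convergence:
    finitely many test points and one radius. *)
Definition discrete_crit G := forall g, G g ->
  exists (xs : seq 'rV[R]_n) e, 0 < e /\
    forall h, G h -> (forall x, x \in xs -> enorm (h x - g x) < e) -> h = g.

Lemma discrete_groupP G : discrete_group G <-> discrete_crit G.
Proof.
split=> [dG g Gg|dG].
  have : isolated (G : set {ptws 'rV[R]_n -> 'rV[R]_n}) g.
    by rewrite (dG : isolated _ = _).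
  move=> [_ [V gV VG]].
  (* The basic neighbourhoods generate a filter that converges pointwise to [g], so one of them lies
     in the given neighbourhood [V]. *)
  pose F : set_system {ptws 'rV[R]_n -> 'rV[R]_n} :=
    filter_from [set p : seq 'rV[R]_n * R | 0 < p.2]
      (fun p => [set h | forall x, x \in p.1 -> enorm (h x - g x) < p.2]).
  have FF : Filter F.
    apply: filter_from_filter; first by exists ([::], 1) => /=.
    move=> [xs e] [ys d] /= e0 d0; exists (xs ++ ys, Order.min e d) => /=.
      by rewrite lt_min e0.
    by move=> h hh; split=> x xin; have := hh x; rewrite mem_cat xin ?orbT lt_min => /(_ isT)/andP[].
  have : {ptws, F --> g}.
    apply/pointwise_cvgP => t B /nbhs_enorm[e e0 hB].
    exists ([:: t], e) => //= h hh; apply: hB; apply: hh; exact: mem_head.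
  move=> /(_ V gV)[[xs e] /= e0 hV].
  exists xs, e; split => // h Gh hh.
  have : (V `&` G) h by split => //; exact: hV.
  by rewrite VG.
apply/seteqP; split; first exact: isolatedS.
move=> g Gg; split; first exact/mem_set.
have [xs [e [e0 h]]] := dG g Gg.
exists [set h | forall x, x \in xs -> enorm (h x - g x) < e]; last first.
  apply/seteqP; split=> [k [/= hk Gk]|k -> /=]; first exact: h.
  by split => // x _; rewrite subrr /enorm dot0l sqrtr0.
have FF : Filter (nbhs (g : {ptws 'rV[R]_n -> 'rV[R]_n})) := nbhs_filter _.
have /pointwise_cvgP gg : {ptws, nbhs (g : {ptws 'rV[R]_n -> 'rV[R]_n}) --> g} by [].
elim: xs {h} => [|x xs IH]; first by apply: filterS filterT => k _ x; rewrite in_nil.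
have hx : \forall k \near (g : {ptws 'rV[R]_n -> 'rV[R]_n}), enorm (k x - g x) < e.
  by apply: (gg x [set y | enorm (y - g x) < e]); apply/nbhs_enorm; exists e.
apply: filterS (filterI hx IH) => k [kx kxs] y; rewrite inE => /orP[/eqP->//|].
exact: kxs.
Qed.

Lemma mirrorsP G x : mirrors G x <->
  exists a k, [/\ a != 0, G (rfl a k) & dot a x = k].
Proof.
split=> [[f [c [f1 Gf fx]]]|[a [k [a0 Ga ax]]]].
  exists f, c; split => //; last by rewrite -hyp_reflE.
  by rewrite -dot_eq0 f1 oner_eq0.
have e0 := enorm_gt0 a0; have e1 : (enorm a)^-1 != 0 by rewrite invr_eq0 gt_eqF.
have u : dot ((enorm a)^-1 *: a) ((enorm a)^-1 *: a) = 1.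
  by rewrite !dotrE -sqr_enorm; field; rewrite gt_eqF.
exists ((enorm a)^-1 *: a), ((enorm a)^-1 * k); split => //.
  by rewrite hyp_reflE // rflZ.
by rewrite dotZl ax.
Qed.

(** Together with the facet reflections lying in [G], this characterises chambers without mention of
    components or closures; see [chamber_avoids], [chamber_facet_reflections] and [is_chamberP]. *)
Definition avoids_interior G (D : simplex R n) := forall a k y, a != 0 ->
  G (rfl a k) -> (forall i, 0 < bary D i y) -> dot a y <> k.

Definition barycenter (D : simplex R n) : 'rV[R]_n := \sum_i n.+1%:R^-1 *: vertex D i.

Lemma bary_barycenter D i : bary D i (barycenter D) = n.+1%:R^-1.
Proof.
apply: (bary_unique (t := fun _ => n.+1%:R^-1)) => //.
by rewrite sumr_const card_ord -[LHS]mulr_natr mulVf // pnatr_eq0.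
Qed.

Lemma bary_conv (D : simplex R n) i x y t :
  bary D i (x + t *: (y - x)) = (1 - t) * bary D i x + t * bary D i y.
Proof.
by rewrite baryD dotZr -baryB; ring.
Qed.

Hypothesis n0 : (0 < n)%N.

(** If a mirror meets the interior at [y], the simplex contains points on both sides of it. As the
    simplex is the closure of a component, so does the component, and by connectedness the component
    meets the mirror. *)
Lemma chamber_avoids G (D : simplex R n) :
  is_chamber G (simplex_set D) -> avoids_interior G D.
Proof.
move=> [x0 Mx0 DE] a k y a0 Ga yD ay.
set C := connected_component _ _ in DE.
have [e e0 he] := @finite_pos_lb R _
  (fun i => bary D i y / (1 + `|dot (bdir D i) a|))
  (fun i => divr_gt0 (yD i) (ltr_pwDl ltr01 (normr_ge0 _))).
have inD (d : R) : `|d| = e -> simplex_set D (y + d *: a).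
  move=> de; apply/simplex_setE => i; rewrite baryD dotZr.
  have := he i; rewrite ler_pdivlMr ?ltr_pwDl // mulrDr mulr1 -de -normrM.
  have := ler_norm (- (d * dot (bdir D i) a)); rewrite normrN.
  have := normr_ge0 d; lra.
have aa := dot_gt0 a0.
have cross (d : R) : `|d| = e ->
    exists2 z, C z & 0 < d * (dot a z - k).
  move=> de; have := inD d de; rewrite DE => /(_ [set z | 0 < d * (dot a z - k)]).
  have d0 : d != 0 by rewrite -normr_gt0 de.
  case=> [|z [Cz hz]]; last by exists z.
  have hd : d * k < dot (d *: a) (y + d *: a).
    rewrite dotDr !dotrE ay ltrDl mulrCA mulrA mulr_gt0 // -expr2 exprn_even_gt0 //.
  have /nbhs_enorm[c c0 hc] := @dot_continuous (d *: a) (y + d *: a) _ (lt_nbhsr hd).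
  apply/nbhs_enorm; exists c => // z /hc.
  by rewrite /= dotZl mulrBr subr_gt0.
have [z1 C1] := cross e (gtr0_norm e0).
have [z2 C2] := cross (- e) (etrans (normrN e) (gtr0_norm e0)).
rewrite mulNr oppr_gt0 pmulr_rlt0 // pmulr_rgt0 // subr_lt0 subr_gt0 => h2 h1.
have hk : dot a z2 <= k <= dot a z1 by rewrite !ltW.
have [z Cz az] := connected_ivt (@component_connected _ _ _) (@dot_continuous a) C2 C1 hk.
have : (~` mirrors G) z by exact: connected_component_sub Cz.
by apply; apply/mirrorsP; exists a, k.
Qed.

Lemma avoids_one_side G (D : simplex R n) a k : avoids_interior G D ->
  a != 0 -> G (rfl a k) -> exists2 e : R, e = 1 \/ e = -1 &
    forall j, 0 <= e * (dot a (vertex D j) - k).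
Proof.
move=> av a0 Ga; set m := barycenter D.
have mk := av a k m a0 Ga (fun i => _).
have {}mk : dot a m != k.
  apply/eqP/mk => i; by rewrite bary_barycenter invr_gt0.
pose e : R := if k < dot a m then 1 else -1.
exists e; first by rewrite /e; case: ifP; [left|right].
have em : 0 < e * (dot a m - k).
  rewrite /e; case: ifP => h; first by rewrite mul1r subr_gt0.
  by move: mk; rewrite neq_lt h orbF mulN1r opprB subr_gt0.
have e1 : e != 0 by rewrite /e; case: ifP; rewrite ?oner_eq0 // oppr_eq0 oner_eq0.
move=> j; rewrite leNgt; apply/negP => hj.
pose p := e * (dot a m - k); pose q := e * (dot a (vertex D j) - k).
have pq : 0 < p - q by rewrite subr_gt0 (lt_trans hj).
(* Along the segment from the barycentre to the vertex the affine function goes from [p > 0] to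
   [q < 0]. It vanishes at [t < 1], where all barycentric coordinates are still positive. *)
pose t := p / (p - q).
have t1 : t < 1 by rewrite /t ltr_pdivrMr // mul1r ltrBrDl gtrDr.
have t0 : 0 < t by rewrite divr_gt0.
apply: (av a k (m + t *: (vertex D j - m)) a0 Ga).
  move=> i; rewrite bary_conv ltr_pwDl //.
    by rewrite mulr_gt0 ?subr_gt0 // bary_barycenter invr_gt0.
  by rewrite mulr_ge0 ?(ltW t0) // bary_vertex ler0n.
apply: (mulfI e1); rewrite dotDr dotZr dotBr.
have -> : dot a (vertex D j) - dot a m = (q - p) / e by rewrite /p /q; field.
have -> : dot a m = p / e + k by rewrite /p; field.
by rewrite /t; field; rewrite e1 gt_eqF.
Qed.

(** The unit normal is oriented so that the simplex lies on the nonnegative side, and the mirror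
    passes within [eta] of every vertex of facet [i]. As [eta] tends to 0 such mirrors approach the
    facet hyperplane. *)
Definition close_mirror G (D : simplex R n) i (eta : R) a k :=
  [/\ dot a a = 1, G (rfl a k), forall j, 0 <= dot a (vertex D j) - k
    & forall j, j != i -> dot a (vertex D j) - k <= eta].

Lemma close_mirror_exists G (D : simplex R n) i eta :
  is_chamber G (simplex_set D) -> 0 < eta -> exists a k, close_mirror G D i eta a k.
Proof.
move=> cD eta0; have av := chamber_avoids cD.
pose xi : 'rV[R]_n := \sum_j (n%:R^-1 * (j != i)%:R) *: vertex D j.
have nR0 : n%:R != 0 :> R by rewrite pnatr_eq0 -lt0n.
have sumw : \sum_j (n%:R^-1 * (j != i)%:R) = 1 :> R.
  rewrite (bigD1 i) //= eqxx mulr0 add0r (eq_bigr (fun=> n%:R^-1)).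
    by rewrite sumr_const cardC1 card_ord -[LHS]mulr_natr mulVf.
  by move=> j ->; rewrite mulr1.
have bxi j : bary D j xi = n%:R^-1 * (j != i)%:R by exact: (bary_unique sumw (erefl xi)).
have Dxi : simplex_set D xi.
  by apply/simplex_setE => j; rewrite bxi mulr_ge0 ?invr_ge0 ?ler0n.
(* [xi] is the mean of the [n] vertices of the facet: a function that is nonnegative at these
   vertices and at most [eta / n] at [xi] is at most [eta] at each of them. *)
pose d := eta / n%:R.
have d0 : 0 < d by rewrite divr_gt0 // ltr0n.
have [y My yd] : exists2 y, mirrors G y & enorm (y - xi) < d.
  (* Without a mirror in the ball about [xi], a segment inside the ball joins a point of the
     component to a point beyond facet [i], which would then belong to the simplex. *)
  apply: contrapT => noM.
  have U y : enorm (y - xi) < d -> (~` mirrors G) y.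
    by move=> hy My; apply: noM; exists y.
  have [x0 Mx0 DE] := cD; set C := connected_component _ _ in DE.
  have [z [Cz /= hz]] : C `&` [set y | enorm (y - xi) < d] !=set0.
    have := Dxi; rewrite DE; apply; apply/nbhs_enorm; by exists d.
  have bp := enorm_bdir_gt0 n0 D i.
  pose t := d / (2 * enorm (bdir D i)).
  have t0 : 0 < t by rewrite divr_gt0 // mulr_gt0.
  pose y := xi - t *: bdir D i.
  have hy : enorm (y - xi) < d.
    rewrite /y addrC addKr enormN enormZ gtr0_norm // /t invfM mulrA.
    by rewrite divfK ?gt_eqF //; lra.
  have : C y.
    apply: (@connected_component_trans _ _ z) => //.
    apply: segment_component => s /andP[s0 s1]; apply: U.
    have -> : z + s *: (y - z) - xi = (1 - s) *: (z - xi) + s *: (y - xi).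
      by apply/rowP => k; rewrite !mxE; ring.
    apply: le_lt_trans (enormD _ _) _; rewrite !enormZ !ger0_norm ?subr_ge0 //.
    exact: convex_comb_lt.
  move=> /subset_closure; rewrite -DE => /simplex_setE /(_ i).
  rewrite baryD bxi eqxx mulr0 add0r dotNr dotZr oppr_ge0 leNgt.
  by rewrite mulr_gt0 // dot_gt0 // bdir_neq0.
have [a [k [a0 Ga ay]]] := iffLR (mirrorsP G y) My.
have e0 := enorm_gt0 a0.
have [e e1 he] := avoids_one_side av a0 Ga.
have en0 : e / enorm a != 0.
  rewrite mulf_neq0 ?invr_eq0 ?(gt_eqF e0) //.
  by case: e1 => ->; rewrite ?oppr_eq0 oner_eq0.
pose a' := (e / enorm a) *: a; pose k' := e / enorm a * k.
have a'1 : dot a' a' = 1.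
  rewrite /a' !dotrE -sqr_enorm; have -> : e / enorm a * (e / enorm a * enorm a ^+ 2) = e ^+ 2.
    by field; rewrite gt_eqF.
  by case: e1 => ->; rewrite ?sqrrN expr1n.
have L x : dot a' x - k' = (enorm a)^-1 * (e * (dot a x - k)).
  by rewrite /a' /k' dotZl; ring.
have L0 j : 0 <= dot a' (vertex D j) - k'.
  by rewrite L mulr_ge0 // invr_ge0 ltW.
exists a', k'; split => //; first by rewrite /a' /k' rflZ.
have : dot a' xi - k' <= d.
  have -> : k' = dot a' y by apply/esym/eqP; rewrite -subr_eq0 L ay subrr !mulr0.
  rewrite -dotBr; apply: le_trans (ler_norm _) _; apply: le_trans (cauchy_schwarz _ _) _.
  by rewrite {1}/enorm a'1 sqrtr1 mul1r -enormN opprB ltW.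
have -> : dot a' xi - k' = n%:R^-1 * \sum_(j | j != i) (dot a' (vertex D j) - k').
  have kE : k' = \sum_j (n%:R^-1 * (j != i)%:R) * k' by rewrite -mulr_suml sumw mul1r.
  rewrite dot_sumr {1}kE -sumrB mulr_sumr [RHS]big_mkcond /=.
  by apply: eq_bigr => j _; rewrite dotZr; case: (j != i) => /=; ring.
rewrite mulrC /d ler_pM2r ?invr_gt0 ?ltr0n // => hs j ji.
apply: le_trans hs; rewrite (bigD1 j) //= lerDl sumr_ge0 //.
Qed.

(** The values [L j] of the affine function of the mirror at the vertices are the coefficients of
    [a] on the gradients. All but [L i] are at most [eta], so the unit length of [a] forces [L i] to
    be close to the altitude [e]. The constant [K] depends on [D], [i] and [x] only. *)
Lemma close_mirror_bound (D : simplex R n) i x : exists2 K, 0 <= K &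
  forall G eta a k, 0 < eta -> close_mirror G D i eta a k ->
    enorm (rfl a k x - frefl D i x) <= K * eta.
Proof.
have bp := enorm_bdir_gt0 n0 D i.
pose S := \sum_j enorm (bdir D j); pose e := (enorm (bdir D i))^-1.
pose B := \sum_j `|bary D j x|.
have S0 : 0 <= S by apply: sumr_ge0 => j _; exact: enorm_ge0.
have B0 : 0 <= B by apply: sumr_ge0.
have e0 : 0 < e by rewrite invr_gt0.
exists (2 * (B + S * e * `|bary D i x| + e * `|bary D i x| * (2 * S))).
  by rewrite !(mulr_ge0, addr_ge0) // ltW.
move=> G eta a k eta0 [a1 _ L0 Le].
pose L j := dot a (vertex D j) - k.
have LE z : dot a z - k = \sum_j bary D j z * L j by exact: affine_bary.
have aE : a = \sum_j L j *: bdir D j.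
  apply: dot_inj => z; rewrite dot_suml.
  have -> : dot a z = (dot a z - k) - (dot a 0 - k) by rewrite dot0r; ring.
  rewrite !LE -sumrB; apply: eq_bigr => j _.
  by rewrite dotZl -mulrBl mulrC baryB subr0.
pose w := \sum_(j | j != i) L j *: bdir D j.
have aw : a = L i *: bdir D i + w by rewrite aE (bigD1 i).
have wS : enorm w <= eta * S.
  apply: le_trans (enorm_sum _ _ _) _.
  rewrite /S mulr_sumr [X in _ <= X](bigD1 i) //= -[X in X <= _]add0r lerD //.
    by rewrite mulr_ge0 ?enorm_ge0 // ltW.
  apply: ler_sum => j ji; rewrite enormZ ger0_norm ?L0 //.
  by rewrite ler_wpM2r ?enorm_ge0 // Le.
have Li : `|L i - e| <= eta * S * e.
  rewrite -(ler_pM2r bp) /e mulfVK ?gt_eqF // -{2}(gtr0_norm bp) -normrM mulrBl mulVf ?gt_eqF //.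
  have ea : enorm a = 1 by rewrite /enorm a1 sqrtr1.
  have Lb : enorm (L i *: bdir D i) = L i * enorm (bdir D i) by rewrite enormZ ger0_norm ?L0.
  have h1 := enormD (L i *: bdir D i) w; rewrite -aw ea Lb in h1.
  have h2 := enormD a (- w); rewrite {1}aw addrK enormN ea Lb in h2.
  by rewrite ler_norml; lra.
pose Lx := dot a x - k; pose L'x := e * bary D i x.
have dL : `|Lx - L'x| <= eta * (B + S * e * `|bary D i x|).
  rewrite /Lx LE (bigD1 i) //= /L'x.
  set T := \sum_(j | _) _.
  have -> : bary D i x * L i + T - e * bary D i x = (L i - e) * bary D i x + T by ring.
  apply: le_trans (ler_normD _ _) _; rewrite mulrDr addrC lerD //.
    apply: le_trans (ler_norm_sum _ _ _) _.
    rewrite /B mulr_sumr [X in _ <= X](bigD1 i) //= -[X in X <= _]add0r lerD //.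
      by rewrite mulr_ge0 // ltW.
    apply: ler_sum => j ji; rewrite normrM mulrC ler_wpM2r // ger0_norm ?L0 //.
    exact: Le.
  by rewrite normrM mulrA mulrA ler_wpM2r.
pose a' := e *: bdir D i.
have da : enorm (a - a') <= eta * (2 * S).
  have -> : a - a' = (L i - e) *: bdir D i + w by rewrite {1}aw /a' (scalerBl (L i) e) addrAC.
  apply: le_trans (enormD _ _) _.
  have -> : eta * (2 * S) = eta * S + eta * S by ring.
  rewrite lerD // enormZ; apply: le_trans (ler_wpM2r (ltW bp) Li) _.
  have ee : e * enorm (bdir D i) = 1 by rewrite mulVf // gt_eqF.
  by rewrite -[_ * e * _]mulrA ee mulr1.
have ea : enorm a = 1 by rewrite /enorm a1 sqrtr1.
have -> : rfl a k x - frefl D i x = -2 *: ((Lx - L'x) *: a + L'x *: (a - a')).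
  rewrite freflE /rfl a1 divr1 -/Lx /L'x /a' -sqr_enorm.
  apply/rowP => j; rewrite !mxE /e; field; by rewrite gt_eqF.
rewrite enormZ normrN ger0_norm // -[X in _ <= X]mulrA ler_wpM2l //.
apply: le_trans (enormD _ _) _; rewrite !enormZ ea mulr1 mulrDl lerD //.
  by rewrite mulrC.
rewrite /L'x normrM (gtr0_norm e0) -[X in _ <= X]mulrA; apply: ler_wpM2l.
  by rewrite mulr_ge0 // ltW.
by rewrite mulrC.
Qed.

(* Mirrors passing close to the centre of a facet have the chamber on one side,
   so they are close to the hyperplane of the facet; by discreteness two such
   reflections coincide, hence equal the facet reflection. *)
Lemma chamber_facet_reflections G (D : simplex R n) :
  discrete_crit G -> G idfun -> (forall g h, G g -> G h -> G (g \o h)) ->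
  is_chamber G (simplex_set D) -> forall i, G (frefl D i).
Proof.
move=> dG G1 GM cD i.
have [xs [e [e0 he]]] := dG _ G1.
have [K K0 hK] : exists2 K, 0 <= K & forall G eta a k x, x \in xs -> 0 < eta ->
    close_mirror G D i eta a k -> enorm (rfl a k x - frefl D i x) <= K * eta.
  elim: xs {he} => [|x xs [K K0 hK]]; first by exists 0.
  have [L L0 hL] := close_mirror_bound D i x.
  exists (K + L); first by rewrite addr_ge0.
  move=> G' eta a k y; rewrite inE => /orP[/eqP-> eta0 /(hL _ _ _ _ eta0) h|yx eta0 /(hK _ _ _ _ _ yx eta0) h];
    by apply: le_trans h _; rewrite ler_pM2r // ?lerDl ?lerDr.
(* The product of two reflections in such mirrors moves every test point by at most
   [2 * K * eta0 < e], so it is the identity. *)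
pose eta0 := e / (2 * K + 1).
have eta0p : 0 < eta0 by rewrite divr_gt0 // ltr_pwDr // mulr_ge0.
have nz a : dot a a = 1 -> a != 0 by move=> h; rewrite -dot_eq0 h oner_eq0.
have same a k b l : close_mirror G D i eta0 a k -> close_mirror G D i eta0 b l ->
    rfl a k = rfl b l.
  move=> ha hb; have [a1 Ga _ _] := ha; have [b1 Gb _ _] := hb.
  have : rfl a k \o rfl b l = idfun.
    apply: he; first exact: GM.
    move=> x xin /=; rewrite -{2}(rflK k (nz _ a1) x) enorm_rfl ?nz //.
    have -> : rfl b l x - rfl a k x = (rfl b l x - frefl D i x) - (rfl a k x - frefl D i x).
      by move: (rfl a k x) (rfl b l x) (frefl D i x) => p q c; rewrite opprB addrA subrK.
    apply: le_lt_trans (enormD _ _) _; rewrite enormN.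
    apply: le_lt_trans (lerD (hK _ _ _ _ _ xin eta0p hb) (hK _ _ _ _ _ xin eta0p ha)) _.
    rewrite -mulrDl -mulr2n -mulr_natl /eta0 mulrCA gtr_pMr // ltr_pdivrMr ?mul1r; last first.
      by rewrite ltr_pwDr // mulr_ge0.
    by rewrite ltrDl.
  move=> E; apply/funext => x; have := congr1 (fun f => f (rfl b l x)) E => /=.
  by rewrite /= rflK ?nz.
have [a [k hak]] := close_mirror_exists i cD eta0p.
suff <- : rfl a k = frefl D i by case: hak.
apply/funext => x; have [L L0 hL] := close_mirror_bound D i x.
apply/eqP; rewrite -subr_eq0 -enorm_eq0 eq_le enorm_ge0 andbT.
apply/ler_addgt0Pr => d d0; rewrite add0r.
pose eta := Order.min eta0 (d / (L + 1)).
have L1 : 0 < L + 1 by rewrite ltr_pwDr.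
have etap : 0 < eta by rewrite lt_min eta0p divr_gt0.
have [b [l hbl]] := close_mirror_exists i cD etap.
have hbl' : close_mirror G D i eta0 b l.
  case: hbl => h1 h2 h3 h4; split => // j /h4 h; apply: le_trans h _.
  by rewrite /eta ge_min lexx.
rewrite (same _ _ _ _ hak hbl'); apply: le_trans (hL _ _ _ _ etap hbl) _.
apply: (@le_trans _ _ ((L + 1) * (d / (L + 1)))); last by rewrite mulrC divfK ?gt_eqF.
apply: ler_pM => //; rewrite ?lerDl ?(ltW etap) //.
by rewrite /eta ge_min lexx orbT.
Qed.

(** The component of the barycentre is the open simplex: a connected set free of mirrors cannot
    cross the facet hyperplanes, and the open simplex is convex and meets no mirror. *)
Lemma is_chamberP G (D : simplex R n) :
  (forall i, G (frefl D i)) -> avoids_interior G D -> is_chamber G (simplex_set D).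
Proof.
move=> GD av; set m := barycenter D.
have bm i : 0 < bary D i m by rewrite bary_barycenter invr_gt0.
have int_noM y : (forall i, 0 < bary D i y) -> (~` mirrors G) y.
  by move=> hy /mirrorsP[a [k [a0 Ga]]]; exact: av.
exists m; first exact: int_noM.
have CE : connected_component (~` mirrors G) m = [set y | forall i, 0 < bary D i y].
  apply/seteqP; split=> [y Cy i|y hy].
    rewrite ltNge; apply/negP => yi.
    have Cm : connected_component (~` mirrors G) m m.
      by apply: connected_component_refl; exact: int_noM.
    have [z Cz zi] := connected_ivt (@component_connected _ _ _) (@bary_continuous D i) Cy Cm
      (k := 0) (introT andP (conj yi (ltW (bm i)))).
    have : (~` mirrors G) z by exact: connected_component_sub Cz.
    apply; apply/mirrorsP; exists (bdir D i), (- bary D i 0); split => //.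
    + exact: bdir_neq0.
    + exact: GD.
    + by move: zi; rewrite baryE => /eqP; rewrite addrC addr_eq0 => /eqP.
  apply: segment_component => t /andP[t0 t1]; apply: int_noM => i.
  rewrite bary_conv; have := bm i; have := hy i.
  move: (bary D i y) (bary D i m) => p q; nra.
rewrite CE; apply/seteqP; split=> y.
  move=> /simplex_setE hy B /nbhs_enorm[e e0 hB].
  have [p0 pp pe] : exists2 p, 0 < p & p = e + enorm (m - y) + 1.
    eexists; last by reflexivity. by rewrite ltr_pwDr // addr_ge0 ?enorm_ge0 // ltW.
  pose t := e / p0.
  have t0 : 0 < t by rewrite divr_gt0.
  have t1 : t <= 1.
    by rewrite ler_pdivrMr // mul1r pe -addrA lerDl addr_ge0 ?enorm_ge0.
  exists (y + t *: (m - y)); split.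
    move=> i; rewrite bary_conv; have := bm i; have := hy i.
    move: (bary D i y) (bary D i m) => a b; nra.
  apply: hB; rewrite addrC addKr enormZ gtr0_norm // /t mulrAC ltr_pdivrMr //.
  rewrite ltr_pM2l // pe -addrA addrC -addrA ltrDl; lra.
move=> hy; apply/simplex_setE => i; rewrite leNgt; apply/negP => yi.
have : nbhs y [set z | bary D i z < 0].
  by apply: (@bary_continuous D i y [set r | r < 0]); apply: lt_nbhsl.
by move=> /hy[z [/(_ i) /= z0 z1]]; have := lt_trans z0 z1; rewrite ltxx.
Qed.

Lemma reflection_group_conj A b r s (P Q : simplex R n) psi :
  affine_image A b r s P Q ->
  cancel (fun x => x *m A + b) psi -> cancel psi (fun x => x *m A + b) ->
  forall g, reflection_group P g ->
    reflection_group Q ((fun x => x *m A + b) \o g \o psi).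
Proof.
move=> h pK Kp; have [_ _ si _] := h; have [t st ts] := injF_bij si.
apply: (reflection_group_ind n0).
- by rewrite (_ : _ \o _ = idfun); [exact: gen_id | apply/funext => y /=; rewrite Kp].
- move=> i; rewrite (_ : _ \o _ = frefl Q (t i)); first exact: reflection_group_frefl.
  by apply/funext => y /=; rewrite -{2}(Kp y) (frefl_affine n0 h) ts.
- move=> g k hg hk; rewrite (_ : _ \o _ = ((fun x => x *m A + b) \o g \o psi) \o
    ((fun x => x *m A + b) \o k \o psi)); first exact: gen_comp.
  by apply/funext => y /=; rewrite pK.
- move=> g k hg gk kg; apply: (gen_inv hg).
    by move=> y /=; rewrite pK gk Kp.
  by move=> y /=; rewrite pK kg Kp.
Qed.

(** Discreteness and the chamber condition restated with distances and reflections only, a form that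
    is easily transported along a similarity. *)
Definition chamber_data (P D : simplex R n) :=
  [/\ discrete_crit (reflection_group P),
      forall i, reflection_group P (frefl D i)
    & avoids_interior (reflection_group P) D].

Lemma chamber_dataP P D : chamber_data P D <->
  discrete_group (reflection_group P) /\ is_chamber (reflection_group P) (simplex_set D).
Proof.
split=> [[dG GD av]|[/discrete_groupP dG cD]].
  by split; [apply/discrete_groupP | apply: is_chamberP].
split => //; last exact: chamber_avoids.
by apply: chamber_facet_reflections => //; [exact: gen_id | move=> g h; exact: gen_comp].
Qed.

Lemma chamber_data_affine A b r s t (P P' D D' : simplex R n) :
  affine_image A b r s P P' -> affine_image A b r t D D' ->
  chamber_data P D -> chamber_data P' D'.
Proof.
move=> hP hD [dG GD av]; have [r0 hA _ _] := hP.
have [psi1 psi2] := sim_conjK b r0 hA.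
set phi := (fun x => x *m A + b) in psi1 psi2.
set psi := (fun y => _) in psi1 psi2.
have [s' [ss' s's hP']] := affine_image_sym hP.
have psiE : psi = (fun y => y *m (r ^- 2 *: A^T) + - (b *m (r ^- 2 *: A^T))).
  by apply/funext => y; rewrite /psi mulmxBl.
have up g : reflection_group P g -> reflection_group P' (phi \o g \o psi).
  exact: reflection_group_conj hP psi1 psi2 g.
have down g : reflection_group P' g -> reflection_group P (psi \o g \o phi).
  rewrite psiE in psi1 psi2 *; exact: reflection_group_conj hP' psi2 psi1 g.
have ephi x y : enorm (phi x - phi y) = r * enorm (x - y).
  rewrite /phi opprD addrACA subrr addr0 -mulmxBl.
  by rewrite /enorm (dot_mulmx _ _ hA) sqrtrM ?sqr_ge0 // sqrtr_sqr gtr0_norm.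
split.
- move=> g Gg; have [xs [e [e0 he]]] := dG _ (down _ Gg).
  exists (map phi xs), (r * e); split; first by rewrite mulr_gt0.
  move=> h Gh hh; have E : psi \o h \o phi = psi \o g \o phi.
    apply: he; first exact: down.
    move=> x xin /=; rewrite -(ltr_pM2l r0) -ephi !psi2; apply: hh.
    by apply: map_f.
  apply/funext => y; have := congr1 (fun f => phi (f (psi y))) E.
  by rewrite /= !psi2.
- have [t' tt' t't] := injF_bij (let: And4 _ _ ti _ := hD in ti).
  move=> i; have := up _ (GD (t i)); congr reflection_group.
  apply/funext => y /=.
  have e : frefl D' i (phi (psi y)) = phi (frefl D (t i) (psi y)) := frefl_affine n0 hD i (psi y).
  by rewrite psi2 in e.
- move=> a k y a0 Ga yD ay.
  have [A1 A2] := sim_mulmxV r0 hA.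
  pose A' := r ^- 2 *: A^T.
  have [r'0 hA' _ _] := hP'.
  have a'0 : a *m A' != 0.
    by apply: contra_neq a0 => e; rewrite -[a]mulmx1 -A2 mulmxA e mul0mx.
  have rr : r^-1 ^+ 2 != 0 by rewrite expf_neq0 // invr_eq0 gt_eqF.
  have conjE x := rfl_conj (- (b *m A')) a k x rr hA'.
  apply: (av (a *m A') (r^-1 ^+ 2 * k + dot (a *m A') (- (b *m A'))) (psi y) a'0).
  + have := down _ Ga; congr reflection_group.
    apply/funext => x /=.
    have pe w : w *m A' + - (b *m A') = psi w by rewrite psiE.
    by have e := conjE (phi x); rewrite !pe psi1 in e; rewrite -e.
  + move=> i; have [t' tt' t't] := injF_bij (let: And4 _ _ ti _ := hD in ti).
    have e : bary D' (t' i) (phi (psi y)) = bary D (t (t' i)) (psi y) := bary_affine hD _ _.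
    by rewrite t't psi2 in e; rewrite -e.
  + rewrite psiE dotDr; congr (_ + _); rewrite (dot_mulmx _ _ hA') ay //.
Qed.

End Topology.

(** * Roots of B_n and their hyperplanes *)

Section FacetFunctional.
Variables (R : realType) (n : nat).
Hypothesis n0 : (0 < n)%N.
Implicit Types (P D : simplex R n) (x y z a b : 'rV[R]_n).

Lemma facet_bary P i a k : (forall j, j != i -> dot a (vertex P j) = k) ->
  forall x, dot a x - k = (dot a (vertex P i) - k) * bary P i x.
Proof.
move=> h x; rewrite (affine_bary P) (bigD1 i) //= big1 ?addr0 1?mulrC // => j ji.
by rewrite h // subrr mulr0.
Qed.

Lemma facet_bdir P i a k : (forall j, j != i -> dot a (vertex P j) = k) ->
  a = (dot a (vertex P i) - k) *: bdir P i.
Proof.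
move=> h; have hb := facet_bary h; apply: dot_inj => z; rewrite dotZl.
have -> : dot a z = (dot a z - k) - (dot a 0 - k) by rewrite dot0r; ring.
by rewrite (hb z) (hb 0) -mulrBr baryB subr0.
Qed.

Lemma facet_frefl P i a k : (forall j, j != i -> dot a (vertex P j) = k) ->
  dot a (vertex P i) != k -> frefl P i = rfl a k.
Proof.
move=> h; rewrite -subr_eq0; have hb := facet_bary h; have aE := facet_bdir h.
move: (dot a (vertex P i) - k) hb aE => d hb aE d0.
have kE : k = d * - bary P i 0.
  by have := hb 0; rewrite dot0r sub0r mulrN => <-; rewrite opprK.
by rewrite aE kE rflZ.
Qed.

Lemma facet_normal P i a k : (forall j, j != i -> dot a (vertex P j) = k) ->
  dot a (vertex P i) < k -> outward_normal P i = (enorm a)^-1 *: a.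
Proof.
move=> h hi; have a0 : a != 0.
  have [j ji] := other_index n0 i.
  by apply: contraTneq hi => a0; rewrite -(h j ji) a0 !dot0l ltxx.
have e0 := enorm_gt0 a0.
apply: outward_normalP => //; split.
- by rewrite !dotrE -sqr_enorm; field; rewrite gt_eqF.
- by move=> j l ji li; rewrite dotZl dotBr !h // subrr mulr0.
- by move=> j ji; rewrite dotZl dotBr (h j) // pmulr_rlt0 ?invr_gt0 // subr_lt0.
Qed.

Lemma rfl_conj_rfl a k b l : a != 0 -> b != 0 ->
  rfl a k \o rfl b l \o rfl a k =
  rfl (b - (2 * dot a b / dot a a) *: a) (l - 2 * dot a b / dot a a * k).
Proof.
move=> a0 b0; have aa : dot a a != 0 by rewrite dot_eq0.
have bb : dot b b != 0 by rewrite dot_eq0.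
apply/funext => x /=; set b' := b - _; set l' := l - _.
have b'b' : dot b' b' = dot b b.
  by rewrite /b' !dotrE (dotC b a); field.
have h : dot b (rfl a k x) - l = dot b' x - l'.
  by rewrite /rfl /b' /l' !dotrE (dotC b a); field.
rewrite [X in rfl a k X]/rfl h [in RHS]/rfl b'b'.
set t := 2 * _ / _; rewrite -[X in _ = X - _](rflK k a0 x).
set y := rfl a k x.
rewrite /rfl dotBr dotZr /b'; apply/rowP => j; rewrite !mxE; field => //.
Qed.

Lemma rfl_neq0 a b : a != 0 -> b != 0 -> b - (2 * dot a b / dot a a) *: a != 0.
Proof.
move=> a0 b0; have aa : dot a a != 0 by rewrite dot_eq0.
rewrite -dot_eq0; have -> : dot (b - (2 * dot a b / dot a a) *: a) (b - (2 * dot a b / dot a a) *: a)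
  = dot b b by rewrite !dotrE (dotC b a); field.
by rewrite dot_eq0.
Qed.

Lemma mirrors_rfl (G : set ('rV[R]_n -> 'rV[R]_n)) a k x :
  (forall g h, G g -> G h -> G (g \o h)) -> a != 0 -> G (rfl a k) ->
  mirrors G x -> mirrors G (rfl a k x).
Proof.
move=> GM a0 Ga /mirrorsP[b [l [b0 Gb bx]]]; apply/mirrorsP.
exists (b - (2 * dot a b / dot a a) *: a), (l - 2 * dot a b / dot a a * k).
split; first exact: (rfl_neq0 a0 b0).
  by rewrite -rfl_conj_rfl //; exact: GM (GM _ _ Ga Gb) Ga.
have aa : dot a a != 0 by rewrite dot_eq0.
by rewrite /rfl !dotrE bx (dotC b a); field.
Qed.

End FacetFunctional.

(** * Integer root hyperplanes, generic points and descent to the alcove *)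

Section Roots.
Variables (R : realType) (n : nat).
Implicit Types (x y z a b : 'rV[R]_n).

Definition intv x := forall i, x 0 i \is a Num.int.

(* The roots of B_n: the integer vectors of square length 1 or 2. *)
Definition is_root a := intv a /\ (dot a a = 1 \/ dot a a = 2).

Lemma intvD x y : intv x -> intv y -> intv (x + y).
Proof. by move=> hx hy i; rewrite mxE rpredD. Qed.

Lemma intvZ t x : t \is a Num.int -> intv x -> intv (t *: x).
Proof. by move=> ht hx i; rewrite mxE rpredM. Qed.

Lemma intvN x : intv x -> intv (- x).
Proof. by move=> hx i; rewrite mxE rpredN. Qed.

Lemma intvB x y : intv x -> intv y -> intv (x - y).
Proof. by move=> hx hy; apply/intvD/intvN. Qed.

Lemma intv_dot x y : intv x -> intv y -> dot x y \is a Num.int.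
Proof. by move=> hx hy; rewrite dotE rpred_sum // => i _; rewrite rpredM. Qed.

Lemma root_neq0 a : is_root a -> a != 0.
Proof.
move=> [_ h]; rewrite -dot_eq0; case: h => ->; first by rewrite oner_eq0.
by rewrite pnatr_eq0.
Qed.

Lemma root_coef_int a t : is_root a -> t \is a Num.int -> 2 * t / dot a a \is a Num.int.
Proof.
move=> [_ h] ht; case: h => ->; first by rewrite divr1 rpredM // rpred_nat.
by rewrite mulrC mulKf // pnatr_eq0.
Qed.

Lemma int_small (t : R) : t \is a Num.int -> `|t| < 1 -> t = 0.
Proof.
move=> /intrP[m ->]; rewrite -intr_norm -[1]/(1%:~R) ltr_int => h.
by have -> : m = 0 by lia.
Qed.

Lemma int_sqr_le2 (t : R) : t \is a Num.int -> t ^+ 2 <= 2 -> [\/ t = 0, t = 1 | t = -1].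
Proof.
move=> /intrP[m ->]; rewrite -rmorphXn -[2]/(2%:~R) ler_int => h.
have : m = 0 \/ m = 1 \/ m = -1 by nia.
by case=> [->|[->|->]]; [constructor 1 | constructor 2 | constructor 3].
Qed.

Lemma pm1_sqr (s : R) : s = 1 \/ s = -1 -> s ^+ 2 = 1.
Proof. by case=> ->; rewrite ?sqrrN expr1n. Qed.

Lemma pm1_int (s : R) : s = 1 \/ s = -1 -> s \is a Num.int.
Proof. by case=> ->; rewrite ?rpredN rpred1. Qed.

Local Notation e_ := (fun i => delta_mx 0 i : 'rV[R]_n).

Lemma root_form a : is_root a -> exists i s, (s = 1 \/ s = -1) /\
  ((a = s *: e_ i /\ dot a a = 1) \/
   exists j t, [/\ j != i, t = 1 \/ t = -1, a = s *: e_ i + t *: e_ j & dot a a = 2]).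
Proof.
move=> ra; have [ia h] := ra.
have le2 : dot a a <= 2 by case: h => ->; rewrite ?lexx // ler1n.
have sq0 i : 0 <= a 0 i ^+ 2 by exact: sqr_ge0.
have dE : dot a a = \sum_i a 0 i ^+ 2 by rewrite dotE; apply: eq_bigr => i _; rewrite expr2.
have val i : [\/ a 0 i = 0, a 0 i = 1 | a 0 i = -1].
  apply: int_sqr_le2 => //; apply: le_trans le2; rewrite dE (bigD1 i) //= lerDl.
  by rewrite sumr_ge0.
have pm i : a 0 i != 0 -> a 0 i = 1 \/ a 0 i = -1.
  by case: (val i) => [->|->|->]; rewrite ?eqxx; auto.
have [i ai] : exists i, a 0 i != 0.
  apply/existsP; apply: contraT; rewrite negb_exists => /forallP h0.
  have := root_neq0 ra; rewrite -dot_eq0 dE big1 ?eqxx // => k _.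
  by move: (h0 k); rewrite negbK => /eqP->; rewrite expr0n.
exists i, (a 0 i); split; first exact: pm.
have [[j /andP[ji aj]]|none] := pselect (exists j, (j != i) && (a 0 j != 0)).
  right; exists j, (a 0 j).
  have rest : \sum_(k | (k != i) && (k != j)) a 0 k ^+ 2 = 0.
    apply/eqP; rewrite eq_le sumr_ge0 // andbT.
    move: le2; rewrite dE (bigD1 i) //= (bigD1 j) //= (pm1_sqr (pm _ ai)) (pm1_sqr (pm _ aj)).
    lra.
  have z k : k != i -> k != j -> a 0 k = 0.
    move=> ki kj; move/eqP: rest; rewrite psumr_eq0 // => /allP /(_ k (mem_index_enum _)).
    by rewrite ki kj /= sqrf_eq0 => /eqP.
  split => //; first exact: pm.
    apply/rowP => k; rewrite !mxE eqxx /=.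
    have [->|ki] := eqVneq k i; first by rewrite eq_sym (negbTE ji) mulr1 mulr0 addr0.
    have [->|kj] := eqVneq k j; first by rewrite mulr1 mulr0 add0r.
    by rewrite z // !mulr0 addr0.
  rewrite dE (bigD1 i) //= (bigD1 j) //= rest (pm1_sqr (pm _ ai)) (pm1_sqr (pm _ aj)).
  lra.
left; have z k : k != i -> a 0 k = 0.
  move=> ki; apply/eqP; rewrite -[_ == _]negbK; apply/negP => h0.
  by apply: none; exists k; rewrite ki.
split.
  apply/rowP => k; rewrite !mxE eqxx /=.
  by have [->|ki] := eqVneq k i; rewrite ?mulr1 // mulr0 z.
by rewrite dE (bigD1 i) //= big1 ?addr0 ?(pm1_sqr (pm _ ai)) // => k ki; rewrite z // expr0n.
Qed.

Lemma intv_delta i : intv (e_ i).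
Proof. by move=> j; rewrite mxE rpred_nat. Qed.

(** A finite list containing the roots, for the induction in [generic_point]. An element [k] of
    ['I_3] encodes the coefficient [k - 1] in -1, 0, 1, and the list also has members that are not
    roots. *)
Definition all_roots : seq 'rV[R]_n :=
  [seq (p.1.2%:R - 1) *: e_ p.1.1 + (p.2.2%:R - 1) *: e_ p.2.1
     | p : ('I_n * 'I_3) * ('I_n * 'I_3)].

Lemma mem_all_roots a : is_root a -> a \in all_roots.
Proof.
have code (s : R) : s = 1 \/ s = -1 -> exists k : 'I_3, k%:R - 1 = s.
  case=> ->; [exists (inord 2) | exists (inord 0)]; rewrite inordK //; lra.
move=> /root_form[i [s [/code[k <-]]]] [[-> _]|[j [t [ji /code[l <-] -> _]]]].
  apply/mapP; exists ((i, k), (i, inord 1 : 'I_3)); first by rewrite mem_enum.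
  by rewrite /= inordK // subrr scale0r addr0.
by apply/mapP; exists ((i, k), (j, l)); rewrite ?mem_enum.
Qed.

Lemma int_gap (r : R) : ~ r \is a Num.int ->
  exists2 d, 0 < d & forall m, m \is a Num.int -> d <= `|r - m|.
Proof.
move=> hr; have fl := floor_le_tmp r; have fu := lt_succ_floor r.
set f := Num.floor r in fl fu.
have fl' : f%:~R < r.
  rewrite lt_neqAle fl andbT; apply/eqP => e; apply: hr; rewrite -e.
  by apply/intrP; exists f.
exists (Order.min (r - f%:~R) ((f + 1)%:~R - r)).
  by rewrite lt_min !subr_gt0 fl'.
move=> _ /intrP[m ->]; have [mf|fm] := leP m f.
  rewrite ge_min; apply/orP; left; apply: le_trans (ler_norm _).
  by rewrite lerB // ler_int.
rewrite ge_min; apply/orP; right; rewrite distrC; apply: le_trans (ler_norm _).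
by rewrite lerB // ler_int lezD1.
Qed.

(** One bound [d] for all roots and levels: it is preserved by the reflections and bounds from below
    the gain of each step in [generic_descent]. *)
Definition generic (d : R) x :=
  forall b m, is_root b -> m \is a Num.int -> d <= `|dot b x - m|.

Definition root_hyperplane f c := exists a t m,
  [/\ is_root a, t != 0, m \is a Num.int, f = t *: a & c = t * m].

Lemma generic_point f c : f != 0 -> ~ root_hyperplane f c ->
  exists y d, [/\ dot f y = c, 0 < d & generic d y].
Proof.
move=> f0 nr; have ff := dot_gt0 f0.
suff [y [d [fy d0 h]]] : exists y d, [/\ dot f y = c, 0 < d & forall b m,
    b \in all_roots -> is_root b -> m \is a Num.int -> d <= `|dot b y - m|].
  by exists y, d; split => // b m rb; apply: h => //; exact: mem_all_roots.
elim: all_roots => [|a s [y [d [fy d0 h]]]].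
  exists ((c / dot f f) *: f), 1; split => //.
  by rewrite dotZr divfK // gt_eqF.
have [ra|nra] := pselect (is_root a); last first.
  by exists y, d; split => // b m; rewrite inE => /orP[/eqP->//|]; exact: h.
have [ay|ay] := pselect (dot a y \is a Num.int); last first.
  have [e e0 he] := int_gap ay; exists y, (Order.min d e); split => //.
    by rewrite lt_min d0.
  move=> b m; rewrite inE => /orP[/eqP-> _ /he|bs rb mi].
    by apply: le_trans; rewrite ge_min lexx orbT.
  by apply: le_trans (h _ _ bs rb mi); rewrite ge_min lexx.
(* The point has to leave the hyperplane [dot a x = dot a y], so it moves along the projection [z]
   of [a] to the direction of the given hyperplane. If [z] were 0, the given hyperplane would be
   that root hyperplane, with the integer level [dot a y]. *)
pose z := a - (dot a f / dot f f) *: f.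
have fz : dot f z = 0 by rewrite /z dotBr dotZr (dotC f a) divfK ?subrr // gt_eqF.
have az : dot a z = dot z z.
  by rewrite [in RHS]/z dotBl dotZl fz mulr0 subr0.
have z0 : z != 0.
  rewrite subr_eq0; apply/eqP => aE; apply: nr.
  set t := dot a f / dot f f in aE.
  have t0 : t != 0 by apply: contra_neq (root_neq0 ra) => t0; rewrite aE t0 scale0r.
  exists a, t^-1, (dot a y); split => //; first by rewrite invr_eq0.
    by rewrite aE scalerA mulVf ?scale1r.
  by rewrite aE dotZl fy mulKf.
have zz := dot_gt0 z0.
pose S := 1 + \sum_(b <- s) `|dot b z|.
have S0 : 0 < S by rewrite ltr_pwDl // sumr_ge0.
(* The first bound changes [dot a y] by at most 1/2, so no other integer comes near; the second
   changes [dot b y] by at most [d / 2] for the roots already treated. *)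
pose t := Order.min ((2 * dot z z)^-1) (d / (2 * S)).
have t0 : 0 < t by rewrite lt_min invr_gt0 mulr_gt0 //= divr_gt0 // mulr_gt0.
have tz : t * dot z z <= 2^-1.
  rewrite -ler_pdivlMr // -invfM mulrC; by rewrite /t ge_min mulrC lexx.
have tS : t * S <= d / 2.
  rewrite -ler_pdivlMr // -mulrA -invfM; by rewrite /t ge_min lexx orbT.
exists (y + t *: z), (Order.min (d / 2) (t * dot z z)); split.
- by rewrite dotDr dotZr fz mulr0 addr0.
- by rewrite lt_min divr_gt0 //= mulr_gt0.
move=> b m; rewrite inE => /orP[/eqP-> _ mi|bs rb mi].
  rewrite ge_min; apply/orP; right; rewrite dotDr dotZr az addrAC.
  have [e|ne] := eqVneq (dot a y - m) 0; first by rewrite e add0r ger0_norm // ltW // mulr_gt0.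
  have : 1 <= `|dot a y - m|.
    rewrite leNgt; apply: contra_neqN ne; apply: int_small; exact: rpredB.
  have := ler_normB (dot a y - m + t * dot z z) (t * dot z z).
  rewrite addrK (ger0_norm (ltW (mulr_gt0 t0 zz))); lra.
rewrite ge_min; apply/orP; left; rewrite dotDr dotZr addrAC.
have h1 := h _ _ bs rb mi.
have h2 : `|t * dot b z| <= d / 2.
  apply: le_trans tS; rewrite normrM (gtr0_norm t0) ler_wpM2l ?(ltW t0) // /S.
  have := big_rem _ bs (F := fun b => `|dot b z|) (P := xpredT) => /= ->.
  by rewrite addrCA lerDl addr_ge0 // sumr_ge0.
have := ler_normB (dot b y - m + t * dot b z) (t * dot b z); rewrite addrK; lra.
Qed.

Lemma root_rfl a b : is_root a -> is_root b -> is_root (rfl a 0 b).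
Proof.
move=> ra rb; have a0 := root_neq0 ra; have [ia _] := ra; have [ib hb] := rb.
split; first by rewrite /rfl subr0; apply/intvB/intvZ => //; apply/root_coef_int/intv_dot.
have -> : dot (rfl a 0 b) (rfl a 0 b) = dot b b => //.
have aa : dot a a != 0 by rewrite dot_eq0.
by rewrite /rfl !dotrE (dotC b a); field.
Qed.

(** The reflection permutes the integer root hyperplanes: a level changes by [c], which is an
    integer because [dot a a] is 1 or 2. *)
Lemma generic_rfl d a k x : is_root a -> k \is a Num.int ->
  generic d x -> generic d (rfl a k x).
Proof.
move=> ra ki hx b m rb mi.
have aa : dot a a != 0 by rewrite dot_eq0 root_neq0.
pose c := 2 * (dot a b * k) / dot a a.
have ci : c \is a Num.int.
  by apply: root_coef_int => //; rewrite rpredM // intv_dot //; [case: ra | case: rb].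
have -> : dot b (rfl a k x) - m = dot (rfl a 0 b) x - (m - c).
  by rewrite /rfl /c !dotrE (dotC b a); field.
by apply: hx; [exact: root_rfl | exact: rpredB].
Qed.

(** Reflecting [x] in a wall that separates it from the barycentre [p] lowers the squared distance
    to [p] by [4 / dot a a] times the product of the two distances to the wall measured by [dot a].
    With [dot a a <= 2] this is at least [2 * (d * q)], so finitely many reflections lead inside. *)
Lemma generic_descent (D : simplex R n) (al : 'I_n.+1 -> 'rV[R]_n) (k h : 'I_n.+1 -> R)
    (X : set 'rV[R]_n) d :
  (forall i, is_root (al i)) -> (forall i, k i \is a Num.int) -> (forall i, 0 < h i) ->
  (forall i x, dot (al i) x - k i = - h i * bary D i x) ->
  (forall i x, X x -> X (rfl (al i) (k i) x)) -> 0 < d ->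
  forall x, X x -> generic d x -> exists2 y, X y & forall i, 0 < bary D i y.
Proof.
move=> ra ki h0 hb XS d0; pose p := barycenter D.
have [q q0 hq] : exists2 q, 0 < q & forall i, q <= k i - dot (al i) p.
  apply: finite_pos_lb => i; rewrite -opprB hb mulNr opprK mulr_gt0 //.
  by rewrite bary_barycenter invr_gt0.
have dq : 0 < 2 * (d * q) by rewrite !mulr_gt0.
suff main : forall (m : nat) x, dot (x - p) (x - p) <= m%:R * (2 * (d * q)) ->
    X x -> generic d x -> exists2 y, X y & forall i, 0 < bary D i y.
  move=> x; apply: (main (Num.truncn (dot (x - p) (x - p) / (2 * (d * q)))).+1).
  by rewrite -ler_pdivrMr // ltW // truncnS_gt.
elim=> [|m IH] x hx Xx gx.
all: have [//|] := pselect (forall i, 0 < bary D i x); first by exists x.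
all: move=> /existsNP[i /negP]; rewrite -leNgt => bi.
all: have pos : 0 <= dot (al i) x - k i by rewrite hb mulNr oppr_ge0 pmulr_rle0.
all: have big : d <= dot (al i) x - k i by have := gx _ _ (ra i) (ki i); rewrite ger0_norm.
all: have aa : dot (al i) (al i) != 0 by rewrite dot_eq0 root_neq0.
all: have E : dot (rfl (al i) (k i) x - p) (rfl (al i) (k i) x - p) = dot (x - p) (x - p)
    - 4 / dot (al i) (al i) * ((dot (al i) x - k i) * (k i - dot (al i) p))
  by rewrite /rfl !dotrE (dotC x (al i)) (dotC p (al i)) (dotC p x); field.
all: have dec : dot (rfl (al i) (k i) x - p) (rfl (al i) (k i) x - p) <=
    dot (x - p) (x - p) - 2 * (d * q).
1,3: rewrite E lerD2l lerN2; apply: ler_pM; rewrite ?mulr_ge0 ?(ltW d0) ?(ltW q0) //;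
  [by case: (ra i) => _ [] ->; lra | by apply: ler_pM; rewrite ?(ltW d0) ?(ltW q0)].
  have := dot_ge0 (rfl (al i) (k i) x - p); move: dec hx; rewrite mul0r; lra.
apply: (IH (rfl (al i) (k i) x)).
- apply: le_trans dec _; move: hx; rewrite -natr1 mulrDl; lra.
- exact: XS.
- exact: generic_rfl.
Qed.

Lemma mirror_root (D : simplex R n) (al : 'I_n.+1 -> 'rV[R]_n) (k h : 'I_n.+1 -> R)
    (G : set ('rV[R]_n -> 'rV[R]_n)) :
  (forall i, is_root (al i)) -> (forall i, k i \is a Num.int) -> (forall i, 0 < h i) ->
  (forall i x, dot (al i) x - k i = - h i * bary D i x) ->
  (forall g h, G g -> G h -> G (g \o h)) -> (forall i, G (rfl (al i) (k i))) ->
  avoids_interior G D ->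
  forall f c, f != 0 -> G (rfl f c) -> root_hyperplane f c.
Proof.
move=> ra ki h0 hb GM GD av f c f0 Gf; apply: contrapT => nr.
have [y [d [fy d0 gy]]] := generic_point f0 nr.
have My : mirrors G y by apply/mirrorsP; exists f, c.
have MS i x : mirrors G x -> mirrors G (rfl (al i) (k i) x).
  by move=> Mx; apply: (mirrors_rfl GM (root_neq0 (ra i)) (GD i) Mx).
have [z /mirrorsP[a [l [a0 Ga az]]] hz] := generic_descent ra ki h0 hb MS d0 My gy.
exact: (av a l z a0 Ga hz az).
Qed.

End Roots.

(** * The standard simplices *)

Section Cosines.
Variable R : realType.

Lemma pi_frac_itv (t : R) : 0 <= t <= 1 -> 0 <= pi * t <= (pi : R).
Proof.
move=> /andP[t0 t1]; rewrite mulr_ge0 ?pi_ge0 //=.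
by rewrite -[X in _ <= X]mulr1 ler_wpM2l ?pi_ge0.
Qed.

Lemma cos_pi3 : cos (pi / 3) = 2^-1 :> R.
Proof.
have p := @pi_gt0 R; set c := cos _.
have c0 : 0 < c by apply: cos_gt0_pihalf; lra.
have e : cos (pi / 3 + (pi / 3) *+ 2) = -1 :> R.
  by rewrite (_ : _ + _ = pi) ?cospi //; field.
rewrite cosD cos_mulr2n sin_mulr2n -/c in e.
have s2 := cos2Dsin2 (pi / 3 : R); rewrite -/c in s2.
have : (c + 1) * (2 * c - 1) ^+ 2 = 0.
  have s2' : sin (pi / 3) ^+ 2 = 1 - c ^+ 2 :> R by lra.
  transitivity (4 * c ^+ 3 - 3 * c + 1); first by ring.
  have : c * (c ^+ 2 *+ 2 - 1) - 2 * c * sin (pi / 3) ^+ 2 = -1.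
    by rewrite -[RHS]e; ring.
  rewrite s2' => h; transitivity ((c * (c ^+ 2 *+ 2 - 1) - 2 * c * (1 - c ^+ 2)) + 1); first by ring.
  by rewrite h addNr.
move/eqP; rewrite mulf_eq0 sqrf_eq0 => /orP[/eqP|/eqP]; first lra.
lra.
Qed.

Lemma cos_2pi3 : cos (2 * pi / 3) = - 2^-1 :> R.
Proof.
rewrite (_ : 2 * pi / 3 = (pi / 3) *+ 2); last by field.
by rewrite cos_mulr2n cos_pi3; field.
Qed.

Lemma cos_pi4 : cos (pi / 4) = (Num.sqrt 2)^-1 :> R.
Proof.
have p := @pi_gt0 R; set c := cos _.
have c0 : 0 < c by apply: cos_gt0_pihalf; lra.
have e : cos ((pi / 4) *+ 2) = 0 :> R.
  by rewrite (_ : _ *+ 2 = pi / 2) ?cos_pihalf //; field.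
rewrite cos_mulr2n -/c in e.
have s0 : 0 < Num.sqrt 2 :> R by rewrite sqrtr_gt0.
apply/eqP; rewrite -(@eqrXn2 _ 2) ?invr_ge0 ?(ltW c0) ?(ltW s0) //.
by rewrite exprVn sqr_sqrtr //; apply/eqP; lra.
Qed.

End Cosines.

(* lia does not see through the generic projection [val]. *)
Ltac vlia := simpl in *; lia.

Section Standard.
Variables (R : realType) (n : nat).
Hypothesis hn : (3 <= n)%N.
Let n0 : (0 < n)%N := ltnW (ltnW hn).

(* Zero for [k >= n]. *)
Definition unit_vec (k : nat) : 'rV[R]_n := \row_j (j == k :> nat)%:R.
Local Notation E := unit_vec.

Lemma dot_unit_row k (F : nat -> R) :
  dot (E k) (\row_(j < n) F j) = if (k < n)%N then F k else 0.
Proof.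
case: ifP => kn.
  have -> : E k = delta_mx 0 (Ordinal kn).
    by apply/rowP => j; rewrite !mxE eqxx.
  by rewrite dotC dot_delta mxE.
have -> : E k = 0.
  by apply/rowP => j; rewrite !mxE; case: eqP => // jk; move: (ltn_ord j); rewrite jk kn.
by rewrite dot0l.
Qed.

Lemma dot_unit_unit k l : dot (E k) (E l) = ((k == l) && (k < n)%N)%:R.
Proof. by rewrite (dot_unit_row k (fun j => (j == l)%:R)) andbC; case: ifP. Qed.

Lemma dot_unit_coord (i : 'I_n) x : dot (E i) x = x 0 i.
Proof.
by rewrite dotC -[RHS]dot_delta; congr dot; apply/rowP => j; rewrite !mxE eqxx.
Qed.

(* Outward normals of the facets [x_0 + x_(N-1) = 1] for [i = 0],
   [x_i = x_(i-1)] for [0 < i < n] and [x_(n-1) = 0] for [i = n]. *)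
Definition std_root N i : 'rV[R]_n := if i is k.+1 then E k.+1 - E k else E 0 + E N.-1.
Local Notation A := std_root.

(** Vertex [j] has its first [j] coordinates equal and the others 0. For [j > 0] it lies on
    [x_0 + x_(N-1) = 1]: if [j < N] the coordinate [N - 1] is 0 and the common value is 1, otherwise
    both coordinates count and it is 1/2. *)
Definition std_scale N j : R := if (j < N)%N then 1 else 2^-1.

Definition std_vertex N (j : nat) : 'rV[R]_n := \row_k (std_scale N j * (k < j)%N%:R).

Lemma std_scale_gt0 N j : 0 < std_scale N j.
Proof. by rewrite /std_scale; case: ifP; rewrite ?invr_gt0. Qed.

Lemma dot_unit_vertex N k j : dot (E k) (std_vertex N j) = if (k < n)%N then std_scale N j * (k < j)%N%:R else 0.
Proof. exact: (dot_unit_row k (fun k => std_scale N j * (k < j)%N%:R)). Qed.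

Lemma dot_root_vertexS N i j : (i < n)%N -> (j <= n)%N ->
  dot (A N i.+1) (std_vertex N j) = - (std_scale N j * (i.+1 == j)%:R).
Proof.
move=> il jl; rewrite /A dotBl !dot_unit_vertex il.
have -> : (if (i.+1 < n)%N then std_scale N j * (i.+1 < j)%N%:R else 0) = std_scale N j * (i.+1 < j)%N%:R.
  case: ifP => // h; have -> : (i.+1 < j)%N = false by lia.
  by rewrite mulr0.
have -> : (i < j)%N%:R = (i.+1 < j)%N%:R + (i.+1 == j)%:R :> R.
  by rewrite -natrD; congr (_%:R); case: (ltngtP i.+1 j) => h; lia.
ring.
Qed.

Lemma dot_root_vertex0 N j : (2 <= N <= n)%N -> dot (A N 0) (std_vertex N j) = (j != 0)%:R.
Proof.
move=> hN; rewrite /A dotDl !dot_unit_vertex n0 (_ : (N.-1 < n)%N); last by lia.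
rewrite /std_scale; case: (ltnP j N) => h.
  rewrite (_ : (N.-1 < j)%N = false); last by lia.
  by rewrite mulr0 addr0 mul1r lt0n.
rewrite -lt0n; have -> : (0 < j)%N by lia.
have -> : (N.-1 < j)%N by lia.
by rewrite /=; field.
Qed.

Lemma std_vertex_independent N (t : 'I_n.+1 -> R) :
  \sum_i t i = 0 -> \sum_i t i *: std_vertex N i = 0 -> forall i, t i = 0.
Proof.
move=> h1 h2; have hS (i : 'I_n.+1) : i != ord0 -> t i = 0.
  move=> i0; case: i i0 => -[//|i] il i0.
  have := congr1 (dot (A N i.+1)) h2; rewrite dot0r dot_sumr.
  rewrite (bigD1 (Ordinal il)) //= big1 => [|j ji].
    rewrite addr0 dotZr dot_root_vertexS //.
    move/eqP; rewrite eqxx mulr1 mulrN oppr_eq0 mulf_eq0 (gt_eqF (std_scale_gt0 _ _)) orbF.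
    by move/eqP.
  rewrite dotZr dot_root_vertexS //; last by rewrite -ltnS.
  rewrite (_ : (i.+1 == j) = false) ?mulr0 ?oppr0 ?mulr0 //.
  by apply: contraNF ji => /eqP e; apply/eqP/val_inj.
move=> i; have [->|/hS//] := eqVneq i ord0.
by move: h1; rewrite (bigD1 ord0) //= big1 ?addr0 // => j /hS.
Qed.

Definition std_simplex N : simplex R n := Simplex (@std_vertex_independent N).
Local Notation Qs := std_simplex.

Definition std_level (i : nat) : R := (i == 0)%:R.
Local Notation lev := std_level.

(** The nodes of the graph are the coordinates: edge [e < n.-1] is the root [E e.+1 - E e], the
    closing edge [n.-1] is [E 0 + E N.-1], and the extra facet is the short root at the coordinate
    [n.-1], which is the node [u]. *)
Definition lab_std (x : option 'I_n) : 'I_n.+1 :=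
  if x is Some e then inord (if val e == n.-1 then 0 else e.+1) else ord_max.

Lemma lab_val e : val (lab_std (Some e)) = if val e == n.-1 then 0%N else e.+1.
Proof. by rewrite /= inordK //; case: ifP => // h; have := ltn_ord e; vlia. Qed.

Lemma lab_std_inj : injective lab_std.
Proof.
move=> [e|] [e'|] // /(congr1 val); rewrite ?lab_val /=.
- have := ltn_ord e; have := ltn_ord e'; case: eqP => h; case: eqP => h' //.
    by move=> _ _ _; congr Some; apply: val_inj; rewrite /= h h'.
  by move=> _ _ [] e1; congr Some; apply: val_inj.
- by case: eqP => h; have := ltn_ord e; vlia.
- by case: eqP => h; have := ltn_ord e'; vlia.
Qed.

Section FixN.
Variable N : nat.
Hypothesis hN : (2 <= N <= n)%N.

Lemma std_simplex_on (i j : 'I_n.+1) : j != i -> dot (A N i) (vertex (Qs N) j) = lev i.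
Proof.
case: i => -[|i] il ji /=.
  by rewrite dot_root_vertex0 // /lev eqxx (_ : (val j != 0)) //; move: ji; rewrite -val_eqE.
rewrite dot_root_vertexS //; last by rewrite -ltnS.
rewrite (_ : (i.+1 == j) = false) ?mulr0 ?oppr0 //.
by apply: contraNF ji => /eqP e; apply/eqP/val_inj.
Qed.

Lemma std_simplex_off (i : 'I_n.+1) : dot (A N i) (vertex (Qs N) i) < lev i.
Proof.
case: i => -[|i] il /=; first by rewrite dot_root_vertex0 // /lev eqxx ltr01.
by rewrite dot_root_vertexS // eqxx mulr1 oppr_lt0 std_scale_gt0.
Qed.

Lemma std_simplex_normal (i : 'I_n.+1) : outward_normal (Qs N) i = (enorm (A N i))^-1 *: A N i.
Proof. by apply: (facet_normal n0 (k := lev i)); [exact: std_simplex_on | exact: std_simplex_off]. Qed.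

Lemma std_simplex_frefl (i : 'I_n.+1) : frefl (Qs N) i = rfl (A N i) (lev i).
Proof. by apply: facet_frefl; [exact: std_simplex_on | rewrite lt_eqF // std_simplex_off]. Qed.

Lemma std_simplex_bary (i : 'I_n.+1) : exists2 h, 0 < h &
  forall x, dot (A N i) x - lev i = - h * bary (Qs N) i x.
Proof.
exists (lev i - dot (A N i) (vertex (Qs N) i)); first by rewrite subr_gt0 std_simplex_off.
by move=> x; rewrite opprB; apply: facet_bary; exact: std_simplex_on.
Qed.

(** The case [j.+1 = n] is included: there [E n] vanishes and the formula describes the short
    root. *)
Lemma dot_root_rootS i j : (i < j < n)%N -> dot (A N i.+1) (A N j.+1) = - (j == i.+1)%:R.
Proof.
move=> h; rewrite /A !dotrE !dot_unit_unit.
have -> : (i.+1 == j.+1) = false by lia.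
have -> : (i == j.+1) = false by lia.
have -> : (i == j) = false by lia.
have -> : (i.+1 == j) && (i.+1 < n)%N = (j == i.+1) by lia.
by rewrite !andFb /=; ring.
Qed.

(** The positive term is the obtuse angle at [c]. For [N = 2] and [j = 0] it cancels against the
    second one: the two edges of a double edge are orthogonal. *)
Lemma dot_root_root0 j : (j < n)%N ->
  dot (A N 0) (A N j.+1) = (j.+1 == N.-1)%:R - (j == 0)%:R - (j == N.-1)%:R.
Proof.
move=> h; rewrite /A !dotrE !dot_unit_unit.
have -> : (0 == j.+1) = false by lia.
have -> : (0 == j) && (0 < n)%N = (j == 0) by lia.
have -> : (N.-1 == j.+1) && (N.-1 < n)%N = (j.+1 == N.-1) by lia.
have -> : (N.-1 == j) && (N.-1 < n)%N = (j == N.-1) by lia.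
by rewrite !andFb /=; ring.
Qed.

Lemma dot_root_long i : (i < n)%N -> dot (A N i) (A N i) = 2.
Proof.
case: i => [|i] h; rewrite /A !dotrE !dot_unit_unit.
  have -> : (0 == N.-1) = false by lia.
  have -> : (N.-1 == 0) = false by lia.
  by rewrite !eqxx n0 (_ : (N.-1 < n)%N) /=; [ring | lia].
have -> : (i.+1 == i) = false by lia.
have -> : (i == i.+1) = false by lia.
by rewrite !eqxx h (ltnW h) /=; ring.
Qed.

Lemma dot_root_short : dot (A N n) (A N n) = 1.
Proof.
have -> : A N n = - E n.-1.
  rewrite -[X in A N X](prednK n0) /A (_ : E n.-1.+1 = 0) ?sub0r //.
  by apply/rowP => j; rewrite !mxE prednK // ltn_eqF.
by rewrite dotNl dotNr opprK dot_unit_unit eqxx (_ : (n.-1 < n)%N) //; lia.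
Qed.

Lemma intv_unit k : intv (E k).
Proof. by move=> i; rewrite mxE rpred_nat. Qed.

Lemma std_root_is_root (i : 'I_n.+1) : is_root (A N i).
Proof.
split; first by case: i => -[|i] il /=; [apply: intvD | apply: intvB]; exact: intv_unit.
have [e|ne] := eqVneq (i : nat) n; first by left; rewrite e dot_root_short.
by right; rewrite dot_root_long //; have := ltn_ord i; rewrite ltnS leq_eqVlt (negbTE ne).
Qed.

Lemma std_level_int i : lev i \is a Num.int.
Proof. by rewrite /lev rpred_nat. Qed.

Lemma gram_std_lt (i j : 'I_n.+1) : (i < j < n)%N ->
  gram (Qs N) i j = dot (A N i) (A N j) / 2.
Proof.
move=> h; rewrite /gram !std_simplex_normal !dotrE /enorm !dot_root_long; try lia.
rewrite mulrA -invfM -expr2 sqr_sqrtr ?ler0n // mulrC //.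
Qed.

Lemma gram_std_n (i j : 'I_n.+1) : (i < n)%N -> val j = n ->
  gram (Qs N) i j = dot (A N i) (A N j) / Num.sqrt 2.
Proof.
move=> h jn; rewrite /gram !std_simplex_normal !dotrE /enorm dot_root_long // jn dot_root_short sqrtr1.
by rewrite invr1 mul1r mulrC.
Qed.

Lemma dihedral_sym (P : simplex R n) i j : dihedral_angle P i j = dihedral_angle P j i.
Proof. by rewrite /dihedral_angle dotC. Qed.

Lemma dihedral_std_pi2 (i j : 'I_n.+1) : (i < j)%N -> dot (A N i) (A N j) = 0 ->
  dihedral_angle (Qs N) i j = pi / 2.
Proof.
move=> ij d; apply: dihedralE => //; first by apply: pi_frac_itv; lra.
have [jn|jn] := ltnP j n; first by rewrite gram_std_lt ?ij // d mul0r cos_pihalf oppr0.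
have jE : val j = n by have := ltn_ord j; rewrite /=; lia.
have il : (i < n)%N by vlia.
by rewrite gram_std_n // d mul0r cos_pihalf oppr0.
Qed.

Lemma dihedral_std_pi3 (i j : 'I_n.+1) : (i < j < n)%N -> dot (A N i) (A N j) = -1 ->
  dihedral_angle (Qs N) i j = pi / 3.
Proof.
move=> ij d; apply: dihedralE => //; first by apply: pi_frac_itv; lra.
by rewrite gram_std_lt // d cos_pi3 mulN1r.
Qed.

Lemma dihedral_std_2pi3 (i j : 'I_n.+1) : (i < j < n)%N -> dot (A N i) (A N j) = 1 ->
  dihedral_angle (Qs N) i j = 2 * pi / 3.
Proof.
move=> ij d; apply: dihedralE => //.
  by rewrite (mulrC 2) -mulrA; apply: pi_frac_itv; lra.
by rewrite gram_std_lt // d cos_2pi3 opprK mul1r.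
Qed.

Lemma dihedral_std_pi4 (i j : 'I_n.+1) : (i < n)%N -> val j = n -> dot (A N i) (A N j) = -1 ->
  dihedral_angle (Qs N) i j = pi / 4.
Proof.
move=> ij jn d; apply: dihedralE => //; first by apply: pi_frac_itv; lra.
by rewrite gram_std_n // d cos_pi4 mulN1r.
Qed.

Lemma gamma_common_sym e e' : @gamma_common n N e e' = gamma_common N e' e.
Proof. by apply/setP => v; rewrite !inE andbC. Qed.

Lemma gamma_angle_sym (x y : option 'I_n) : gamma_angle N R x y = gamma_angle N R y x.
Proof.
case: x y => [e|] [e'|] //=; rewrite gamma_common_sym; case: ifP => // _.
by congr (if _ then _ else _); rewrite andbCA.
Qed.

Lemma gamma_at_uE (e : 'I_n) : gamma_at_u N e =
  if val e == n.-1 then N == n else e.+1 == n.-1.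
Proof.
have en := ltn_ord e; have u1 : (n.-1 < n)%N by vlia.
apply/existsP/idP => [[v /andP[/eqP vu]]|h].
  rewrite /gamma_incident vu /=; case: eqP => h; vlia.
exists (Ordinal u1); rewrite /gamma_is_u /gamma_incident /= eqxx /=.
by case: eqP h => h; vlia.
Qed.

Lemma angle_star (e : 'I_n) :
  dihedral_angle (Qs N) (lab_std (Some e)) (lab_std None) = gamma_angle N R (Some e) None.
Proof.
have en := ltn_ord e; rewrite /gamma_angle gamma_at_uE.
have AnE : A N n = A N n.-1.+1 by rewrite prednK.
have v := lab_val e; set i := lab_std (Some e) in v *.
have jn : val (lab_std None) = n by [].
case: eqP v => h v.
  have d : dot (A N i) (A N (lab_std None)) = - (N == n)%:R.
    rewrite v jn AnE dot_root_root0; last by vlia.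
    have -> : (n.-1.+1 == N.-1) = false by vlia.
    have -> : (n.-1 == 0) = false by vlia.
    have -> : (n.-1 == N.-1) = (N == n) by vlia.
    by rewrite subrr sub0r.
  case: eqP d => hN' d; first by apply: dihedral_std_pi4 => //; vlia.
  by apply: dihedral_std_pi2; [vlia | rewrite d oppr0].
have d : dot (A N i) (A N (lab_std None)) = - (e.+1 == n.-1)%:R.
  rewrite v jn AnE dot_root_rootS; last by vlia.
  by rewrite (_ : (n.-1 == e.+1) = (e.+1 == n.-1)) // eq_sym.
case: eqP d => hN' d; first by apply: dihedral_std_pi4 => //; vlia.
by apply: dihedral_std_pi2; [vlia | rewrite d oppr0].
Qed.

Lemma angle_path (e e' : 'I_n) : (e < e' < n.-1)%N ->
  dihedral_angle (Qs N) (lab_std (Some e)) (lab_std (Some e')) =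
  gamma_angle N R (Some e) (Some e').
Proof.
move=> h; have v := lab_val e; have v' := lab_val e'.
have e1 : (val e == n.-1) = false by vlia.
have e'1 : (val e' == n.-1) = false by vlia.
rewrite e1 in v; rewrite e'1 in v'.
set i := lab_std _ in v *; set j := lab_std _ in v' *.
have d : dot (A N i) (A N j) = - (val e' == e.+1)%:R.
  by rewrite v v' dot_root_rootS //; vlia.
have [a|a] := eqVneq (val e') e.+1; last first.
  have c0 : gamma_common N e e' = finset.set0.
    by apply/setP => u; rewrite !inE /gamma_incident e1 e'1; vlia.
  rewrite /gamma_angle c0 cards0 /=; apply: dihedral_std_pi2; rewrite ?d ?(negbTE a) ?oppr0 //.
  by rewrite v v'; vlia.
have c1 : gamma_common N e e' = [set e']%SET.
  apply/setP => u; rewrite !inE /gamma_incident e1 e'1 -val_eqE /=; vlia.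
rewrite /gamma_angle c1 cards1 /=.
(* The common node is [e']; if it is [c = N.-1], then the edge [e'] starts the path and is not an
   edge of the cycle. *)
have -> : [&& gamma_cycle_edge N e, gamma_cycle_edge N e' &
    [forall v in [set e']%SET, gamma_is_c N v]] = false.
  apply/and3P => -[_]; rewrite /gamma_cycle_edge e'1 /= => h1 /forallP/(_ e').
  by rewrite inE eqxx /gamma_is_c /=; vlia.
by apply: dihedral_std_pi3; rewrite ?d ?a ?eqxx // v v'; vlia.
Qed.

(** The closing edge meets edge [0] at node 0, edge [N - 1] of the path at [c], and edge [N - 2] of
    the cycle at [c]. For [N = 2] the first and the last of these are the same edge, which it meets
    at both ends. *)
Lemma angle_close (e e' : 'I_n) : (e < n.-1)%N -> val e' = n.-1 ->
  dihedral_angle (Qs N) (lab_std (Some e')) (lab_std (Some e)) =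
  gamma_angle N R (Some e') (Some e).
Proof.
move=> h h'; have v := lab_val e; have v' := lab_val e'.
have e1 : (val e == n.-1) = false by vlia.
have e'1 : (val e' == n.-1) by vlia.
rewrite e1 in v; rewrite e'1 in v'.
set i := lab_std (Some e') in v' *; set j := lab_std (Some e) in v *.
have ij : (i < j < n)%N by rewrite v v'; vlia.
have ij' : (i < j)%N by case/andP: ij.
have d : dot (A N i) (A N j) = (e.+1 == N.-1)%:R - (val e == 0)%:R - (val e == N.-1)%:R.
  by rewrite v v' dot_root_root0 //; vlia.
have zl : (0 < n)%N by vlia.
have Nl : (N.-1 < n)%N by vlia.
have incE u : (u \in gamma_common N e' e) =
    ((val u == 0) || (val u == N.-1)) && ((val u == val e) || (val u == e.+1)).
  by rewrite !inE /gamma_incident e1 e'1.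
have cyc' : gamma_cycle_edge N e' by rewrite /gamma_cycle_edge e'1.
have cyc : gamma_cycle_edge N e = (e < N.-1)%N by rewrite /gamma_cycle_edge e1.
rewrite /gamma_angle.
have [a|a] := eqVneq (val e) 0.
  have [N2|N2] := eqVneq N 2.
    have c : gamma_common N e' e = [set Ordinal zl; Ordinal Nl]%SET.
      by apply/setP => u; rewrite incE !inE -!val_eqE /=; vlia.
    rewrite c cards2 -val_eqE /= (_ : (0 != N.-1)) /=; last by vlia.
    apply: dihedral_std_pi2 => //; rewrite d.
    have -> : (e.+1 == N.-1) by vlia.
    have -> : (val e == 0) by vlia.
    have -> : (val e == N.-1) = false by vlia.
    by rewrite /=; ring.
  have c : gamma_common N e' e = [set Ordinal zl]%SET.
    by apply/setP => u; rewrite incE !inE -!val_eqE /=; vlia.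
  rewrite c cards1 /= cyc' /=.
  have -> : [forall v in [set Ordinal zl]%SET, gamma_is_c N v] = false.
    apply/negP => /forallP/(_ (Ordinal zl)); rewrite inE eqxx /gamma_is_c /=; vlia.
  rewrite andbF; apply: dihedral_std_pi3 => //; rewrite d.
  have -> : (e.+1 == N.-1) = false by vlia.
  have -> : (val e == 0) by vlia.
  have -> : (val e == N.-1) = false by vlia.
  by rewrite /=; ring.
have [b|b] := eqVneq (val e) N.-1.
  have c : gamma_common N e' e = [set Ordinal Nl]%SET.
    by apply/setP => u; rewrite incE !inE -!val_eqE /=; vlia.
  rewrite c cards1 /= cyc cyc' (_ : (e < N.-1)%N = false) /=; last by vlia.
  apply: dihedral_std_pi3 => //; rewrite d.
  have -> : (e.+1 == N.-1) = false by vlia.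
  have -> : (val e == 0) = false by vlia.
  have -> : (val e == N.-1) by vlia.
  by rewrite /=; ring.
have [g|g] := eqVneq e.+1 N.-1.
  have c : gamma_common N e' e = [set Ordinal Nl]%SET.
    by apply/setP => u; rewrite incE !inE -!val_eqE /=; vlia.
  rewrite c cards1 /= cyc cyc' (_ : (e < N.-1)%N) /=; last by vlia.
  have -> : [forall v in [set Ordinal Nl]%SET, gamma_is_c N v].
    by apply/forallP => u; apply/implyP; rewrite inE => /eqP->; rewrite /gamma_is_c /=.
  by apply: dihedral_std_2pi3 => //; rewrite d g eqxx (negbTE a) (negbTE b) /=; ring.
have c : gamma_common N e' e = finset.set0.
  by apply/setP => u; rewrite incE !inE -?val_eqE /=; vlia.
rewrite c cards0 /=; apply: dihedral_std_pi2 => //.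
by rewrite d (negbTE a) (negbTE b) (negbTE g) /=; ring.
Qed.

Lemma std_simplex_gamma x y : x != y ->
  dihedral_angle (Qs N) (lab_std x) (lab_std y) = gamma_angle N R x y.
Proof.
case: x y => [e|] [e'|] // xy; last first.
- by rewrite dihedral_sym gamma_angle_sym angle_star.
- exact: angle_star.
have ee : val e != val e' by apply: contra_neq xy => /val_inj->.
have en := ltn_ord e; have en' := ltn_ord e'.
have [h|h] := eqVneq (val e) n.-1; first by apply: angle_close => //; vlia.
have [h'|h'] := eqVneq (val e') n.-1.
  by rewrite dihedral_sym gamma_angle_sym; apply: angle_close => //; vlia.
have [l|l|l] := ltngtP (val e) (val e').
- by apply: angle_path; vlia.
- by rewrite dihedral_sym gamma_angle_sym; apply: angle_path; vlia.
- by rewrite l eqxx in ee.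
Qed.

End FixN.

Lemma two_le_n : (2 <= 2 <= n)%N. Proof. by rewrite /= ltnW. Qed.

(** The facets of [Qs 2] are numbered like the nodes of [Btilde_mult]: the roots 0 and 1 form the
    fork and the short root [n] gives the 2-fold edge. *)
Lemma std_simplex2_angle (i j : 'I_n.+1) : i != j ->
  dihedral_angle (Qs 2) i j = pi / (Btilde_mult n i j + 2)%:R.
Proof.
wlog ij : i j / (i < j)%N => [hw|] h.
  have [l|l|l] := ltngtP i j; first exact: hw.
    by rewrite dihedral_sym hw // 1?eq_sym // /Btilde_mult minnC maxnC.
  by move: h; rewrite -val_eqE /= l eqxx.
have h2 := two_le_n; have jn := ltn_ord j.
rewrite /Btilde_mult (minn_idPl (ltnW ij)) (maxn_idPr (ltnW ij)).
have [k jE] : exists k, val j = k.+1 by exists (val j).-1; vlia.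
case: ifP => [/andP[/eqP a /eqP b]|ab].
  apply: dihedral_std_pi4 => //; first by vlia.
  have [l iE] : exists l, val i = l.+1 by exists (val i).-1; vlia.
  rewrite iE jE dot_root_rootS //; last by vlia.
  by have -> : (k == l.+1) by vlia.
have [i0|i0] := eqVneq (val i) 0%N.
  have d : dot (A 2 i) (A 2 j) = - (nat_of_ord j == 2%N)%:R.
    rewrite i0 jE dot_root_root0 //; last by vlia.
    have -> : (k.+1 == 2.-1) = (k == 0) by vlia.
    by rewrite subrr sub0r.
  have -> : (0 < i)%N = false by vlia.
  rewrite /=; case: eqP d => c d; first by apply: dihedral_std_pi3 => //; vlia.
  by apply: dihedral_std_pi2; rewrite ?d ?oppr0.
have [l iE] : exists l, val i = l.+1 by exists (val i).-1; vlia.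
have -> : (0 < i)%N by vlia.
rewrite /= orbF.
have d : dot (A 2 i) (A 2 j) = - (nat_of_ord j == i.+1)%:R.
  by rewrite iE jE dot_root_rootS //; vlia.
case: eqP d => c d; first by apply: dihedral_std_pi3 => //; vlia.
by apply: dihedral_std_pi2; rewrite ?d ?oppr0.
Qed.

End Standard.

(** * The groups of the standard simplices *)

Lemma coord_sub_scale (R : realType) n (u v : 'rV[R]_n) t j :
  (u - t *: v) 0 j = u 0 j - t * v 0 j.
Proof. by rewrite !mxE. Qed.

Section Lattice.
Variables (R : realType) (n : nat).
Hypothesis hn : (3 <= n)%N.
Let n0 : (0 < n)%N := ltnW (ltnW hn).
Implicit Types (x y z a : 'rV[R]_n) (g : 'rV[R]_n -> 'rV[R]_n).

Local Notation one := (const_mx 1 : 'rV[R]_n).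
Local Notation E := (@unit_vec R n).
Local Notation A := (@std_root R n).
Local Notation Qs := (@std_simplex R n hn).
Local Notation lev := (@std_level R).

(* The lattice D_n, the translation lattice of the group. *)
Definition evenv x := intv x /\ dot one x / 2 \is a Num.int.

Lemma dot_one_unit k : dot one (E k) = (k < n)%N%:R.
Proof.
rewrite dotC (_ : one = \row_(j < n) 1); last by apply/rowP => j; rewrite !mxE.
by rewrite (dot_unit_row _ k (fun=> 1)); case: ifP.
Qed.

(** Preserving D_n is not enough: for [n = 4] the reflection in [(1, 1, 1, 1) / 2] does so and is
    not a root reflection. The second clause, that linear parts preserve Z^n, excludes it; the third
    says that [g] is affine. *)
Definition lattice_inv g := [/\ forall x, evenv x <-> evenv (g x),
  forall x y, intv (x - y) <-> intv (g x - g y)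
  & forall x y z t, g (x + t *: (y - z)) = g x + t *: (g y - g z)].

Lemma lattice_inv_comp g h : lattice_inv g -> lattice_inv h -> lattice_inv (g \o h).
Proof.
move=> [g1 g2 g3] [h1 h2 h3]; split => /=.
- by move=> x; rewrite h1 g1.
- by move=> x y; rewrite h2 g2.
- by move=> x y z t; rewrite h3 g3.
Qed.

Lemma lattice_inv_inv g h : lattice_inv g -> cancel g h -> cancel h g -> lattice_inv h.
Proof.
move=> [g1 g2 g3] gK hK; split.
- by move=> x; rewrite (g1 (h x)) hK.
- by move=> x y; rewrite (g2 (h x)) !hK.
- by move=> x y z t; apply: (can_inj gK); rewrite g3 !hK.
Qed.

Section FixN.
Variable N : nat.
Hypothesis hN : (2 <= N <= n)%N.

Lemma evenv_facet (i : 'I_n.+1) x : evenv x -> evenv (rfl (A N i) (lev i) x).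
Proof.
move=> [ix sx]; have ra := std_root_is_root R hn hN i; have [ia _] := ra.
have ti : 2 * (dot (A N i) x - lev i) / dot (A N i) (A N i) \is a Num.int.
  by apply: root_coef_int => //; rewrite rpredB ?intv_dot ?std_level_int.
split; first by apply/intvB/intvZ.
rewrite /rfl dotBr dotZr mulrBl rpredB // .
have [e|ne] := eqVneq (nat_of_ord i) n.
  have An : dot one (A N i) = -1.
    rewrite e -[X in A N X](prednK n0) /std_root dotBr !dot_one_unit prednK // ltnn leqnn.
    by rewrite sub0r.
  rewrite An e dot_root_short // divr1 /lev (_ : n == 0%N = false); last by lia.
  rewrite subr0 (_ : 2 * dot (A N n) x * -1 / 2 = - dot (A N n) x); last by field.
  by rewrite e in ia; rewrite rpredN intv_dot.
have il : (i < n)%N by have := ltn_ord i; lia.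
have [e0|e0] := eqVneq (nat_of_ord i) 0%N.
  have A0 : dot one (A N i) = 2.
    rewrite e0 /std_root dotDr !dot_one_unit n0 (_ : (N.-1 < n)%N); last by lia.
    by rewrite /=; ring.
  by rewrite A0 mulfK // pnatr_eq0.
have [k kE] : exists k, nat_of_ord i = k.+1 by exists (nat_of_ord i).-1; lia.
have AS : dot one (A N i) = 0.
  rewrite kE /std_root dotBr !dot_one_unit.
  have -> : (k.+1 < n)%N by lia.
  have -> : (k < n)%N by lia.
  by rewrite subrr.
by rewrite AS mulr0 mul0r rpred0.
Qed.

Lemma lattice_inv_group g : reflection_group (Qs N) g -> lattice_inv g.
Proof.
apply: (reflection_group_ind n0).
- by split.
- move=> i; rewrite std_simplex_frefl //; have ra := std_root_is_root R hn hN i; have [ia _] := ra.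
  have a0 := root_neq0 ra; have inv := rflK (lev i) a0.
  split.
  + by move=> x; split => h; [exact: evenv_facet | rewrite -(inv x); exact: evenv_facet].
  + suff one_dir x y : intv (x - y) -> intv (rfl (A N i) (lev i) x - rfl (A N i) (lev i) y).
      by move=> x y; split => [|h]; [exact: one_dir | rewrite -(inv x) -(inv y); exact: one_dir].
    by move=> h; rewrite rfl_sub; apply/intvB/intvZ => //; apply/root_coef_int/intv_dot.
  + move=> x y z t; rewrite rfl_sub /rfl !dotrE; apply/rowP => j; rewrite !mxE; ring.
- exact: lattice_inv_comp.
- exact: lattice_inv_inv.
Qed.

Lemma evenv0 : evenv 0.
Proof. by split => [i|]; rewrite ?mxE ?dot0r ?mul0r rpred0. Qed.

Lemma intv_close x : intv x -> enorm x < 1 -> x = 0.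
Proof.
move=> ix h; apply/rowP => i; rewrite mxE; apply: int_small => //.
exact: le_lt_trans (coord_le_enorm x i) h.
Qed.

(** Elements of the group send 0 to an integer vector and preserve integer differences, so two of
    them that are closer than 1 at 0 and at the basis vectors agree there. Being affine, they are
    equal. *)
Lemma std_simplex_discrete : discrete_crit (reflection_group (Qs N)).
Proof.
move=> g Gg; have [g1 g2 g3] := lattice_inv_group Gg.
pose e_ (i : 'I_n) : 'rV[R]_n := delta_mx 0 i.
exists (0 :: [seq e_ i | i <- enum 'I_n]), 1; split => // h Gh hh.
have [h1 h2 h3] := lattice_inv_group Gh.
have e0 : h 0 = g 0.
  apply/eqP; rewrite -subr_eq0; apply/eqP/intv_close; last by apply: hh; exact: mem_head.
  by apply: intvB; [have [] := iffLR (h1 0) evenv0 | have [] := iffLR (g1 0) evenv0].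
have ee i : h (e_ i) = g (e_ i).
  apply/eqP; rewrite -subr_eq0; apply/eqP/intv_close; last first.
    by apply: hh; rewrite inE map_f ?orbT // mem_enum.
  have ie : intv (e_ i - 0) by rewrite subr0; exact: intv_delta.
  have -> : h (e_ i) - g (e_ i) = (h (e_ i) - h 0) - (g (e_ i) - g 0).
    by rewrite e0 opprB addrA subrK.
  by apply: intvB; [exact: iffLR (h2 _ _) ie | exact: iffLR (g2 _ _) ie].
apply/funext => x; rewrite (row_sum_delta x).
elim/big_rec: _ => [|i y _ IH]; first exact: e0.
rewrite addrC; have := h3 y (e_ i) 0 (x 0 i); have := g3 y (e_ i) 0 (x 0 i).
by rewrite !subr0 => -> ->; rewrite IH ee e0.
Qed.

Lemma lattice_refl_root_unit f c : dot f f = 1 -> lattice_inv (rfl f c) ->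
  root_hyperplane f c.
Proof.
move=> ff [h1 h2 _].
(* The linear part maps Z^n to itself, so the entries of twice [f^T *m f] are integers. Hence each
   squared coordinate is 0, 1/2 or 1, and [f] is a unit root or a long root divided by the square
   root of 2. *)
have int2 i j : 2 * (f 0 i * f 0 j) \is a Num.int.
  have ie : intv ((delta_mx 0 i : 'rV[R]_n) - 0) by rewrite subr0; exact: intv_delta.
  have := iffLR (h2 _ _) ie; rewrite rfl_sub subr0 dot_delta ff divr1 => /(_ j).
  rewrite coord_sub_scale => h; have := rpredB (intv_delta R i j) h.
  by rewrite opprB addrCA subrr addr0 mulrA.
(* This vector is the image of 0. Its even coordinate sum makes the level [c] an integer when [f] is
   a unit root; for a long root the integrality of its coordinates is enough. *)
have ev0 : evenv ((2 * c) *: f).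
  have := iffLR (h1 0) evenv0; by rewrite /rfl dot0r ff divr1 !sub0r mulrN scaleNr opprK.
have [[i fi]|none] := pselect (exists i, f 0 i ^+ 2 = 1).
  have fpm : f 0 i = 1 \/ f 0 i = -1.
    by move/eqP: fi; rewrite sqrf_eq1 => /orP[/eqP|/eqP]; auto.
  have z j : j != i -> f 0 j = 0.
    move=> ji; have := ff; rewrite dotE (bigD1 i) //= -expr2 fi -[RHS]addr0 => /addrI /eqP.
    rewrite psumr_eq0 => [|l _]; last by rewrite -expr2 sqr_ge0.
    by move=> /allP /(_ j (mem_index_enum _)); rewrite ji -expr2 sqrf_eq0 => /eqP.
  have fE : f = f 0 i *: delta_mx 0 i.
    apply/rowP => j; rewrite !mxE eqxx /=.
    by have [->|/z->] := eqVneq j i; rewrite ?mulr1 // mulr0.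
  have [_ s] := ev0.
  exists f, 1, c; split; rewrite ?oner_eq0 ?scale1r ?mul1r //.
    split; last by left.
    by rewrite fE; apply: intvZ; [exact: pm1_int | exact: intv_delta].
  have -> : c = dot one ((2 * c) *: f) / 2 * f 0 i.
    rewrite fE dotZr dotZr dot_delta !mxE !eqxx mulr1.
    have -> : 2 * c * f 0 i / 2 * f 0 i = c * f 0 i ^+ 2 by field.
    by rewrite fi mulr1.
  by rewrite rpredM // pm1_int.
have sq i : f 0 i ^+ 2 = 0 \/ f 0 i ^+ 2 = 2^-1.
  have := int2 i i; rewrite -expr2 => /intrP[m mE].
  have le1 : f 0 i ^+ 2 <= 1.
    rewrite -ff dotE (bigD1 i) //= expr2 lerDl sumr_ge0 // => j _.
    by rewrite -expr2 sqr_ge0.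
  have m0 : (0 <= m)%R by rewrite -(ler_int R) -mE mulr_ge0 // sqr_ge0.
  have m2 : (m <= 2)%R by rewrite -(ler_int R) -mE; lra.
  have : m = 0 \/ m = 1 \/ m = 2 by lia.
  case=> [m'|[m'|m']]; rewrite m' /= in mE.
  - left; move: mE; rewrite /=; lra.
  - right; move: mE; rewrite /=; lra.
  - by exfalso; apply: none; exists i; lra.
have s0 : 0 < Num.sqrt 2 :> R by rewrite sqrtr_gt0.
have s2 : Num.sqrt 2 ^+ 2 = 2 :> R by rewrite sqr_sqrtr.
pose b := Num.sqrt 2 *: f.
have bi i : b 0 i = 0 \/ (b 0 i = 1 \/ b 0 i = -1).
  rewrite /b mxE; case: (sq i) => h.
    by left; move/eqP: h; rewrite sqrf_eq0 => /eqP ->; rewrite mulr0.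
  right; have : (Num.sqrt 2 * f 0 i) ^+ 2 = 1 by rewrite exprMn s2 h mulfV.
  by move/eqP; rewrite sqrf_eq1 => /orP[/eqP|/eqP]; auto.
have ib : intv b.
  move=> i; case: (bi i) => [->|h]; first exact: rpred0.
  exact: pm1_int.
have bb : dot b b = 2 by rewrite /b !dotrE ff mulr1 -expr2.
have rb : is_root b by split => //; right.
have [i bi1] : exists i, b 0 i = 1 \/ b 0 i = -1.
  apply: contrapT => nb; have := root_neq0 rb; apply/negP; rewrite negbK; apply/eqP/rowP => i.
  rewrite [RHS]mxE; case: (bi i) => // h; by exfalso; apply: nb; exists i.
exists b, (Num.sqrt 2)^-1, (Num.sqrt 2 * c); split => //.
- have [/(_ i) + _] := ev0; rewrite mxE.
  have -> : 2 * c * f 0 i = (Num.sqrt 2 * c) * b 0 i.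
    by rewrite /b mxE -[in LHS]s2; ring.
  case: bi1 => ->; first by rewrite mulr1.
  by rewrite mulrN1 rpredN.
- by rewrite /b scalerA mulVf ?scale1r // gt_eqF.
- by rewrite mulKf // gt_eqF.
Qed.

Lemma lattice_refl_root a k : a != 0 -> lattice_inv (rfl a k) -> root_hyperplane a k.
Proof.
move=> a0 h; have ea := enorm_gt0 a0; have en0 : (enorm a)^-1 != 0 by rewrite invr_eq0 gt_eqF.
have ff : dot ((enorm a)^-1 *: a) ((enorm a)^-1 *: a) = 1.
  by rewrite !dotrE -sqr_enorm; field; rewrite gt_eqF.
have rE : rfl a k = rfl ((enorm a)^-1 *: a) ((enorm a)^-1 * k) by rewrite rflZ.
rewrite rE in h; have [b [t [m [rb t0 mi fE cE]]]] := lattice_refl_root_unit ff h.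
exists b, (enorm a * t), m; split => //; first by rewrite mulf_neq0 // gt_eqF.
  by rewrite -scalerA -fE scalerA divff ?scale1r // gt_eqF.
by rewrite -mulrA -cE mulrA divff ?mul1r // gt_eqF.
Qed.

Lemma std_interior_coords y : (forall i, 0 < bary (Qs 2) i y) ->
  [/\ forall (i j : 'I_n), (i < j)%N -> y 0 j < y 0 i, forall i, 0 < y 0 i
    & forall (i j : 'I_n), (i < j)%N -> y 0 i + y 0 j < 1].
Proof.
move=> hy; have h2 := two_le_n hn.
have lt (i : 'I_n.+1) : dot (A 2 i) y < lev i.
  have [h h0 hb] := std_simplex_bary R hn h2 i.
  by rewrite -subr_lt0 hb mulNr oppr_lt0 mulr_gt0.
pose Y (k : nat) := dot (E k) y.
have YE (i : 'I_n) : y 0 i = Y i by rewrite /Y dot_unit_coord.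
have st k : (k < n)%N -> Y k.+1 < Y k.
  move=> kn; have := lt (inord k.+1); rewrite inordK // /std_root dotBl /lev /=.
  by rewrite subr_lt0.
have dec i j : (i < j <= n)%N -> Y j < Y i.
  elim: j => // j IH h; have [->|ij] := eqVneq i j; first by apply: st; lia.
  by apply: (lt_trans (st j _)); [lia | apply: IH; lia].
have Yn : Y n = 0.
  rewrite /Y (_ : E n = 0) ?dot0l //; apply/rowP => j; rewrite !mxE ltn_eqF //.
have Y01 : Y 0%N + Y 1%N < 1.
  by have := lt (inord 0); rewrite inordK // /std_root dotDl /lev /=.
have pos i : (i < n)%N -> 0 < Y i by move=> h; rewrite -Yn dec // h leqnn.
have le i j : (i <= j <= n)%N -> Y j <= Y i.
  by move=> h; have [->//|ij] := eqVneq i j; apply/ltW/dec; lia.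
split=> [i j ij|i|i j ij]; rewrite !YE.
- by apply: dec; have := ltn_ord j; lia.
- exact: pos.
- apply: le_lt_trans Y01; have := ltn_ord j; have := ltn_ord i => h3 h4.
  by rewrite lerD // le; lia.
Qed.

(** Inside the alcove the coordinates are positive and distinct and any two of them add up to less
    than 1, so every root takes a nonzero value strictly between -1 and 1. *)
Lemma root_avoids_interior a m y : is_root a -> m \is a Num.int ->
  (forall i, 0 < bary (Qs 2) i y) -> dot a y <> m.
Proof.
move=> ra mi hy ay; have [d p u] := std_interior_coords hy.
suff [nz lt1] : dot a y != 0 /\ `|dot a y| < 1.
  by move/eqP: nz; apply; apply: int_small => //; rewrite ay.
have lt1 i : y 0 i < 1.
  have [j ij] : exists j : 'I_n, j != i.
    have [->|i0] := eqVneq i (Ordinal n0); last by exists (Ordinal n0); rewrite eq_sym.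
    have n1 : (1 < n)%N by lia.
    by exists (Ordinal n1).
  have pj := p j; have := ltngtP i j.
  case=> [h|h|h]; first by have := u _ _ h; lra.
    by have := u _ _ h; lra.
  by move: ij; rewrite (val_inj h) eqxx.
have [i [s [hs]]] := root_form ra.
have pi' := p i; have li := lt1 i.
case=> [[-> _]|[j [t [ji ht -> _]]]].
  rewrite dotZl dotC dot_delta; case: hs => ->.
    by rewrite mul1r ger0_norm ?(ltW pi') // gt_eqF.
  by rewrite mulN1r normrN ger0_norm ?(ltW pi') // oppr_eq0 gt_eqF.
rewrite !dotrE ![dot (delta_mx 0 _) y]dotC !dot_delta.
have pj := p j; have lj := lt1 j.
have [ij|ij|ij] := ltngtP i j; last by move: ji; rewrite (val_inj ij) eqxx.
  have := d _ _ ij; have := u _ _ ij => h1 h2.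
  by case: hs => ->; case: ht => ->; (split; [apply/eqP => e; lra | rewrite ltr_norml; lra]).
have := d _ _ ij; have := u _ _ ij => h1 h2.
by case: hs => ->; case: ht => ->; (split; [apply/eqP => e; lra | rewrite ltr_norml; lra]).
Qed.

(** Conjugation by the facet reflection of [E m.+1 - E m] turns [E 0 + E m.+1] into [E 0 + E m].
    Descending from [m = N.-1], one reaches at [m = 1] the only wall of the alcove that may fail to
    be a facet mirror of [Qs N]. *)
Lemma std_simplex_chain_refl m : (1 <= m < N)%N -> reflection_group (Qs N) (rfl (E 0 + E m) 1).
Proof.
move=> hm; have [k kE] : exists k, (m + k = N.-1)%N by exists (N.-1 - m)%N; lia.
elim: k m hm kE => [|k IH] m hm kE.
  have := reflection_group_frefl n0 (Qs N) ord0; rewrite std_simplex_frefl //=.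
  by rewrite /lev eqxx -kE addn0.
have hb := IH m.+1 _ _; have {hb} hb : reflection_group (Qs N) (rfl (E 0 + E m.+1) 1).
  by apply: hb; lia.
have im : (m.+1 < n.+1)%N by lia.
have ha := reflection_group_frefl n0 (Qs N) (Ordinal im).
rewrite std_simplex_frefl // /lev /= in ha.
have a0 : A N m.+1 != 0 by exact: (root_neq0 (std_root_is_root R hn hN (Ordinal im))).
have b0 : E 0 + E m.+1 != 0.
  apply/eqP => e; have := congr1 (dot (E m.+1)) e; rewrite dot0r dotDr !dot_unit_unit eqxx /=.
  have -> : (m.+1 < n)%N by lia.
  by rewrite add0r => /eqP; rewrite oner_eq0.
have := gen_comp (gen_comp ha hb) ha; rewrite rfl_conj_rfl //.
have -> : dot (A N m.+1) (E 0 + E m.+1) = 1.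
  rewrite /std_root !dotrE !dot_unit_unit eqxx /=.
  have -> : (m.+1 < n)%N by lia.
  have -> : (m == 0%N) = false by lia.
  have -> : (m == m.+1) = false by lia.
  by rewrite /=; ring.
have -> : dot (A N m.+1) (A N m.+1) = 2 by rewrite dot_root_long //; lia.
rewrite mulr1 divff ?pnatr_eq0 // scale1r mulr0 subr0 /std_root.
have -> : E 0 + E m.+1 - (E m.+1 - E m) = E 0 + E m by apply/rowP => j; rewrite !mxE; ring.
by [].
Qed.

Lemma std_simplex_chamber_data : chamber_data (Qs N) (Qs 2).
Proof.
have h2 := two_le_n hn.
split; first exact: std_simplex_discrete.
  move=> i; rewrite std_simplex_frefl //; case: i => -[|i] il /=.
    by rewrite /lev eqxx; apply: std_simplex_chain_refl; lia.
  have := reflection_group_frefl n0 (Qs N) (Ordinal il).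
  by rewrite std_simplex_frefl //.
move=> a k y a0 Ga hy ay.
have [b [t [m [rb t0 mi aE kE]]]] := lattice_refl_root a0 (lattice_inv_group Ga).
apply: (root_avoids_interior rb mi hy); apply: (mulfI t0).
by rewrite -kE -ay aE dotZl.
Qed.

End FixN.
End Lattice.

(** * Classification *)

Section Classification.
Variables (R : realType) (n : nat).
Hypothesis hn : (3 <= n)%N.
Let n0 : (0 < n)%N := ltnW (ltnW hn).
Local Notation E := (@unit_vec R n).
Local Notation A := (@std_root R n).
Local Notation Qs := (@std_simplex R n hn).
Local Notation lev := (@std_level R).
Local Notation e_ := (fun i => delta_mx 0 i : 'rV[R]_n).

Lemma dot_ee (i j : 'I_n) : dot (e_ i) (e_ j) = (i == j)%:R.
Proof. by rewrite dot_delta mxE eqxx eq_sym. Qed.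

(** A long root reflection exchanges two coordinates of a difference, multiplying both by the same
    sign. *)
Lemma coord_prod_rfl (a : 'rV[R]_n) k x y : is_root a -> dot a a = 2 ->
  \prod_l (rfl a k x - rfl a k y) 0 l = \prod_l (x - y) 0 l.
Proof.
move=> ra aa; have [i [s [hs]]] := root_form ra; case=> [[_ h]|[j [t [ji ht aE _]]]].
  by move: h; rewrite aa => /eqP; rewrite -subr_eq0 (_ : 2 - 1 = 1) ?oner_eq0 //; ring.
rewrite rfl_sub aa; move: (x - y) => z {x y}.
have az : dot a z = s * z 0 i + t * z 0 j.
  by rewrite aE !dotrE ![dot (e_ _) z]dotC !dot_delta.
have ai : a 0 i = s.
  by rewrite aE !mxE !eqxx /= [i == j]eq_sym (negbTE ji) mulr1 mulr0 addr0.
have aj : a 0 j = t by rewrite aE !mxE !eqxx /= (negbTE ji) mulr0 mulr1 add0r.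
have al l : l != i -> l != j -> a 0 l = 0.
  by move=> li lj; rewrite aE !mxE eqxx (negbTE li) (negbTE lj) !mulr0 addr0.
have s2 := pm1_sqr hs; have t2 := pm1_sqr ht.
rewrite (bigD1 i) //= (bigD1 j) //= [RHS](bigD1 i) //= [in RHS](bigD1 j) //= !mulrA.
congr (_ * _); last first.
  by apply: eq_bigr => l /andP[li lj]; rewrite coord_sub_scale al // mulr0 subr0.
rewrite !coord_sub_scale ai aj az.
have -> : z 0 i - 2 * (s * z 0 i + t * z 0 j) / 2 * s =
    (1 - s ^+ 2) * z 0 i - s * t * z 0 j by field.
have -> : z 0 j - 2 * (s * z 0 i + t * z 0 j) / 2 * t =
    (1 - t ^+ 2) * z 0 j - s * t * z 0 i by field.
rewrite s2 t2 subrr !mul0r !sub0r mulrNN.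
have -> : s * t * z 0 j * (s * t * z 0 i) = (s ^+ 2 * t ^+ 2) * (z 0 i * z 0 j) by ring.
by rewrite s2 t2 !mul1r.
Qed.

Lemma root_pos_dot (a : 'rV[R]_n) i s : is_root a -> (s = 1 \/ s = -1) ->
  0 < dot a (s *: e_ i) ->
  (a = s *: e_ i /\ dot a a = 1) \/
  exists j t, [/\ j != i, t = 1 \/ t = -1, a = s *: e_ i + t *: e_ j & dot a a = 2].
Proof.
move=> ra hs; have [j [t [ht]]] := root_form ra.
have same (t' : R) : t' = 1 \/ t' = -1 -> 0 < t' * s -> t' = s.
  by move=> h; case: hs => ->; case: h => ->; lra.
case=> [[aE aa]|[l [t' [lj ht' aE aa]]]].
  rewrite {1}aE !dotrE dot_ee; have [ij|ij] := eqVneq j i.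
    by rewrite mulr1 => /(same _ ht) e; left; split => //; rewrite aE ij e.
  by rewrite !mulr0 ltxx.
rewrite {1}aE !dotrE !dot_ee; have [ji|ji] := eqVneq j i.
  have -> : (l == i) = false by rewrite -ji (negbTE lj).
  rewrite !mulr0 addr0 mulr1 => /(same _ ht) e.
  by right; exists l, t'; split => //; [rewrite -ji | rewrite aE ji e].
have [li|li] := eqVneq l i; last by rewrite !mulr0 addr0 ltxx.
rewrite !mulr0 add0r mulr1 => /(same _ ht') e.
by right; exists j, t; split => //; rewrite aE li e addrC.
Qed.

(** * The facet normals as a signed graph *)

Section Facets.
Variables (P : simplex R n) (al : 'I_n.+1 -> 'rV[R]_n) (k lam : 'I_n.+1 -> R).
Hypothesis al_root : forall i, is_root (al i).
Hypothesis k_int : forall i, k i \is a Num.int.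
Hypothesis lam_gt0 : forall i, 0 < lam i.
Hypothesis normalE : forall i, outward_normal P i = lam i *: al i.
Hypothesis freflE : forall i, frefl P i = rfl (al i) (k i).
Hypothesis al_vertex : forall i j, j != i -> dot (al i) (vertex P j) = k i.
Hypothesis GQ : forall i : 'I_n.+1, reflection_group P (rfl (A 2 i) (lev i)).

Lemma al_relation : exists2 mu : 'I_n.+1 -> R, forall i, 0 < mu i & \sum_i mu i *: al i = 0.
Proof.
exists (fun i => enorm (bdir P i) * lam i).
  by move=> i; rewrite mulr_gt0 // enorm_bdir_gt0.
rewrite -[RHS](normal_relation n0 P); apply: eq_bigr => i _.
by rewrite normalE scalerA.
Qed.

(** Uniqueness of the relation between the normals, in the form used on the graph: a relation that
    misses one facet is trivial. *)
Lemma al_circuit (c : 'I_n.+1 -> R) : \sum_i c i *: al i = 0 ->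
  forall i j, c i = 0 -> c j = 0.
Proof.
move=> h.
have : \sum_i (c i / lam i) *: outward_normal P i = 0.
  by rewrite -[RHS]h; apply: eq_bigr => i _; rewrite normalE scalerA divfK // gt_eqF.
move=> /(normal_circuit n0)[a ha] i j ci.
have /eqP := ha i; rewrite ci mul0r eq_sym mulf_eq0 (gt_eqF (enorm_bdir_gt0 n0 P i)) orbF.
move=> /eqP a0; have /eqP := ha j; rewrite a0 mul0r mulf_eq0 invr_eq0 (gt_eqF (lam_gt0 j)) orbF.
by move/eqP.
Qed.

(* Otherwise the product of the coordinates of differences would be invariant. *)
Lemma short_facet : exists i, dot (al i) (al i) = 1.
Proof.
apply: contrapT => none.
have long i : dot (al i) (al i) = 2.
  by case: (al_root i) => _ [] // h; exfalso; apply: none; exists i.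
have inv g : reflection_group P g -> forall x y,
    \prod_l (g x - g y) 0 l = \prod_l (x - y) 0 l.
  move: g; apply: (reflection_group_ind n0) => //.
  - by move=> i x y; rewrite freflE coord_prod_rfl.
  - by move=> g h ig ih x y /=; rewrite ig ih.
  - by move=> g h ig gh hg x y; rewrite -ig !hg.
have := inv _ (GQ ord_max) (const_mx 1) 0.
rewrite rfl_sub subr0 /= dot_root_short ?two_le_n // divr1.
have AE : A 2 n = - E n.-1.
  rewrite -[X in A 2 X](prednK n0) /std_root (_ : E n.-1.+1 = 0) ?sub0r //.
  by apply/rowP => j; rewrite !mxE prednK // ltn_eqF.
have ln : (n.-1 < n)%N by lia.
have EE : E n.-1 = e_ (Ordinal ln) by apply/rowP => j; rewrite !mxE eqxx.
rewrite AE EE dotNl dotC dot_delta mxE.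
rewrite (bigD1 (Ordinal ln)) //= coord_sub_scale !mxE !eqxx /=.
rewrite big1 => [|l ll]; last by rewrite coord_sub_scale !mxE (negbTE ll) /= oppr0 mulr0 subr0.
rewrite big1 => [|l _]; last by rewrite mxE.
move=> h; have := h; rewrite mulr1; lra.
Qed.

(* Otherwise the group would preserve p + 2 Z^n, with p the vertex opposite to i. *)
Lemma short_level_nonint i : dot (al i) (al i) = 1 ->
  ~ dot (al i) (vertex P i) \is a Num.int.
Proof.
move=> aa pint; set p := vertex P i in pint.
pose X x := intv (2^-1 *: (x - p)).
have inv g : reflection_group P g -> forall x, X x <-> X (g x).
  move: g; apply: (reflection_group_ind n0) => //.
  - move=> j; have a0 := root_neq0 (al_root j).
    suff dir x : X x -> X (frefl P j x).
      by move=> x; split => h; [exact: dir | rewrite -(freflK n0 P j x); exact: dir].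
    rewrite freflE => Xx; rewrite /X /rfl.
    have -> : 2^-1 *: (x - (2 * (dot (al j) x - k j) / dot (al j) (al j)) *: al j - p) =
      2^-1 *: (x - p) - ((dot (al j) x - k j) / dot (al j) (al j)) *: al j.
      have d0 : dot (al j) (al j) != 0 by rewrite dot_eq0.
      by apply/rowP => l; rewrite !mxE; field.
    apply/intvB/intvZ => //; last by case: (al_root j).
    have zi : dot (al j) (2^-1 *: (x - p)) \is a Num.int by rewrite intv_dot //; case: (al_root j).
    have -> : dot (al j) x - k j =
        (dot (al j) p - k j) + 2 * dot (al j) (2^-1 *: (x - p)).
      by rewrite dotZr dotBr; field.
    (* Facets other than [i] pass through [p]. For [i] itself the root is short and its value at [p]
       is an integer by assumption. *)
    have [ji|ij] := eqVneq j i.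
      by rewrite ji in zi *; rewrite aa divr1; apply: rpredD; [exact: rpredB | apply: rpredM => //; exact: rpred_nat].
    by rewrite al_vertex 1?eq_sym // subrr add0r; apply: root_coef_int.
  - by move=> g h ig ih x /=; rewrite ih ig.
  - by move=> g h ig gh hg x; rewrite (ig (h x)) hg.
have Xp : X p by rewrite /X subrr scaler0 => l; rewrite mxE rpred0.
(* The reflections of the alcove move [p] by vectors of 2 Z^n. The walls [n, ..., 1] then make the
   coordinates of [p] integers of equal parity, whereas wall 0 makes [Y 0 + Y 1] odd. *)
have step (j : 'I_n.+1) : intv (((dot (A 2 j) p - lev j) / dot (A 2 j) (A 2 j)) *: A 2 j).
  have := intvN (iffLR (inv _ (GQ j) p) Xp).
  congr intv; rewrite /rfl addrAC subrr sub0r scalerN opprK scalerA; congr (_ *: _).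
  have d0 : dot (A 2 j) (A 2 j) != 0.
    by rewrite dot_eq0 (root_neq0 (std_root_is_root R hn (two_le_n hn) j)).
  by field.
have h2 := two_le_n hn.
pose Y (m : nat) := dot (E m) p.
have stepE (j : 'I_n.+1) m : (m < n)%N ->
    (dot (A 2 j) p - lev j) / dot (A 2 j) (A 2 j) * dot (E m) (A 2 j) \is a Num.int.
  move=> mn; have := step j (Ordinal mn); rewrite mxE.
  by rewrite -(dot_unit_coord (Ordinal mn) (A 2 j)).
have down m : (m < n)%N -> Y (n.-1 - m)%N \is a Num.int.
  elim: m => [_|m IH mn].
    rewrite subn0; have nn : (n.-1 < n)%N by lia.
    have := stepE ord_max n.-1 nn.
    rewrite /= dot_root_short // divr1 /lev (_ : (n == 0%N) = false); last by lia.
    rewrite subr0 -[X in A 2 X](prednK n0) /std_root (_ : E n.-1.+1 = 0); last first.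
      by apply/rowP => j; rewrite !mxE prednK // ltn_eqF.
    by rewrite sub0r dotNl dotNr dot_unit_unit eqxx nn /= mulrNN mulr1.
  have {}IH : Y (n.-1 - m)%N \is a Num.int by apply: IH; lia.
  set q := (n.-1 - m.+1)%N; have qE : (n.-1 - m)%N = q.+1 by rewrite /q; lia.
  rewrite qE in IH.
  have ql : (q.+1 < n)%N by rewrite /q; lia.
  have := stepE (inord q.+1) q.+1 ql; rewrite inordK; last by lia.
  rewrite dot_root_long // /lev /= subr0 /std_root dotBr dotBl !dot_unit_unit eqxx ql /=.
  have -> : (q.+1 == q) = false by lia.
  rewrite subr0 mulr1 -/(Y q.+1) -/(Y q) => h.
  have -> : Y q = Y q.+1 - 2 * ((Y q.+1 - Y q) / 2) by field.
  by rewrite rpredB // rpredM // rpred_nat.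
have Y0 : Y 0%N \is a Num.int by have := down n.-1; rewrite subnn; apply; lia.
have n1 : (1 < n)%N by lia.
have h0 := stepE (inord 0) 0%N n0; have h1 := stepE (inord 1) 1%N n1.
rewrite inordK // dot_root_long // /lev eqxx /std_root dotDl dotDr !dot_unit_unit n0 /= addr0 mulr1 in h0.
rewrite inordK // dot_root_long // /lev /= subr0 /std_root dotBl dotBr !dot_unit_unit n1 /= subr0 mulr1 in h1.
have := rpredB Y0 (rpredB h0 h1); rewrite -/(Y 0%N) -/(Y 1%N).
have -> : Y 0%N - ((Y 0%N + Y 1%N - 1) / 2 - (Y 1%N - Y 0%N) / 2) = 2^-1 by field.
move=> /int_small; rewrite gtr0_norm ?invr_gt0 // invf_lt1 // ltr1n => /(_ isT) /eqP.
by rewrite invr_eq0 pnatr_eq0.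
Qed.

(* A path of edges starting at the half-edge [idx 0]; the signs of the basis
   vectors are absorbed in [u]. *)
Definition chain (m : nat) (u : nat -> 'rV[R]_n) (a : nat -> 'I_n) (idx : nat -> 'I_n.+1) :=
  [/\ forall j, (j < m)%N -> exists2 s, s = 1 \/ s = -1 & u j = s *: e_ (a j),
      forall i j, (i < m)%N -> (j < m)%N -> a i = a j -> i = j,
      al (idx 0%N) = - u 0%N
    & forall j, (j.+1 < m)%N -> al (idx j.+1) = u j - u j.+1].

Definition handcuff N (u : nat -> 'rV[R]_n) (idx : nat -> 'I_n.+1) (i : 'I_n.+1) :=
  [/\ forall j l, (j < n)%N -> (l < n)%N -> dot (u j) (u l) = (j == l)%:R,
      al (idx 0%N) = - u 0%N,
      forall j, (j.+1 < n)%N -> al (idx j.+1) = u j - u j.+1,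
      al i = u n.-1 + u (n - N)%N
    & forall l, l = i \/ exists2 j, (j < n)%N & l = idx j].

Lemma chain_dot m u a idx : chain m u a idx ->
  forall j l, (j < m)%N -> (l < m)%N -> dot (u j) (u l) = (j == l)%:R.
Proof.
move=> [hu ha _ _] j l jm lm; have [s hs uj] := hu j jm.
have [<-|jl] := eqVneq j l; first by rewrite uj !dotrE dot_ee eqxx mulr1 -expr2 pm1_sqr.
have [t ht ul] := hu l lm; rewrite uj ul !dotrE dot_ee.
case: eqP => [/ha e|_]; last by rewrite !mulr0.
by rewrite e // eqxx in jl.
Qed.

Lemma chain_le m u a idx : chain m u a idx -> (m <= n)%N.
Proof.
move=> [_ ha _ _]; rewrite -[m]card_ord -[n]card_ord.
apply: (leq_card (fun i : 'I_m => a i)) => i j /ha e; apply: val_inj.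
exact: e.
Qed.

Lemma chain_sum m u a idx : chain m u a idx -> forall j, (j < m)%N ->
  \sum_(l < j.+1) al (idx l) = - u j.
Proof.
move=> [_ _ h0 hS]; elim=> [_|j IH jm]; first by rewrite big_ord1.
by rewrite big_ord_recr /= IH ?(ltnW jm) // hS // addrA addNr sub0r.
Qed.

Lemma sum_indicator (i : 'I_n.+1) : \sum_l (l == i)%:R *: al l = al i.
Proof.
rewrite (bigD1 i) //= eqxx scale1r big1 ?addr0 // => l /negbTE ->.
by rewrite scale0r.
Qed.

Lemma sum_indicators (I : finType) (p : pred I) (f : I -> 'I_n.+1) :
  \sum_l (\sum_(m | p m) (l == f m)%:R) *: al l = \sum_(m | p m) al (f m).
Proof.
under eq_bigr do rewrite scaler_suml.
by rewrite exchange_big /=; apply: eq_bigr => m _; exact: sum_indicator.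
Qed.

(** A facet with positive inner product with the free end [u m] is a half-edge there, leads to a new
    node, or returns to an old one. The first case and a balanced return are impossible; an
    unbalanced return uses up all facets. *)
Lemma chain_extend m u a idx : chain m.+1 u a idx ->
  (exists u' a' idx', chain m.+2 u' a' idx') \/
  exists N idx' i, (2 <= N <= n)%N /\ handcuff N u idx' i.
Proof.
move=> hc; have [hu ha h0 hS] := hc; have ud := chain_dot hc; have us := chain_sum hc.
have [s hs um] := hu m (ltnSn m).
have last_dot : dot (al (idx m)) (u m) = -1.
  case: m hc hu ha hS ud us um => [|m] hc hu ha hS ud us um.
    by rewrite h0 dotNl ud // eqxx.
  rewrite hS // dotBl !ud // eqxx (_ : (m == m.+1) = false) ?sub0r //; lia.
have idx_le j : (j <= m)%N -> dot (al (idx j)) (u m) <= 0.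
  case: j => [|j] jm; first by rewrite h0 dotNl ud // oppr_le0 ler0n.
  rewrite hS // dotBl !ud // ?(ltnW jm) //; last by lia.
  have -> : (j == m) = false by lia.
  by rewrite sub0r oppr_le0 ler0n.
have [mu mu0 mur] := al_relation.
(* In the positive relation paired with [u m], facet [idx m] contributes a negative term, so some
   other term is positive. *)
have [i ipos] : exists i, 0 < dot (al i) (u m).
  apply: contrapT => none; have neg l : dot (al l) (u m) <= 0.
    by rewrite leNgt; apply/negP => h; apply: none; exists l.
  have := congr1 (fun v => dot v (u m)) mur; rewrite dot0l dot_suml (bigD1 (idx m)) //=.
  rewrite dotZl last_dot mulrN1 => /eqP; rewrite addrC subr_eq0 => /eqP h.
  have := mu0 (idx m); rewrite -h ltNge; apply/negP; rewrite negbK.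
  by apply: sumr_le0 => l _; rewrite dotZl pmulr_rle0.
have ineq j : (j <= m)%N -> idx j != i.
  by move=> /idx_le h; apply: contraTneq ipos => <-; rewrite -leNgt.
move: (ipos); rewrite {1}um => /(root_pos_dot (al_root i) hs).
rewrite -um => -[[aE aa]|[c [t [cm ht aE aa]]]].
  (* A second half-edge: [al i = u m] is minus the sum of the chain. All facets of the chain contain
     the vertex opposite to [i], so the value of [al i] there is a sum of integer levels. *)
  exfalso; apply: (short_level_nonint aa).
  have -> : dot (al i) (vertex P i) = - \sum_(j < m.+1) dot (al (idx j)) (vertex P i).
    by rewrite -dot_suml us // dotNl opprK aE.
  rewrite rpredN rpred_sum // => j _; rewrite al_vertex // eq_sym ineq //.
  by rewrite -ltnS.
have [[j jm cj]|new] := pselect (exists2 j, (j <= m)%N & c = a j); last first.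
  left; exists (fun l => if (l <= m)%N then u l else - t *: e_ c),
    (fun l => if (l <= m)%N then a l else c), (fun l => if (l <= m)%N then idx l else i).
  split.
  - move=> l lm; case: ifP => h; first by exact: hu.
    by exists (- t) => //; case: ht => ->; [right | left; rewrite opprK].
  - move=> p q pm qm; case: ifP => hp; case: ifP => hq.
    + exact: ha.
    + by move=> e; exfalso; apply: new; exists p.
    + by move=> e; exfalso; apply: new; exists q.
    + by move=> _; lia.
  - exact: h0.
  - move=> l lm; have -> : (l <= m)%N by lia.
    case: ifP => h; first by exact: hS.
    have -> : l = m by lia.
    by rewrite aE scaleNr opprK.
right; have jm' : (j < m)%N.
  rewrite ltn_neqAle jm andbT; apply: contra_neq cm => <-; exact: cj.
have [s' hs' uj] := hu j (leqW jm').
have teq : t *: e_ c = u j \/ t *: e_ c = - u j.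
  rewrite uj cj -scaleNr; case: ht => ->; case: hs' => ->; rewrite ?opprK; auto.
have norm_idx0 : dot (al (idx 0%N)) (al (idx 0%N)) = 1.
  by rewrite h0 dotNl dotNr opprK ud // eqxx.
have norm_idxS l : (l < m)%N -> dot (al (idx l.+1)) (al (idx l.+1)) = 2.
  move=> lm; rewrite hS // !dotrE !ud // ?(ltnW lm) //; try lia.
  have -> : (l == l.+1) = false by lia.
  have -> : (l.+1 == l) = false by lia.
  by rewrite !eqxx /=; ring.
have one2 : (1 : R) <> 2 by move=> h; have : (1 : R) = 2 := h; lra.
(* A balanced cycle: [al i = u m - u j] cancels against the edges after node [j], a nontrivial
   relation that misses the half-edge [idx 0]. *)
case: teq => tE; last first.
  exfalso; pose cc l : R := (l == i)%:R + \sum_(p < m.+1 | (j < p)%N) (l == idx p)%:R.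
  have rel : \sum_l cc l *: al l = 0.
    rewrite /cc; under eq_bigr do rewrite scalerDl.
    rewrite big_split /= sum_indicator (sum_indicators _ (fun p : 'I_m.+1 => idx p)) aE tE.
    have := us m (ltnSn m); rewrite (bigID (fun p : 'I_m.+1 => (p < j.+1)%N)) /=.
    rewrite -(big_ord_widen m.+1 (fun p => al (idx p))); last by lia.
    rewrite us; last by lia.
    under eq_bigl do rewrite -leqNgt.
    move=> /eqP; rewrite addrC -subr_eq0 opprK => /eqP e.
    by rewrite -[RHS]e; move: (\sum_(_ < _ | _) _) => S; apply/rowP => q; rewrite !mxE; ring.
  have c0 : cc (idx 0%N) = 0.
    rewrite /cc (negbTE (ineq 0%N _)) // add0r big1 // => p jp.
    case: eqP => // e; exfalso; case: p jp e => -[//|p] pm jp /= e.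
    by have := norm_idx0; rewrite e norm_idxS // => h; exact: one2 (esym h).
  have := al_circuit rel i c0; rewrite /cc eqxx => /eqP.
  by rewrite gt_eqF // ltr_pwDl // sumr_ge0.
(* An unbalanced cycle: [al i = u m + u j] cancels against the partial sums of the chain up to [m]
   and up to [j]. A facet missing from this relation is excluded by [al_circuit], and counting the
   facets gives [m.+1 = n]. *)
pose cc l : R := (l == i)%:R + (\sum_(p < m.+1) (l == idx p)%:R + \sum_(p < j.+1) (l == idx p)%:R).
have rel : \sum_l cc l *: al l = 0.
  rewrite /cc; under eq_bigr do rewrite !scalerDl.
  rewrite !big_split /= sum_indicator (sum_indicators _ (fun p : 'I_m.+1 => idx p)).
  rewrite (sum_indicators _ (fun p : 'I_j.+1 => idx p)) !us //.
  by rewrite aE tE; apply/rowP => q; rewrite !mxE; ring.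
have ci : cc i <> 0.
  by apply/eqP; rewrite gt_eqF // /cc eqxx ltr_pwDl // addr_ge0 // sumr_ge0.
have cover l : l = i \/ exists2 p, (p < m.+1)%N & l = idx p.
  have [->|li] := eqVneq l i; first by left.
  right; apply: contrapT => none; apply: ci; apply: (al_circuit rel (i := l)).
  rewrite /cc (negbTE li) !big1 ?addr0 // => p _; case: eqP => // e; exfalso; apply: none.
    by exists p => //; have := ltn_ord p; lia.
  by exists p.
have mn : m.+1 = n.
  apply/eqP; rewrite eqn_leq (chain_le hc) /=.
  have : (#|'I_n.+1| <= #|{: option 'I_m.+1}|)%N; last by rewrite card_option !card_ord.
  have /choice[f hf] : forall l, exists x : option 'I_m.+1,
      l = if x is Some p then idx p else i.
    move=> l; case: (cover l) => [->|[p pm ->]]; first by exists None.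
    by exists (Some (Ordinal pm)).
  by apply: (leq_card f) => l l' e; rewrite (hf l) e -hf.
exists (n - j)%N, idx, i; split; first by lia.
split => //.
- by move=> p q pn qn; apply: ud; lia.
- by move=> p pn; apply: hS; lia.
- by rewrite aE tE; congr (u _ + u _); lia.
- by move=> l; case: (cover l) => [|[p pm lE]]; [left | right; exists p => //; lia].
Qed.

Lemma handcuff_exists : exists N u idx i, (2 <= N <= n)%N /\ handcuff N u idx i.
Proof.
have [i0 aa] := short_facet.
have [c [s [hs]]] := root_form (al_root i0); case=> [[aE _]|[? [? [_ _ _]]]]; last first.
  by rewrite aa => h; exfalso; have : (1 : R) = 2 := h; lra.
have start : chain 1 (fun=> - al i0) (fun=> c) (fun=> i0).
  split => //; last by rewrite opprK.
    move=> j _; exists (- s); first by case: hs => ->; [right | left; rewrite opprK].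
    by rewrite aE scaleNr.
  by move=> [|i] [|j].
suff main d : forall m u a idx, (n - m)%N = d -> chain m.+1 u a idx ->
    exists N u idx i, (2 <= N <= n)%N /\ handcuff N u idx i.
  exact: (main _ 0%N _ _ _ erefl start).
elim/ltn_ind: d => d IH m u a idx dE hc.
have mn := chain_le hc.
case: (chain_extend hc) => [[u' [a' [idx' hc']]]|[N [idx' [i [hN h]]]]].
  apply: (IH (n - m.+1)%N _ m.+1 u' a' idx') => //; lia.
by exists N, u, idx', i.
Qed.

Lemma handcuff_gram N u idx i : (2 <= N <= n)%N -> handcuff N u idx i ->
  gram_equiv P (Qs N).
Proof.
move=> hN [ud h0 hS hi cover].
(* The order is reversed because the half-edge is at node 0 of the chain but at coordinate [n.-1] of
   the standard simplex. *)
pose U : 'M[R]_n := \matrix_(r < n) u (n.-1 - r)%N.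
have UU : U *m U^T = 1%:M.
  apply/matrixP => r q; rewrite mxE.
  transitivity (dot (row r U) (row q U)).
    by rewrite dotE; apply: eq_bigr => l _; rewrite !mxE.
  have := ltn_ord r; have := ltn_ord q => hq hr.
  rewrite !rowK ud ?mxE; try lia.
  by congr (_%:R); congr nat_of_bool; rewrite -val_eqE /=; lia.
have EU r : (r < n)%N -> E r *m U = u (n.-1 - r)%N.
  move=> rn; have -> : E r = e_ (Ordinal rn) by apply/rowP => l; rewrite !mxE eqxx.
  by rewrite -rowE rowK.
have EUn : E n *m U = 0.
  by rewrite (_ : E n = 0) ?mul0mx //; apply/rowP => l; rewrite !mxE ltn_eqF.
pose sg (m : 'I_n.+1) := if val m == 0%N then i else idx (n - m)%N.
have alE m : al (sg m) = A N m *m U.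
  rewrite /sg; case: m => -[|m] mn /=.
    rewrite hi /std_root mulmxDl !EU; try lia.
    by rewrite subn0; congr (_ + u _); lia.
  rewrite /std_root mulmxBl (EU m); last by lia.
  have [e|ne] := eqVneq m.+1 n.
    have -> : E m.+1 = E n by rewrite e.
    rewrite EUn sub0r (_ : (n - m.+1)%N = 0%N); last by lia.
    by rewrite h0; congr (- u _); lia.
  rewrite EU; last by lia.
  have [q qE] : exists q, (n - m.+1)%N = q.+1 by exists (n - m.+2)%N; lia.
  rewrite qE hS; last by lia.
  by congr (u _ - u _); lia.
have /choice[g sgg] : forall l, exists m, sg m = l.
  move=> l; case: (cover l) => [->|[j jn ->]].
    by exists ord0.
  exists (inord (n - j)%N); rewrite /sg /= inordK; last by lia.
  have -> : (n - j == 0)%N = false by lia.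
  by congr idx; lia.
have [h gh hg] := injF_bij (can_inj sgg).
have sgi : injective sg.
  move=> x y; rewrite -(hg x) -(hg y) !sgg => ->//.
exists sg => // x y _; rewrite /gram.
have nE m : outward_normal P (sg m) = outward_normal (Qs N) m *m U.
  rewrite std_simplex_normal // normalE alE -scalemxAl; congr (_ *: _).
  have := outward_normal_unit n0 P (sg m); rewrite normalE alE !dotrE (dot_mulmx _ _ UU) mul1r.
  have a0 : A N m != 0 by exact: (root_neq0 (std_root_is_root R hn hN m)).
  have e0 := enorm_gt0 a0; rewrite -sqr_enorm mulrA -expr2 -exprMn => /eqP.
  rewrite sqrf_eq1 => /orP[/eqP e|/eqP e]; first by rewrite -[RHS]mul1r -e mulfK // gt_eqF.
  by have := mulr_gt0 (lam_gt0 (sg m)) e0; rewrite e oppr_gt0 ltr10.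
by rewrite !nE (dot_mulmx _ _ UU) mul1r.
Qed.

Lemma facets_classify : exists2 N, (2 <= N <= n)%N & gram_equiv P (Qs N).
Proof.
have [N [u [idx [i [hN h]]]]] := handcuff_exists; exists N => //.
exact: handcuff_gram hN h.
Qed.

End Facets.

Lemma affine_image_exists (Am : 'M[R]_n) b r (P : simplex R n) :
  0 < r -> Am *m Am^T = (r ^+ 2)%:M -> exists P', affine_image Am b r id P P'.
Proof.
move=> r0 hA; have [A1 A2] := sim_mulmxV r0 hA.
have ind (t : 'I_n.+1 -> R) : \sum_i t i = 0 ->
    \sum_i t i *: (vertex P i *m Am + b) = 0 -> forall i, t i = 0.
  move=> t0; under eq_bigr do rewrite scalerDr scalemxAl.
  rewrite big_split /= -scaler_suml t0 scale0r addr0 -mulmx_suml => h.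
  apply: (@vertex_affine_independent _ _ P t t0).
  by have := congr1 (fun v => v *m (r ^- 2 *: Am^T)) h; rewrite -mulmxA A1 mulmx1 mul0mx.
by exists (Simplex ind); split.
Qed.

Lemma chamber_data_classify (P : simplex R n) : chamber_data P (Qs 2) ->
  exists2 N, (2 <= N <= n)%N & gram_equiv P (Qs N).
Proof.
move=> [_ GD av]; have h2 := two_le_n hn.
have GQ (i : 'I_n.+1) : reflection_group P (rfl (A 2 i) (lev i)).
  by rewrite -std_simplex_frefl.
have /choice[h hb] : forall i : 'I_n.+1, exists h, 0 < h /\
    forall x, dot (A 2 i) x - lev i = - h * bary (Qs 2) i x.
  by move=> i; have [h h0 hh] := std_simplex_bary R hn h2 i; exists h.
have rootP i : root_hyperplane (bdir P i) (- bary P i 0).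
  apply: (@mirror_root _ _ (Qs 2) (fun i => A 2 i) (fun i => lev i) h (reflection_group P)).
  - by move=> j; exact: std_root_is_root.
  - by move=> j; exact: std_level_int.
  - by move=> j; case: (hb j).
  - by move=> j; case: (hb j).
  - by move=> f g; exact: gen_comp.
  - exact: GQ.
  - exact: av.
  - exact: bdir_neq0.
  - exact: reflection_group_frefl.
have /choice[q hq] : forall i, exists q : 'rV[R]_n * R * R,
    [/\ is_root q.1.1, q.1.2 \is a Num.int, 0 < q.2, outward_normal P i = q.2 *: q.1.1 &
      (frefl P i = rfl q.1.1 q.1.2) /\
      forall j, j != i -> dot q.1.1 (vertex P j) = q.1.2].
  move=> i; have [a [t [m [ra t0 mi bE kE]]]] := rootP i.
  (* The outward normal is a negative multiple of the gradient [t *: a], so [s *: a] is the outward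
     one of the two roots. *)
  pose s : R := - Num.sg t.
  have hs : s = 1 \/ s = -1.
    by rewrite /s; case: sgrP t0 => //; rewrite ?opprK; auto.
  have s0 : s != 0 by case: hs => ->; rewrite ?oppr_eq0 oner_eq0.
  have ss : s * s = 1 by rewrite -expr2 pm1_sqr.
  have ep := enorm_bdir_gt0 n0 P i.
  have st : - t = `|t| * s by rewrite /s mulrN; congr (- _); rewrite {1}(numEsg t) mulrC.
  exists (s *: a, s * m, `|t| / enorm (bdir P i)); split => /=.
  - case: ra => ia aa; split; first by apply: intvZ => //; exact: pm1_int.
    by rewrite !dotrE mulrA ss mul1r.
  - by rewrite rpredM // pm1_int.
  - by rewrite divr_gt0 // normr_gt0.
  - rewrite outward_normalE // {2}bE !scalerA; congr (_ *: _).
    by rewrite mulNr -mulrN st; ring.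
  split; first by rewrite rflZ // /frefl bE kE rflZ.
  move=> j ji; rewrite dotZl; congr (_ * _); apply: (mulfI t0).
  rewrite -kE -dotZl -bE.
  have := bary_vertex P i j; rewrite baryE eq_sym (negbTE ji) => /eqP.
  by rewrite addrC addr_eq0 => /eqP.
apply: (@facets_classify P (fun i => (q i).1.1) (fun i => (q i).1.2) (fun i => (q i).2)) => //.
- by move=> i; case: (hq i).
- by move=> i; case: (hq i).
- by move=> i; case: (hq i).
- by move=> i; case: (hq i).
- by move=> i; case: (hq i) => _ _ _ _ [].
- by move=> i; case: (hq i) => _ _ _ _ [].
Qed.

Lemma generates_classify (P : simplex R n) : generates_Btilde P ->
  exists2 N, (2 <= N <= n)%N & gram_equiv P (Qs N).
Proof.
move=> [dG [D [_ [s hs]] cD]].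
have h2 := two_le_n hn.
have DQ : gram_equiv D (Qs 2).
  exists s; first exact: perm_inj.
  move=> i j ij; have [k [k2 ang mE]] := hs i j ij.
  apply: oppr_inj; rewrite -!cos_dihedral // ang std_simplex2_angle // mE.
  by rewrite subnK.
have [Am [b [r [s' him]]]] := gram_equiv_affine n0 DQ.
have [r0 hA _ _] := him.
have [P' hP'] := affine_image_exists b P r0 hA.
have cd : chamber_data P D by apply/(chamber_dataP n0).
have [N hN hg] := chamber_data_classify (chamber_data_affine n0 hP' him cd).
exists N => //; apply: gram_equiv_trans hg; apply: gram_equiv_sym => //.
by exists id => // i j _; rewrite (gram_affine n0 hP').
Qed.

End Classification.

(** * Counting *)

Section Final.
Variables (R : realType) (n : nat).
Hypothesis hn : (3 <= n)%N.
Let n0 : (0 < n)%N := ltnW (ltnW hn).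
Local Notation A := (@std_root R n).
Local Notation Qs := (@std_simplex R n hn).

Lemma gamma_facetsP N (P : simplex R n) : (2 <= N <= n)%N ->
  (exists lab : option 'I_n -> 'I_n.+1, gamma_facets N P lab) <-> gram_equiv P (Qs N).
Proof.
move=> hN.
have [lab' l1 l2] : bijective (@lab_std n).
  apply: inj_card_bij; first exact: (lab_std_inj hn).
  by rewrite card_option !card_ord.
split=> [[lab [[inv li1 li2] h]]|[s si hs]].
  exists (lab \o lab'); first exact: inj_comp (can_inj li1) (can_inj l2).
  move=> i j ij /=; apply: oppr_inj; rewrite -!cos_dihedral //; congr cos.
  have ij' : lab' i != lab' j by rewrite (can_eq l2).
  by rewrite h // -(std_simplex_gamma R hn hN ij') !l2.
have sb := injF_bij si.
exists (s \o @lab_std n); split; first by apply: bij_comp => //; exists lab'.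
move=> x y xy; rewrite -(std_simplex_gamma R hn hN xy) /dihedral_angle /=; congr (_ - acos _).
by apply: hs; rewrite (inj_eq (lab_std_inj hn)).
Qed.

(** Such an equality is a nontrivial relation with coefficient 0 at a third facet, which the
    uniqueness of the relation forbids. *)
Lemma normals_not_parallel (P : simplex R n) i j (e : R) : i != j -> (e = 1 \/ e = -1) ->
  outward_normal P i <> e *: outward_normal P j.
Proof.
move=> ij he h; pose c l : R := (l == i)%:R - e * (l == j)%:R.
have rel : \sum_l c l *: outward_normal P l = 0.
  rewrite (bigD1 i) //= (bigD1 j) 1?eq_sym //= big1 => [|l /andP[li lj]].
    rewrite /c !eqxx (negbTE ij) eq_sym (negbTE ij) mulr0 subr0 scale1r sub0r mulr1.
    by rewrite addr0 h scaleNr subrr.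
  by rewrite /c (negbTE li) (negbTE lj) mulr0 subrr scale0r.
have [a ha] := normal_circuit n0 rel.
have [l li lj] : exists2 l : 'I_n.+1, l != i & l != j.
  pose m := if (i != 0%N :> nat) && (j != 0%N :> nat) then 0%N
    else if (i != 1%N :> nat) && (j != 1%N :> nat) then 1%N else 2%N.
  have mn : (m < n.+1)%N by rewrite /m; do 2?[case: ifP => _ //]; lia.
  by exists (Ordinal mn); rewrite -val_eqE /= /m; do 2?[case: ifP => //]; lia.
have := ha l; rewrite /c (negbTE li) (negbTE lj) mulr0 subrr => /esym/eqP.
rewrite mulf_eq0 (gt_eqF (enorm_bdir_gt0 n0 P l)) orbF => /eqP a0.
have := ha i; rewrite /c eqxx (negbTE ij) mulr0 subr0 a0 mul0r => /eqP.
by rewrite oner_eq0.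
Qed.

(* The outward normals of both simplices satisfy the same linear relation up to
   scaling, with positive coefficients, so all the signs agree. *)
Lemma family_gram (P Q : simplex R n) : family P Q -> gram_equiv Q P.
Proof.
move=> fam.
have /choice[q hq] : forall i, exists q : 'I_n.+1 * R, (q.2 = 1 \/ q.2 = -1) /\
    outward_normal Q q.1 = q.2 *: outward_normal P i.
  move=> i; have : facet_normals_pm P (outward_normal P i) by exists i; left.
  rewrite -(fam : facet_normals_pm Q = _) => -[j [e|e]].
    by exists (j, 1); split; [left | rewrite e scale1r].
  by exists (j, -1); split; [right | rewrite e scaleN1r opprK].
pose s i := (q i).1; pose e i := (q i).2.
have he i : e i = 1 \/ e i = -1 by case: (hq i).
have sE i : outward_normal Q (s i) = e i *: outward_normal P i by case: (hq i).
have ee i : e i * e i = 1 by rewrite -expr2 pm1_sqr.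
have si : injective s.
  move=> i j ij; apply/eqP; apply: contraT => ne; exfalso.
  have := sE i; rewrite ij sE => h.
  apply: (@normals_not_parallel P i j (e i * e j) ne).
    by case: (he i) => ->; case: (he j) => ->; rewrite ?mulrNN ?mulr1 ?mul1r; auto.
  by rewrite -scalerA h scalerA ee scale1r.
exists s => // i j _.
have [t st ts] := injF_bij si.
have [a ha] : exists a, forall i, enorm (bdir Q (s i)) * e i = a * enorm (bdir P i).
  apply: (normal_circuit n0); rewrite -[RHS](normal_relation n0 Q) [RHS](reindex_inj si) /=.
  by apply: eq_bigr => l _; rewrite sE scalerA.
have same : e i = e j.
  have hi := ha i; have hj := ha j.
  have := enorm_bdir_gt0 n0 P i; have := enorm_bdir_gt0 n0 P j.
  have := enorm_bdir_gt0 n0 Q (s i); have := enorm_bdir_gt0 n0 Q (s j).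
  move: hi hj; move: (enorm _) (enorm (bdir P i)) (enorm (bdir Q (s j))) (enorm (bdir P j)).
  move=> x y z w; case: (he i) => ->; case: (he j) => -> //; rewrite ?mulr1 ?mulrN1; nra.
by rewrite /gram !sE !dotrE mulrA same ee mul1r.
Qed.

Lemma gram_generates N (P : simplex R n) : (2 <= N <= n)%N ->
  gram_equiv P (Qs N) -> generates_Btilde P.
Proof.
move=> hN /(gram_equiv_sym) /(gram_equiv_affine n0)[Am [b [r [s him]]]].
have [r0 hA _ _] := him.
have [D hD] := affine_image_exists b (Qs 2) r0 hA.
have cd := chamber_data_affine n0 him hD (std_simplex_chamber_data R hn hN).
have [dG cD] := iffLR (chamber_dataP n0 P D) cd.
have ang i j : i != j -> dihedral_angle D i j = pi / (Btilde_mult n i j + 2)%:R.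
  move=> ij; rewrite -(std_simplex2_angle R hn ij) /dihedral_angle.
  by congr (_ - acos _); exact: (gram_affine n0 hD).
split => //; exists D => //; split.
  by move=> i j ij; exists (Btilde_mult n i j + 2)%N; [lia | exact: ang].
exists 1%g => i j ij; rewrite !perm1; exists (Btilde_mult n i j + 2)%N; split.
- by lia.
- exact: ang.
- by rewrite addnK.
Qed.

(** The inverse altitudes are the square root of 2 for [i < N], twice that for [N <= i < n], and 2
    for [i = n]. Thus [N] counts the minimal coefficients of the relation between the normals. *)
Lemma bdir_std_simplex N (i : 'I_n.+1) : (2 <= N <= n)%N ->
  if (i < N)%N then enorm (bdir (Qs N) i) = Num.sqrt 2
  else Num.sqrt 2 < enorm (bdir (Qs N) i).
Proof.
move=> hN.
have aE := facet_bdir (fun j ji => std_simplex_on R hn hN ji : dot (A N i) (vertex (Qs N) j) = std_level R i).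
set d := dot (A N i) (vertex (Qs N) i) - std_level R i in aE.
have d0 : d < 0 by rewrite subr_lt0; exact: std_simplex_off.
have eE : enorm (bdir (Qs N) i) = (- d)^-1 * enorm (A N i).
  by rewrite aE enormZ ltr0_norm // mulKf // oppr_eq0 lt_eqF.
have dE : - d = if (i < N)%N then 1 else 2^-1.
  rewrite /d opprB; case: i {d d0 aE eE} => -[|i] il /=.
    rewrite dot_root_vertex0 // /std_level eqxx subr0; have -> : (0 < N)%N by lia.
    by [].
  by rewrite dot_root_vertexS // eqxx mulr1 /std_level /= sub0r opprK.
have s0 : 0 < Num.sqrt 2 :> R by rewrite sqrtr_gt0.
have s2 : Num.sqrt 2 ^+ 2 = 2 :> R by rewrite sqr_sqrtr.
move: dE; case: ifP => h dE; rewrite eE dE.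
  by rewrite invr1 mul1r /enorm dot_root_long //; lia.
rewrite invrK; have [e|ne] := eqVneq (nat_of_ord i) n.
  rewrite e /enorm dot_root_short // sqrtr1 mulr1; nra.
by rewrite /enorm dot_root_long //; [lra | have := ltn_ord i; lia].
Qed.

Lemma std_simplex_gram_le N N' : (2 <= N <= n)%N -> (2 <= N' <= n)%N ->
  gram_equiv (Qs N) (Qs N') -> (N' <= N)%N.
Proof.
move=> hN hN' /(gram_equiv_affine n0)[Am [b [r [s him]]]].
have [r0 hA si _] := him.
have rel i : enorm (bdir (Qs N') i) = r^-1 * enorm (bdir (Qs N) (s i)).
  rewrite (bdir_affine him) enormZ /enorm (dot_mulmx _ _ hA) sqrtrM ?sqr_ge0 //.
  rewrite sqrtr_sqr (gtr0_norm r0) ger0_norm ?invr_ge0 ?sqr_ge0 //.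
  by field; rewrite gt_eqF.
have s0 : 0 < Num.sqrt 2 :> R by rewrite sqrtr_gt0.
have ge M (i : 'I_n.+1) : (2 <= M <= n)%N -> Num.sqrt 2 <= enorm (bdir (Qs M) i).
  by move=> hM; have := bdir_std_simplex i hM; case: ifP => _ => [->//|/ltW].
have [t st ts] := injF_bij si.
(* Both relations have smallest coefficient [Num.sqrt 2], attained at facet 0. The similarity
   therefore has ratio 1 and sends minimal coefficients to minimal ones. *)
have r1 : r^-1 = 1.
  have hi : Num.sqrt 2 <= r^-1 * Num.sqrt 2.
    have := ge N' (t ord0) hN'; rewrite rel ts.
    by have := bdir_std_simplex (ord0 : 'I_n.+1) hN; rewrite (_ : (ord0 < N)%N) => [->|] //=; lia.
  have lo : r^-1 * Num.sqrt 2 <= Num.sqrt 2.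
    have := bdir_std_simplex (ord0 : 'I_n.+1) hN'; rewrite (_ : (ord0 < N')%N); last by rewrite /=; lia.
    rewrite rel => e; rewrite -[X in _ <= X]e ler_wpM2l ?ge // invr_ge0 ltW //.
  by apply: (mulIf (lt0r_neq0 s0)); rewrite mul1r; apply/eqP; rewrite eq_le hi lo.
have maps (i : 'I_n.+1) : (i < N')%N -> (s i < N)%N.
  move=> iN; have := bdir_std_simplex i hN'; rewrite iN rel r1 mul1r => e.
  by have := bdir_std_simplex (s i) hN; rewrite e; case: ifP => // _; rewrite ltxx.
have [M NE] : exists M, N = M.+1 by exists N.-1; lia.
rewrite -[N']card_ord [X in (_ <= X)%N]NE -[M.+1]card_ord.
have lt (x : 'I_N') : (x < n.+1)%N by have := ltn_ord x; lia.
apply: (leq_card (fun x : 'I_N' => inord (s (Ordinal (lt x))) : 'I_M.+1)) => x y e.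
have mx (z : 'I_N') : (s (Ordinal (lt z)) < M.+1)%N by rewrite -NE; apply: maps => /=; exact: ltn_ord.
have : s (Ordinal (lt x)) = s (Ordinal (lt y)).
  by apply: val_inj; have := congr1 val e; rewrite /= !inordK.
by move/si/(congr1 val) => /= h; apply: val_inj.
Qed.

Lemma std_simplex_gram_inj N N' : (2 <= N <= n)%N -> (2 <= N' <= n)%N ->
  gram_equiv (Qs N) (Qs N') -> N = N'.
Proof.
move=> hN hN' h; apply/eqP; rewrite eqn_leq; apply/andP; split.
  exact: std_simplex_gram_le hN' hN (gram_equiv_sym h).
exact: std_simplex_gram_le hN hN' h.
Qed.

Lemma gamma_family_diagram N (P : simplex R n) (lab : option 'I_n -> 'I_n.+1) :
  gamma_facets N P lab -> forall x y, x != y ->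
  family_diagram P (lab x) (lab y) (gamma_mult N x y).
Proof.
move=> [_ h] x y xy; move: (h x y xy); rewrite /family_diagram.
have E2 z : z = pi / 2 -> exists k, [/\ (2 <= k)%N,
    z = pi / k%:R \/ z = pi * (k - 1)%:R / k%:R & 0%N = (k - 2)%N] :> Prop.
  by move=> ->; exists 2%N; split => //; left.
have E3 z : z = pi / 3 \/ z = 2 * pi / 3 -> exists k, [/\ (2 <= k)%N,
    z = pi / k%:R \/ z = pi * (k - 1)%:R / k%:R & 1%N = (k - 2)%N] :> Prop.
  by case=> ->; exists 3%N; split => //; [left | right; rewrite [pi * _]mulrC].
have E4 z : z = pi / 4 -> exists k, [/\ (2 <= k)%N,
    z = pi / k%:R \/ z = pi * (k - 1)%:R / k%:R & 2%N = (k - 2)%N] :> Prop.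
  by move=> ->; exists 4%N; split => //; left.
case: x y xy => [e|] [e'|] //= _.
- case: ifP => [c|/negbFE c] zE; first by rewrite (negbTE c); exact: E2.
  by rewrite c; apply: E3; rewrite zE; case: ifP => _; auto.
- by case: ifP => _; [exact: E4 | exact: E2].
- by case: ifP => _; [exact: E4 | exact: E2].
Qed.

End Final.

Theorem theorem2 (R : realType) (n : nat) (hn : (3 <= n)%N) :
  ([set similarity_class P | P in [set P : simplex R n | generates_Btilde P]]
     #= `I_n.-1)%card
  /\
  exists F : nat -> set (simplex R n),
    [/\ forall N : nat, (2 <= N <= n)%N ->
          is_family (F N) /\ (forall P, F N P -> generates_Btilde P),
        forall P : simplex R n, generates_Btilde P ->
          exists! N : nat, (2 <= N <= n)%N /\ (exists2 Q, F N Q & similar P Q),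
        forall (N : nat) (P : simplex R n), (2 <= N <= n)%N ->
          ((exists2 Q, F N Q & similar P Q) <->
           exists lab : option 'I_n -> 'I_n.+1, gamma_facets N P lab)
      & forall (N : nat) (P : simplex R n) (lab : option 'I_n -> 'I_n.+1),
          (2 <= N <= n)%N -> gamma_facets N P lab ->
          forall x y, x != y ->
            family_diagram P (lab x) (lab y) (gamma_mult N x y)].
Proof.
have n0 : (0 < n)%N by apply: leq_trans hn.
pose Q N := std_simplex R hn N.
have famE N (P : simplex R n) : (exists2 T, family (Q N) T & similar P T) <-> gram_equiv P (Q N).
  split=> [[T /(family_gram hn) TQ /(similarP n0) PT]|h]; first exact: gram_equiv_trans TQ.
  by exists (Q N) => //; apply/(similarP n0).
have classE (P T : simplex R n) : gram_equiv P T -> similarity_class P = similarity_class T.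
  move=> h; apply/seteqP; split=> S /(similarP n0) h'; apply/(similarP n0).
    exact: gram_equiv_trans (gram_equiv_sym h) h'.
  exact: gram_equiv_trans h h'.
split.
  (* The index [k < n.-1] stands for the parameter [N = k.+2]. *)
  have -> : [set similarity_class P | P in [set P : simplex R n | generates_Btilde P]] =
      (fun k => similarity_class (Q k.+2)) @` `I_n.-1.
    apply/seteqP; split=> [_ [P /= gP <-]|_ [k /= kn <-]].
      have [N hN h] := generates_classify hn gP.
      exists (N - 2)%N; first by rewrite /=; lia.
      have -> : (N - 2).+2 = N by lia.
      by apply/esym/classE.
    exists (Q k.+2) => //=; apply: (@gram_generates _ _ hn k.+2); first by lia.
    exact: gram_equiv_refl.
  apply: inj_card_eq => k l /set_mem /= kn /set_mem /= ln e.
  suff : k.+2 = l.+2 by case.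
  apply: (@std_simplex_gram_inj R n hn); try lia.
  apply/(similarP n0); have : similarity_class (Q l.+2) (Q l.+2).
    by apply/(similarP n0); exact: gram_equiv_refl.
  by rewrite -e.
exists (fun N => family (Q N)); split.
- move=> N hN; split; first by exists (Q N).
  by move=> P /(family_gram hn); exact: gram_generates.
- move=> P gP; have [N hN h] := generates_classify hn gP.
  exists N; split; first by split => //; apply/famE.
  move=> N' [hN' /famE h']; apply: (std_simplex_gram_inj hN hN').
  exact: gram_equiv_trans (gram_equiv_sym h) h'.
- by move=> N P hN; rewrite famE (gamma_facetsP hn P hN).
- by move=> N P lab _; exact: gamma_family_diagram.
Qed.
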